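(* There exist an absolute constant $C>0$ and a bandit algorithm $\mathbb{A}$, which takes as input the time horizon $T$, an action set $\mathcal{A}\subseteq\mathbb{R}^d$ and the parameter $\rho$ (and has no knowledge of $\theta^\star$), such that for every integer $T\ge2$, every $\rho\in(0,1]$, every $d\ge1$ and every infinite action set $\mathcal{A}\subseteq\mathbb{R}^d$ with $\sup_{a\in\mathcal{A}}\|a\|_2\le1$ the following hold. (i) $\mathbb{A}$ is $\rho$-replicable for the stochastic $d$-dimensional linear bandit problem with action set $\mathcal{A}$ and horizon $T$. (ii) For every $\theta^\star\in\mathbb{R}^d$ with $\|\theta^\star\|_2\le1$ (and every admissible noise), the expected regret satisfies $$\mathbf{E}[R_T]\le C\cdot\frac{d^4\,\log(d)\,\bigl(\log\log(d)\bigr)^2\,\log\log\log(d)}{\rho^2}\,\sqrt{T}\,\log^{3/2}(T),$$ where each of the factors $\log(d)$, $\log\log(d)$, $\log\log\log(d)$ is read as $1$ whenever it is undefined or smaller than $1$. (iii) The running time of $\mathbb{A}$ is polynomial in $T^d$ and $1/\rho$.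
   Context: Stochastic linear bandits: each arm is a vector $a$ in a known action set $\mathcal{A}\subseteq\mathbb{R}^d$ (possibly infinite), and there is a parameter $\theta^\star\in\mathbb{R}^d$ unknown to the player, with $\|\theta^\star\|_2\le1$ and $\sup_{a\in\mathcal{A}}\|a\|_2\le1$. In round $t=1,\dots,T$ the player chooses $a_t\in\mathcal{A}$ and receives the reward $r_t=\langle\theta^\star,a_t\rangle+\eta_t$, where $\eta_t$ is a zero-mean 1-subgaussian random variable (i.e. $\mathbf{E}[\eta_t]=0$ and $\mathbf{E}[\exp(\lambda\eta_t)]\le\exp(\lambda^2/2)$ for all $\lambda\in\mathbb{R}$), independent of any other source of randomness. A bandit algorithm chooses $a_t=\mathbb{A}(a_1,r_1,\dots,a_{t-1},r_{t-1};\xi)$ as a function of the past arm-reward pairs and of internal randomness $\xi$ (independent of the noise). Expected regret: $\mathbf{E}[R_T]=T\sup_{a\in\mathcal{A}}\langle\theta^\star,a\rangle-\mathbf{E}\left[\sum_{t=1}^T\langle\theta^\star,a_t\rangle\right]$. Replicability: $\mathbb{A}$ is $\rho$-replicable if, for any $\theta^\star\in\mathbb{R}^d$ with $\|\theta^\star\|_2\le1$ and any noise variables $\eta_t$ that are zero-mean, 1-subgaussian and independent of any other source of randomness, and for two executions of $\mathbb{A}$ that share the same internal randomness $\xi$ but have independent reward (noise) realizations, $$\Pr\left[(a_1^{(1)},\dots,a_T^{(1)})=(a_1^{(2)},\dots,a_T^{(2)})\right]\ge1-\rho,$$ where $a_t^{(i)}$ is the action taken at round $t$ in execution $i$ and the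 probability is over $\xi$ and the rewards of both executions. $\log$ is the natural logarithm. Running time counts elementary operations (arithmetic operations and comparisons on real numbers, and draws of internal random numbers); the algorithm has access to $\mathcal{A}$ through a deterministic $1/T$-net of it, i.e. a finite set $\mathcal{A}'\subseteq\mathcal{A}$ of size at most $(3T)^d$ such that every $a\in\mathcal{A}$ has some $a'\in\mathcal{A}'$ with $\|a-a'\|_2\le1/T$. *)

(* Defs.v *)
From HB Require Import structures.
From mathcomp Require Import all_boot all_order all_algebra.
From mathcomp Require Import all_classical all_reals all_analysis.

Set Implicit Arguments.
Unset Strict Implicit.
Unset Printing Implicit Defensive.

Import Order.TTheory GRing.Theory Num.Theory.
Import numFieldNormedType.Exports.

Local Open Scope classical_set_scope.
Local Open Scope ring_scope.

(* The norm that MathComp-Analysis puts on 'rV[R]_d is the sup norm, hence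
   these definitions. *)
Definition dot (R : realType) (d : nat) (u v : 'rV[R]_d) : R :=
  \sum_(i < d) u ord0 i * v ord0 i.

Definition l2norm (R : realType) (d : nat) (u : 'rV[R]_d) : R :=
  Num.sqrt (dot u u).

(* An algorithm maps the internal randomness xi and the past
   [:: (a_1, r_1); ...; (a_t, r_t)] to the next arm a_(t+1), which is played in
   round number t, rounds being numbered from 0. *)
Definition policy (R : realType) (d : nat) : Type :=
  (nat -> R) -> seq ('rV[R]_d * R) -> 'rV[R]_d.

Fixpoint history (R : realType) (d : nat) (alg : policy R d)
    (theta : 'rV[R]_d) (xi eta : nat -> R) (t : nat) : seq ('rV[R]_d * R) :=
  if t is t'.+1 then
    let h := history alg theta xi eta t' in
    let a := alg xi h in
    rcons h (a, dot theta a + eta t')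
  else [::].

Definition actions (R : realType) (d : nat) (alg : policy R d)
    (theta : 'rV[R]_d) (xi eta : nat -> R) (T : nat) : seq 'rV[R]_d :=
  [seq ar.1 | ar <- history alg theta xi eta T].

Definition mutually_independent (R : realType) (d0 : measure_display)
    (Omega : measurableType d0) (P : probability Omega R) (I : eqType)
    (X : I -> {RV P >-> R}) : Prop :=
  forall (J : seq I) (B : I -> set R), uniq J ->
    (forall i, measurable (B i)) ->
    P (\bigcap_(i in [set` J]) (X i @^-1` B i)) =
    (\prod_(i <- J) P (X i @^-1` B i))%E.

Definition uniform01 (R : realType) (d0 : measure_display)
    (Omega : measurableType d0) (P : probability Omega R)
    (X : {RV P >-> R}) : Prop :=
  forall B : set R, measurable B ->
    distribution P X B = uniform_prob (@ltr01 R) B.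

Definition same_law (R : realType) (d0 : measure_display)
    (Omega : measurableType d0) (P : probability Omega R)
    (X Y : {RV P >-> R}) : Prop :=
  forall B : set R, measurable B -> distribution P X B = distribution P Y B.

Definition zero_mean_1_subgaussian (R : realType) (d0 : measure_display)
    (Omega : measurableType d0) (P : probability Omega R)
    (X : {RV P >-> R}) : Prop :=
  'E_P[X]%E = 0%E /\
  forall lambda : R, ('M_P X lambda <= (expR (lambda ^+ 2 / 2))%:E)%E.

(* The internal randomness is a sequence of uniform draws from [0, 1].  Of the
   noise sequence only the entries eta t with t < T are constrained (and
   used). *)
Definition one_execution (R : realType) (d0 : measure_display)
    (Omega : measurableType d0) (P : probability Omega R) (T : nat)
    (xi eta : nat -> {RV P >-> R}) : Prop :=
  [/\ forall k, uniform01 (xi k),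
      forall t, (t < T)%N -> zero_mean_1_subgaussian (eta t) &
      mutually_independent (fun s : nat + 'I_T =>
        match s with inl k => xi k | inr t => eta t end)].

(* eta1 and eta2 are independent realizations of the same noise. *)
Definition two_executions (R : realType) (d0 : measure_display)
    (Omega : measurableType d0) (P : probability Omega R) (T : nat)
    (xi eta1 eta2 : nat -> {RV P >-> R}) : Prop :=
  [/\ forall k, uniform01 (xi k),
      forall t, (t < T)%N ->
        zero_mean_1_subgaussian (eta1 t) /\ same_law (eta1 t) (eta2 t) &
      mutually_independent (fun s : nat + ('I_T + 'I_T) =>
        match s with
        | inl k => xi k
        | inr (inl t) => eta1 t
        | inr (inr t) => eta2 t
        end)].

Definition replicable (R : realType) (d : nat) (alg : policy R d) (T : nat)
    (rho : R) : Prop :=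
  forall (theta : 'rV[R]_d), l2norm theta <= 1 ->
  forall (d0 : measure_display) (Omega : measurableType d0)
    (P : probability Omega R) (xi eta1 eta2 : nat -> {RV P >-> R}),
    two_executions T xi eta1 eta2 ->
    ((1 - rho)%:E <= P [set w |
       actions alg theta (xi ^~ w) (eta1 ^~ w) T =
       actions alg theta (xi ^~ w) (eta2 ^~ w) T])%E.

Definition expected_regret (R : realType) (d : nat) (A : set 'rV[R]_d)
    (alg : policy R d) (T : nat) (theta : 'rV[R]_d) (d0 : measure_display)
    (Omega : measurableType d0) (P : probability Omega R)
    (xi eta : nat -> {RV P >-> R}) : \bar R :=
  ((T%:R * sup [set dot theta a | a in A])%:E -
   'E_P[fun w =>
     (\sum_(a <- actions alg theta (xi ^~ w) (eta ^~ w) T) dot theta a)%R])%E.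

(* ln x = 0 for x <= 0 in MathComp-Analysis, so that an undefined iterated
   logarithm is read as 1 here. *)
Definition log_1 (R : realType) (d : nat) : R := Num.max 1 (ln d%:R).
Definition log_2 (R : realType) (d : nat) : R := Num.max 1 (ln (ln d%:R)).
Definition log_3 (R : realType) (d : nat) : R := Num.max 1 (ln (ln (ln d%:R))).

(* N lists, without repetition, a 1/T-net of A. *)
Definition is_net (R : realType) (d : nat) (T : nat) (A : set 'rV[R]_d)
    (N : seq 'rV[R]_d) : Prop :=
  [/\ uniq N, (size N <= (3 * T) ^ d)%N, [set` N] `<=` A &
      forall a, A a -> exists2 a', a' \in N & l2norm (a - a') <= T%:R^-1].

(* A real RAM: a structured program over two unbounded memories with indirect
   addressing, one of natural numbers (indices) and one of real numbers.
   There is no rounding of reals and no multiplication of indices, which would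
   make unit-cost machines unreasonably powerful; the only constants of a
   program are natural numbers. *)

Inductive real_op := RAdd | RSub | RMul | RDiv.

(* a, b, c are addresses of index cells and x, y, z of real cells. *)
Inductive instr :=
| ILit (a n : nat)
| IAdd (a b c : nat)
| ISub (a b c : nat)
| ILoad (a b : nat)
| IStore (a b : nat)
| RLit (x n : nat)
| ROp (op : real_op) (x y z : nat)
| RLoad (x a : nat)
| RStore (a x : nat)
| RDraw (x : nat)
| RArm (x a b : nat)
| RPlay (a x : nat).

Inductive test := ILe (a b : nat) | RLe (x y : nat).

Inductive cmd :=
| Skip
| Do (i : instr)
| Seq (p q : cmd)
| If (c : test) (p q : cmd)
| While (c : test) (p : cmd).

Record state (R : realType) (d : nat) := State {
  imem : nat -> nat;
  rmem : nat -> R;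
  drawn : nat;                 (* number of internal draws so far *)
  plays : seq ('rV[R]_d * R)   (* arms played and rewards received so far *)
}.

Definition eval_op (R : realType) (op : real_op) (x y : R) : R :=
  match op with
  | RAdd => x + y
  | RSub => x - y
  | RMul => x * y
  | RDiv => x / y
  end.

Definition eval_test (R : realType) (d : nat) (c : test) (s : state R d)
    : bool :=
  match c with
  | ILe a b => (imem s a <= imem s b)%N
  | RLe x y => rmem s x <= rmem s y
  end.

Definition set_idx (R : realType) (d : nat) (s : state R d) (a n : nat)
    : state R d :=
  State [eta imem s with a |-> n] (rmem s) (drawn s) (plays s).

Definition set_real (R : realType) (d : nat) (s : state R d) (x : nat) (v : R)
    : state R d :=
  State (imem s) [eta rmem s with x |-> v] (drawn s) (plays s).

(* One instruction, when the arms are those of N, the k-th internal draw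
   returns xi k and the t-th play returns the reward r t.  None stands for an
   invalid access: an arm not in N or a coordinate that does not exist. *)
Definition step (R : realType) (d : nat) (N : seq 'rV[R]_d) (xi r : nat -> R)
    (i : instr) (s : state R d) : option (state R d) :=
  match i with
  | ILit a n => Some (set_idx s a n)
  | IAdd a b c => Some (set_idx s a (imem s b + imem s c)%N)
  | ISub a b c => Some (set_idx s a (imem s b - imem s c)%N)
  | ILoad a b => Some (set_idx s a (imem s (imem s b)))
  | IStore a b => Some (set_idx s (imem s a) (imem s b))
  | RLit x n => Some (set_real s x n%:R)
  | ROp op x y z => Some (set_real s x (eval_op op (rmem s y) (rmem s z)))
  | RLoad x a => Some (set_real s x (rmem s (imem s a)))
  | RStore a x => Some (set_real s (imem s a) (rmem s x))
  | RDraw x =>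
      let s' := set_real s x (xi (drawn s)) in
      Some (State (imem s') (rmem s') (drawn s).+1 (plays s'))
  | RArm x a b =>
      if (imem s a < size N)%N then
        if insub (imem s b) is Some j
        then Some (set_real s x (nth 0 N (imem s a) ord0 (j : 'I_d)))
        else None
      else None
  | RPlay a x =>
      if (imem s a < size N)%N then
        let rew := r (size (plays s)) in
        let s' := set_real s x rew in
        Some (State (imem s') (rmem s') (drawn s')
                (rcons (plays s) (nth 0 N (imem s a), rew)))
      else None
  end.

(* exec N xi r p s s' n: from the state s, the program p halts in the state s'
   after n elementary operations (instructions and tests). *)
Inductive exec (R : realType) (d : nat) (N : seq 'rV[R]_d) (xi r : nat -> R)
    : cmd -> state R d -> state R d -> nat -> Prop :=
| ExecSkip s : exec N xi r Skip s s 0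
| ExecDo i s s' : step N xi r i s = Some s' -> exec N xi r (Do i) s s' 1
| ExecSeq p q s s' s'' m n :
    exec N xi r p s s' m -> exec N xi r q s' s'' n ->
    exec N xi r (Seq p q) s s'' (m + n)
| ExecIfTrue c p q s s' n :
    eval_test c s -> exec N xi r p s s' n -> exec N xi r (If c p q) s s' n.+1
| ExecIfFalse c p q s s' n :
    ~~ eval_test c s -> exec N xi r q s s' n ->
    exec N xi r (If c p q) s s' n.+1
| ExecWhileTrue c p s s' s'' m n :
    eval_test c s -> exec N xi r p s s' m ->
    exec N xi r (While c p) s' s'' n ->
    exec N xi r (While c p) s s'' (m + n).+1
| ExecWhileFalse c p s :
    ~~ eval_test c s -> exec N xi r (While c p) s s 1.

(* The input: T, d and the number of arms in the index cells 0, 1, 2, and rho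
   in the real cell 0.  The arms are read with RArm. *)
Definition init (R : realType) (d : nat) (T : nat) (N : seq 'rV[R]_d) (rho : R)
    : state R d :=
  State [eta (fun=> 0%N) with 0%N |-> T, 1%N |-> d, 2%N |-> size N]
        [eta (fun=> 0) with 0%N |-> rho] 0 [::].

(* Whatever the internal draws and the rewards are, the program makes exactly
   T plays, which are those of alg, and halts after at most time operations. *)
Definition computes_within (R : realType) (d : nat) (p : cmd) (T : nat)
    (N : seq 'rV[R]_d) (rho : R) (alg : policy R d) (time : R) : Prop :=
  forall xi r : nat -> R, (forall k, 0 <= xi k <= 1) ->
  exists (s : state R d) (n : nat),
    [/\ exec N xi r p (init T N rho) s n,
        size (plays s) = T,
        forall t, (t < T)%N ->
          nth (0, 0) (plays s) t = (alg xi (take t (plays s)), r t) &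
        n%:R <= time].

(* Main.v *)
(* Phased elimination on a deterministic schedule: in phase l a barycentric
   spanner of the active arms is computed and each of its d elements is played
   4 ^ l times.  The empirical means are within beta_l, of order 2 ^ - l, of the
   true ones with high probability.  They are rounded to a grid of width
   alpha_l = 3 K beta_l shifted by a random offset, common to both executions,
   with K possible values.  At most one offset puts a cell boundary within beta_l
   of a given true mean; otherwise both executions, as well as the noiseless one,
   round to the same value, so they make the same eliminations and play the same
   arms.  A union bound over the d slots of at most log T phases gives
   replicability when K is about d log T / rho.  The rounded estimates have error
   O(d alpha_l), and summing over the phases gives the regret.

   The spanner is found by pivoting on entries of absolute value above 2 from the
   artificial basis e_j / T; each pivot doubles a determinant, which stays
   bounded, so d (d + T) pivots suffice. *)

Require Import Defs.
From mathcomp Require Import all_boot all_order all_algebra.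
From mathcomp Require Import all_classical all_reals all_analysis.
From mathcomp Require Import measurable_realfun perm zify ring lra.

Set Implicit Arguments.
Unset Strict Implicit.
Unset Printing Implicit Defensive.

Import Order.TTheory GRing.Theory Num.Theory.
Import numFieldNormedType.Exports.

Local Open Scope classical_set_scope.
Local Open Scope ring_scope.

(** Because the schedule is deterministic, the noise of a slot is a sum over a fixed set of rounds,
    and Chernoff bounds apply although the arms are chosen adaptively. The spanner leaves only d
    numbers per phase to be rounded, whatever the size of the net. The active arms may fail to span
    the space; the artificial vectors e_j / T fill the gap and get the value 0, an error of at most
    1/T each. The two executions are never compared directly: each is compared with the noiseless
    run, a function of the offsets alone. The offset of a phase is independent of the earlier ones,
    which fix the noiseless state, so that bounding the probability of a bad offset is a matter of
    counting. The regret bound on good noise holds for every value of the offsets. The confidence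
    radius is about the square root of a linear expression in log T, d and 1/rho, within reach of
    simple loops of the machine. The regret is then of order d^3 rho^(-3/2) sqrt(T) log(T)^(3/2),
    which lies below the stated bound. *)

Definition upd (X : Type) (f : nat -> X) (i : nat) (x : X) : nat -> X :=
  fun k => if k == i then x else f k.

(** * Barycentric spanners by pivoting *)

Section Spanner.
Variables (R : realType) (d : nat) (N : seq 'rV[R]_d).

Definition arm (k : nat) : 'rV[R]_d := nth 0 N k.

Definition rv_coord (u : 'rV[R]_d) (j : nat) : R :=
  if insub j is Some i then u ord0 (i : 'I_d) else 0.

(* A tableau (tb, bs): bs j is 0 for the artificial basis vector e_j / T and
   k.+1 for arm k; tb k j is the j-th coordinate of arm k in that basis. *)
Definition tableau : Type := ((nat -> nat -> R) * (nat -> nat))%type.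

(** Entries are tested through their squares, which avoids a case distinction on the sign; a later
    hit replaces an earlier one, as in a loop without early exit. *)
Definition search_row (tb : nat -> nat -> R) (k : nat)
    (acc : option (nat * nat)) : option (nat * nat) :=
  iteri d (fun j acc => if tb k j * tb k j <= 4 then acc else Some (k, j)) acc.

Definition search (act : nat -> bool) (tb : nat -> nat -> R) :
    option (nat * nat) :=
  iteri (size N) (fun k acc => if act k then search_row tb k acc else acc) None.

(** Gauss-Jordan exchange: basis vector [i] leaves and arm [p] enters, which requires [x.1 p i] to
    be nonzero. *)
Definition pivot (x : tableau) (p i : nat) : tableau :=
  (fun k j => let f := x.1 k i / x.1 p i in
              if j == i then f else x.1 k j - x.1 p j * f,
   upd x.2 i p.+1).

Definition span_step (act : nat -> bool) (x : tableau) : tableau :=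
  if search act x.1 is Some pi then pivot x pi.1 pi.2 else x.

Definition tab_span (T fuel : nat) (act : nat -> bool) : tableau :=
  iter fuel (span_step act) (fun k j => rv_coord (arm k) j * T%:R, fun=> 0%N).

Lemma search_rowP tb k acc :
  match search_row tb k acc with
  | None => acc = None /\ forall j, (j < d)%N -> tb k j * tb k j <= 4
  | Some pi => acc = Some pi \/
      [/\ pi.1 = k, (pi.2 < d)%N & 4 < tb k pi.2 * tb k pi.2]
  end.
Proof.
rewrite /search_row; elim: {1 2 3}d => [|n IHn] /=.
  by case: acc => [pi|]; [left|].
case: lerP => hj; last by right; split.
case: (iteri _ _ _) IHn => [pi [->|[-> h1 h2]]|[-> h]]; [by left| |].
  by right; split => //; exact: ltnW.
by split=> // j; rewrite ltnS leq_eqVlt => /orP[/eqP->|/h].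
Qed.

Lemma searchP act tb :
  match search act tb with
  | None => forall k j, (k < size N)%N -> act k -> (j < d)%N ->
      tb k j * tb k j <= 4
  | Some pi => [/\ (pi.1 < size N)%N, act pi.1, (pi.2 < d)%N &
      4 < tb pi.1 pi.2 * tb pi.1 pi.2]
  end.
Proof.
rewrite /search; elim: {1 2 3}(size N) => [|n IHn] //=.
case: ifPn => an.
  have := search_rowP tb n (iteri n
    (fun k acc => if act k then search_row tb k acc else acc) None).
  case: (search_row _ _ _) => [pi|].
    case=> [h|[h1 h2 h3]]; last by rewrite h1.
    by move: IHn; rewrite h => -[? ? ? ?]; split=> //; exact: ltnW.
  case=> h; rewrite h in IHn => hn k j.
  by rewrite ltnS leq_eqVlt => /orP[/eqP->//|]; [move=> _; exact: hn|exact: IHn].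
case: (iteri _ _ _) IHn => [pi [h1 h2 h3 h4]|IHn].
  by split=> //; exact: ltnW.
move=> k j; rewrite ltnS leq_eqVlt => /orP[/eqP->|]; [by rewrite (negbTE an)|].
exact: IHn.
Qed.

Definition basis_vec (T : nat) (bs : nat -> nat) (j : 'I_d) : 'rV[R]_d :=
  if bs j is k.+1 then arm k else T%:R^-1 *: delta_mx 0 j.

Definition basis_mx T bs : 'M[R]_d := \matrix_(j < d) basis_vec T bs j.

Definition represents (T : nat) (x : tableau) : Prop :=
  forall k, (k < size N)%N ->
    arm k = \sum_(j < d) x.1 k j *: basis_vec T x.2 j.

Lemma represents_mx T (x : tableau) k : (k < size N)%N -> represents T x ->
  arm k = (\row_j x.1 k j) *m basis_mx T x.2.
Proof.
move=> kN /(_ k kN) {1}->; rewrite mulmx_sum_row; apply: eq_bigr => j _.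
by rewrite rowK mxE.
Qed.

Lemma coord_ord u (j : 'I_d) : rv_coord u j = u ord0 j.
Proof. by rewrite /rv_coord valK. Qed.

Lemma represents0 T : (0 < T)%N ->
  represents T (fun k j => rv_coord (arm k) j * T%:R, fun=> 0%N).
Proof.
move=> T0 k _ /=; rewrite {1}[arm k]row_sum_delta; apply: eq_bigr => j _.
rewrite /basis_vec /= scalerA coord_ord mulfK // pnatr_eq0; lia.
Qed.

Lemma represents_pivot T (x : tableau) p (i : 'I_d) : (p < size N)%N -> x.1 p i != 0 ->
  represents T x -> represents T (pivot x p i).
Proof.
move=> pN nz rx k kN.
have bvi : basis_vec T (pivot x p i).2 i = arm p.
  by rewrite /basis_vec /= /upd eqxx.
have bvj j : j != i ->
    basis_vec T (pivot x p i).2 j = basis_vec T x.2 j.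
  by move=> ji; rewrite /basis_vec /= /upd (inj_eq val_inj) (negbTE ji).
rewrite (bigD1 i) //= eqxx bvi.
under eq_bigr => j ji do rewrite (inj_eq val_inj) (negbTE ji) bvj // scalerBl.
rewrite sumrB.
under [X in _ + (_ - X)]eq_bigr => j _ do rewrite [_ * (_ / _)]mulrC -scalerA.
rewrite -scaler_sumr.
have := rx p pN; rewrite (bigD1 i) //= => Ep.
have := rx k kN; rewrite (bigD1 i) //= => {1}->.
by rewrite {1}Ep scalerDr scalerA divfK // addrACA subrr addr0.
Qed.

(** Cramer's rule: only row [i] changes, so its cofactors are those of the old basis [B], and
    [arm p *m \adj B] is the coordinate row of arm [p] times [\det B]. *)
Lemma det_pivot T (x : tableau) p (i : 'I_d) : (p < size N)%N -> represents T x ->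
  \det (basis_mx T (pivot x p i).2) = x.1 p i * \det (basis_mx T x.2).
Proof.
move=> pN rx; set B := basis_mx T x.2.
rewrite (expand_det_row _ i).
have cof j : cofactor (basis_mx T (pivot x p i).2) i j = cofactor B i j.
  rewrite /cofactor; congr (_ * \det _); apply/matrixP => a b.
  by rewrite !mxE /basis_vec /= /upd eq_sym (negbTE (neq_bump _ _)).
have -> : \sum_j basis_mx T (pivot x p i).2 i j *
    cofactor (basis_mx T (pivot x p i).2) i j = (arm p *m \adj B) ord0 i.
  rewrite mxE; apply: eq_bigr => j _; rewrite cof [\adj _ _ _]mxE.
  by rewrite mxE /basis_vec /= /upd eqxx.
rewrite (represents_mx pN rx) -mulmxA mul_mx_adj.
by rewrite mul_mx_scalar !mxE mulrC.
Qed.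

Lemma fact_le_expn n m : (n <= m)%N -> (n`! <= m ^ n)%N.
Proof.
elim: n => [|n IH] nm; first by rewrite expn0.
by rewrite factS expnS leq_mul // IH // ltnW.
Qed.

Lemma det_le_fact n (B : 'M[R]_n) : (forall i j, `|B i j| <= 1) ->
  `|\det B| <= (n`!)%:R.
Proof.
move=> hB; rewrite /determinant.
apply: (le_trans (ler_norm_sum _ _ _)).
have -> : (n`!)%:R = \sum_(s : 'S_n) (1 : R).
  by rewrite sumr_const card_Sn.
apply: ler_sum => s _; rewrite normrM normrX normrN1 expr1n mul1r normr_prod.
by apply: prodr_ile1 => i _; rewrite normr_ge0 hB.
Qed.

Lemma coord_le_l2norm (u : 'rV[R]_d) j : `|u ord0 j| <= l2norm u.
Proof.
rewrite /l2norm -sqrtr_sqr ler_wsqrtr // /dot (bigD1 j) //= expr2 lerDl.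
by apply: sumr_ge0 => i _; rewrite -expr2 sqr_ge0.
Qed.

Definition unit_arms := forall a, a \in N -> l2norm a <= 1.

(** Used twice: basis vectors have entries bounded by 1, which bounds the determinant, and slots
    only play active arms. *)
Definition in_basis (act : nat -> bool) (bs : nat -> nat) : Prop :=
  forall j, bs j = 0%N \/ exists k, [/\ bs j = k.+1, (k < size N)%N & act k].

Lemma in_basis_step act (x : tableau) :
  in_basis act x.2 -> in_basis act (span_step act x).2.
Proof.
move=> h; rewrite /span_step; have := searchP act x.1.
case: (search _ _) => [[p i] /= [pN ap _ _] j|//]; rewrite /upd.
by case: eqP => _; [right; exists p | exact: h].
Qed.

Lemma span_in_basis T fuel act : in_basis act (tab_span T fuel act).2.
Proof.
by rewrite /tab_span; elim: fuel => [|n IH]; [move=> j; left | exact: in_basis_step].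
Qed.

Lemma represents_step T act (x : tableau) : represents T x -> represents T (span_step act x).
Proof.
move=> h; rewrite /span_step; have := searchP act x.1.
case: (search _ _) => [[p i] /= [pN ap id hc]|//].
apply: (@represents_pivot T x p (Ordinal id)) => //=.
by apply/eqP => e; move: hc; rewrite e mul0r => /lt_trans/(_ (ltr0Sn _ 3)); rewrite ltxx.
Qed.

Lemma span_represents T fuel act : (0 < T)%N ->
  represents T (tab_span T fuel act).
Proof.
move=> T0; rewrite /tab_span; elim: fuel => [|n IH]; first exact: represents0.
exact: represents_step.
Qed.

Lemma span_bounded T (act : nat -> bool) : (0 < d)%N -> (0 < T)%N -> unit_arms ->
  forall k j, (k < size N)%N -> act k -> (j < d)%N ->
  `|(tab_span T (d * (d + T)) act).1 k j| <= 2.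
Proof.
move=> d0 T0 uN.
set x0 : tableau := (fun k j => rv_coord (arm k) j * T%:R, fun=> 0%N).
set xs := fun n => iter n (span_step act) x0.
have rxs n : represents T (xs n).
  by elim: n => [|n IH]; [exact: represents0 | exact: represents_step].
have detle n : `|\det (basis_mx T (xs n).2)| <= (d`!)%:R.
  apply: det_le_fact => i j; rewrite mxE /basis_vec.
  have : in_basis act (xs n).2 by exact: (span_in_basis T n act).
  move=> /(_ i) [->|[k [-> kN _]]].
    rewrite !mxE eqxx /= normrM ger0_norm ?invr_ge0 ?ler0n //.
    apply: mulr_ile1; rewrite ?invr_ge0 ?ler0n ?normr_ge0 //.
      by rewrite invf_le1 ?ler1n ?ltr0n.
    by case: eqP; rewrite ?normr1 ?normr0.
  by apply: le_trans (coord_le_l2norm _ _) _; apply: uN; exact: mem_nth.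
(* A failed search is a fixed point of [span_step], so the first alternative persists. In the
   second, each step multiplies the initial determinant T^-d by an entry of absolute value above
   2. *)
have keyP n : search act (xs n).1 = None \/
    2 ^+ n * T%:R ^- d <= `|\det (basis_mx T (xs n).2)|.
  elim: n => [|n IH].
    right; rewrite expr0 mul1r.
    have -> : basis_mx T (xs 0%N).2 = (T%:R^-1)%:M.
      by apply/matrixP => i j; rewrite !mxE eqxx /= eq_sym mulr_natr.
    by rewrite det_scalar exprVn ger0_norm // invr_ge0 exprn_ge0.
  have -> : xs n.+1 = span_step act (xs n) by [].
  rewrite /span_step; have := searchP act (xs n).1.
  case sE : (search act (xs n).1) IH => [[p i]|] IH /=; last by left.
  case: IH => // IH [pN ap id hc]; right.
  rewrite -[i]/(Ordinal id : nat) det_pivot //= normrM exprS -mulrA.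
  apply: ler_pM => //.
  have : 4 < `|(xs n).1 p i| ^+ 2 by rewrite -normrX ger0_norm ?sqr_ge0 ?expr2.
  by move: (normr_ge0 ((xs n).1 p i)) => ?; nra.
have sN : search act (xs (d * (d + T))%N).1 = None.
  case: (keyP (d * (d + T))%N) => // h; exfalso.
  have := le_trans h (detle _); apply/negP; rewrite -ltNge.
  (* Origin of the number of steps: d! T^d <= d^d T^d < (2^d)^d (2^T)^d = 2^(d(d+T)). *)
  rewrite ltr_pdivlMr ?exprn_gt0 ?ltr0n //.
  rewrite -!natrX -natrM ltr_nat mulnDr expnD !expnM (expnAC _ d T).
  have h1 : (d`! <= d ^ d)%N.
    exact: fact_le_expn.

  have h2 : (d ^ d < (2 ^ d) ^ d)%N by rewrite ltn_exp2r // ltn_expl.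
  have h3 : (T ^ d <= (2 ^ T) ^ d)%N by rewrite leq_exp2r // ltnW // ltn_expl.
  apply: (leq_ltn_trans (leq_mul h1 h3)).
  by rewrite ltn_pmul2r // expn_gt0 expn_gt0.
move=> k j kN ak jd.
have := searchP act (xs (d * (d + T))%N).1; rewrite sN => /(_ k j kN ak jd).
rewrite -expr2 -real_normK ?num_real // => h.
rewrite -/(xs (d * (d + T))%N).
by move: (normr_ge0 ((xs (d * (d + T))%N).1 k j)) => ?; nra.
Qed.

End Spanner.

(** * The algorithm *)

Section Schedule.
Variable d : nat.
Local Open Scope nat_scope.

Definition sched (l : nat) : nat := d * \sum_(i < l) 4 ^ i.

(** The sum s of the 4^i for i < l satisfies 3 s + 1 = 4^l, so for d > 0 round t has reached phase l
    exactly when 4^l <= 3 (t %/ d) + 1. *)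
Definition phase_of (t : nat) : nat := trunc_log 4 (3 * (t %/ d)).+1.

Definition slot_of (t : nat) : nat :=
  (t - sched (phase_of t)) %/ 4 ^ phase_of t.

Lemma sched0 : sched 0 = 0.
Proof. by rewrite /sched big_ord0 muln0. Qed.

Lemma schedS l : sched l.+1 = sched l + d * 4 ^ l.
Proof. by rewrite /sched big_ord_recr /= mulnDr. Qed.

Lemma sum_pow4 l : 3 * (\sum_(i < l) 4 ^ i) + 1 = 4 ^ l.
Proof.
elim: l => [|l IH]; first by rewrite big_ord0.
by rewrite big_ord_recr /= mulnDr addnAC IH expnS; lia.
Qed.

Lemma sched_mul3 l : 3 * sched l + d = d * 4 ^ l.
Proof. by rewrite /sched mulnCA -{2}[d]muln1 -mulnDr sum_pow4. Qed.

Lemma leq_sched l l' : l <= l' -> sched l <= sched l'.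
Proof.
by elim: l' => [|l' IH]; rewrite leq_eqVlt => /orP[/eqP->//|] //; rewrite ltnS schedS => /IH; lia.
Qed.

Hypothesis d0 : 0 < d.

Lemma phase_ofP t : sched (phase_of t) <= t < sched (phase_of t).+1.
Proof.
rewrite /phase_of.
have /andP[h1 h2] := @trunc_log_bounds 4 (3 * (t %/ d)).+1 isT isT.
move: h1 h2; set l := trunc_log _ _ => h1 h2.
have := sum_pow4 l; have := sum_pow4 l.+1; rewrite /sched.
set a := \sum_(i < l) _; set b := \sum_(i < l.+1) _ => e1 e2.
apply/andP; split.
  by rewrite mulnC -leq_divRL //; lia.
by rewrite mulnC -ltn_divLR //; lia.
Qed.

Lemma phase_of_uniq t l : sched l <= t < sched l.+1 -> phase_of t = l.
Proof.
move=> /andP[h1 h2]; have /andP[h3 h4] := phase_ofP t.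
have [h|h|//] := ltngtP (phase_of t) l.
  by have := leq_sched h; lia.
by have := leq_sched h; lia.
Qed.

Lemma block_lt l j i : j < d -> i < 4 ^ l ->
  sched l + j * 4 ^ l + i < sched l.+1.
Proof.
move=> jd il; rewrite schedS -addnA ltn_add2l.
apply: (@leq_trans (j.+1 * 4 ^ l)); first by rewrite mulSn addnC ltn_add2r.
by rewrite leq_mul2r jd orbT.
Qed.

Lemma phase_of_block l j i : j < d -> i < 4 ^ l ->
  phase_of (sched l + j * 4 ^ l + i) = l.
Proof.
move=> jd il; apply: phase_of_uniq; rewrite block_lt // andbT.
by rewrite -addnA leq_addr.
Qed.

Lemma slot_of_block l j i : j < d -> i < 4 ^ l ->
  slot_of (sched l + j * 4 ^ l + i) = j.
Proof.
move=> jd il; rewrite /slot_of phase_of_block // -addnA addKn.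
by rewrite divnMDl ?expn_gt0 // divn_small // addn0.
Qed.

End Schedule.

(** * Grid, elimination rule and policy *)

Section Algorithm.
Variables (R : realType) (d T : nat) (N : seq 'rV[R]_d) (K b0 : nat).

Local Notation nN := (size N).

Definition beta (l : nat) : R := b0%:R / 2 ^+ l.
(** Spacing of the offsets. It exceeds 2 [beta], so that two different offsets cannot both have a
    boundary within [beta] of the same mean. *)
Definition delta (l : nat) : R := 3 * beta l.
Definition alpha (l : nat) : R := K%:R * delta l.
(** Twice the error 4 d alpha of an estimate, so that a best arm passes the elimination test. *)
Definition tau (l : nat) : R := 8 * d%:R * alpha l.

(** At most -1 for all offsets up to [K], because [delta l * K] is [alpha l]. The form [0 - 1]
    follows the order in which the machine computes it. *)
Definition start (l kk : nat) : R := 0 - 1 - alpha l + delta l * kk%:R.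
Definition grid (l kk z : nat) : R := start l kk + alpha l * z%:R.
(** The clamp at 1 bounds the number of cells, hence the rounding time. Below [start] the quotient
    is negative and [truncn] returns 0, a clamp from the other side. *)
Definition cell (l kk : nat) (x : R) : nat :=
  Num.truncn ((Num.min x 1 - start l kk) / alpha l).

(* The set of active arms and an active arm, played in the slots of artificial
   basis vectors. *)
Definition pstate : Type := ((nat -> bool) * nat)%type.

Definition spanner (st : pstate) : tableau R := tab_span N T (d * (d + T)) st.1.

Definition slot_arm (st : pstate) (j : nat) : nat :=
  if (spanner st).2 j is k.+1 then k else st.2.

Definition est (tb : nat -> nat -> R) (v : nat -> R) (k : nat) : R :=
  \sum_(j < d) tb k j * v j.

Definition argbest (act : nat -> bool) (e : nat -> R) (b : nat) : nat :=
  iteri nN (fun k b => if act k && (e b <= e k) then k else b) b.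

Definition next_state (l : nat) (v : nat -> R) (st : pstate) : pstate :=
  let e := est (spanner st).1 v in
  let b := argbest st.1 e st.2 in
  (fun k => st.1 k && (e b <= e k + tau l), b).

(** The slot values are a parameter, so that the actual and the noiseless run are two instances and
    can be compared slot by slot. *)
Fixpoint run_phases (V : nat -> pstate -> nat -> R) (l : nat) : pstate :=
  if l is l'.+1 then let st := run_phases V l' in next_state l' (V l' st) st
  else (fun=> true, 0%N).

Definition slot_val (l kk : nat) (st : pstate) (z : nat -> nat) (j : nat) : R :=
  if (spanner st).2 j is _.+1 then grid l kk (z j) else 0.

(** The last phase may be cut at [T]. Its sums then run over the rounds actually played, as in the
    program; the state computed from them serves no round before [T]. *)
Definition block_sum (r : nat -> R) (l j : nat) : R :=
  \sum_(i < 4 ^ l | (sched d l + j * 4 ^ l + i < T)%N)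
    r (sched d l + j * 4 ^ l + i)%N.

(** For positive [K], the value [K] is reached only from [xi l = 1] on, an event of probability 0;
    [minn] makes the bound by [K] hold for every real draw. *)
Definition offset (xi : nat -> R) (l : nat) : nat :=
  minn K (Num.truncn (K%:R * xi l)).

Definition cells (kk : nat -> nat) (r : nat -> R) (l j : nat) : nat :=
  cell l (kk l) (block_sum r l j / (4 ^ l)%:R).

(** The run depends on draws and rewards only through the natural numbers [kk] and [z]; the
    measurability of the played indices rests on this. *)
Definition run_of (kk : nat -> nat) (z : nat -> nat -> nat) : nat -> pstate :=
  run_phases (fun l st => slot_val l (kk l) st (z l)).

Definition real_run (kk : nat -> nat) (r : nat -> R) : nat -> pstate :=
  run_of kk (cells kk r).

Definition index_at (st : nat -> pstate) (t : nat) : nat :=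
  slot_arm (st (phase_of d t)) (slot_of d t).

(** The run is recomputed from the past rewards, continued by 0 beyond the end of [h]; by
    [real_run_causal] this continuation does not affect the arm chosen. *)
Definition lin_alg : policy R d := fun xi h =>
  arm N (index_at (real_run (offset xi) (fun i => (nth (0, 0) h i).2)) (size h)).

Definition wf_state (st : pstate) : Prop := (st.2 < nN)%N /\ st.1 st.2.

Lemma argbestP (act : nat -> bool) e b : (b < nN)%N -> act b ->
  let b' := argbest act e b in
  [/\ (b' < nN)%N, act b' & forall k, (k < nN)%N -> act k -> e k <= e b'].
Proof.
move=> bN ab; suff H n : (n <= nN)%N ->
    let b' := iteri n (fun k b => if act k && (e b <= e k) then k else b) b in
    [/\ (b' < nN)%N, act b' & forall k, (k < n)%N -> act k -> e k <= e b'].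
  exact: H.
elim: n => [|n IH] nle /=; first by split.
have [h1 h2 h3] := IH (ltnW nle).
set b' := iteri _ _ _ in h1 h2 h3 *.
case: ifPn => [/andP[an le]|ng]; split=> // k; rewrite ltnS leq_eqVlt.
  by move=> /orP[/eqP->//|kn ak]; exact: le_trans (h3 _ kn ak) le.
move=> /orP[/eqP-> an|]; last exact: h3.
by move: ng; rewrite an /= -ltNge => /ltW.
Qed.

Lemma next_congr l v v' st : (forall j, (j < d)%N -> v j = v' j) ->
  next_state l v st = next_state l v' st.
Proof.
move=> h; rewrite /next_state.
suff -> : est (spanner st).1 v = est (spanner st).1 v' by [].
by apply/funext => k; apply: eq_bigr => j _; rewrite h.
Qed.

Lemma run_congr V V' n :
  (forall l j st, (l < n)%N -> (j < d)%N -> V l st j = V' l st j) ->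
  run_phases V n = run_phases V' n.
Proof.
elim: n => [//|n IH] h /=; rewrite IH; last by move=> l j st ln; apply: h; lia.
by apply: next_congr => j jd; apply: h.
Qed.

(** The blocks of the phases before [n] all lie in the rounds before [sched d n]. This reconciles
    the policy, which sees a prefix, with the run on the full reward sequence. *)
Lemma real_run_causal kk kk' r r' n : (forall l, (l < n)%N -> kk l = kk' l) ->
  (forall t, (t < sched d n)%N -> r t = r' t) ->
  real_run kk r n = real_run kk' r' n.
Proof.
move=> hk hr; apply: run_congr => l j st ln jd.
rewrite /slot_val hk //; case: (_ j) => // _.
congr (grid l _ _); rewrite /cells hk //; congr (cell _ _ (_ / _)).
apply: eq_bigr => i _; apply: hr.
exact: leq_trans (block_lt jd (ltn_ord i)) (leq_sched d ln).
Qed.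

Hypotheses (d0 : (0 < d)%N) (T0 : (0 < T)%N) (K0 : (0 < K)%N) (b00 : (0 < b0)%N).

Lemma beta_gt0 l : 0 < beta l.
Proof. by rewrite divr_gt0 ?exprn_gt0 ?ltr0n. Qed.

Lemma alpha_beta l : alpha l = K%:R * 3 * beta l.
Proof. by rewrite /alpha /delta mulrA. Qed.

Lemma beta_le_alpha l : beta l <= alpha l.
Proof.
have K1 : (1 : R) <= K%:R by rewrite ler1n.
by rewrite alpha_beta; have := beta_gt0 l; nra.
Qed.

Lemma alpha_gt0 l : 0 < alpha l.
Proof. exact: lt_le_trans (beta_gt0 l) (beta_le_alpha l). Qed.

Lemma tau_ge0 l : 0 <= tau l.
Proof. by rewrite /tau !mulr_ge0 ?ler0n // ltW ?alpha_gt0. Qed.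

Lemma next_state_wf l v st : wf_state st -> wf_state (next_state l v st).
Proof.
case=> h1 h2; rewrite /wf_state /next_state /=.
have [h3 h4 h5] := argbestP (est (spanner st).1 v) h1 h2.
by split=> //; rewrite h4 /= lerDl tau_ge0.
Qed.

Lemma run_phases_wf V l : (0 < nN)%N -> wf_state (run_phases V l).
Proof. by move=> N0; elim: l => [|l IH] /=; [split | exact: next_state_wf]. Qed.

Lemma slot_arm_lt st j : wf_state st -> (slot_arm st j < nN)%N /\ st.1 (slot_arm st j).
Proof.
move=> [h1 h2]; rewrite /slot_arm.
by have := span_in_basis N T (d * (d + T)) st.1 j; rewrite -/(spanner st) => -[->|[k [-> ? ?]]].
Qed.

Lemma index_at_lt V t : (0 < nN)%N -> (index_at (run_phases V) t < nN)%N.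
Proof. by move=> N0; apply: (slot_arm_lt _ (run_phases_wf _ _ _)).1. Qed.

End Algorithm.

(** * Rounding and elimination *)

Section Dot.
Variables (R : realType) (d : nat).
Implicit Types u v w : 'rV[R]_d.

Lemma dotBr u v w : dot u (v - w) = dot u v - dot u w.
Proof. by rewrite /dot -sumrB; apply: eq_bigr => i _; rewrite !mxE mulrBr. Qed.

Lemma dotZr u a v : dot u (a *: v) = a * dot u v.
Proof. by rewrite /dot mulr_sumr; apply: eq_bigr => i _; rewrite !mxE mulrCA. Qed.

Lemma dot_sumr (I : finType) u (c : I -> R) (v : I -> 'rV[R]_d) :
  dot u (\sum_i c i *: v i) = \sum_i c i * dot u (v i).
Proof.
rewrite /dot; under eq_bigr => j _ do rewrite summxE mulr_sumr.
rewrite exchange_big; apply: eq_bigr => i _.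
by rewrite mulr_sumr; apply: eq_bigr => j _; rewrite !mxE mulrCA.
Qed.

Lemma dot_ge0 u : 0 <= dot u u.
Proof. by apply: sumr_ge0 => i _; rewrite -expr2 sqr_ge0. Qed.

Lemma dot_le1_of_l2norm u : l2norm u <= 1 -> dot u u <= 1.
Proof.
move=> h; rewrite -[dot u u]sqr_sqrtr ?dot_ge0 //.
by rewrite expr_le1 // sqrtr_ge0.
Qed.

Lemma norm_dot_le1 u v : l2norm u <= 1 -> l2norm v <= 1 -> `|dot u v| <= 1.
Proof.
move=> /dot_le1_of_l2norm hu /dot_le1_of_l2norm hv.
have h : `|dot u v| *+ 2 <= dot u u + dot v v.
  rewrite /dot -big_split /=; apply: le_trans (_ : (\sum_i `|u ord0 i * v ord0 i|) *+ 2 <= _).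
    by rewrite lerMn2r /= ler_norm_sum.
  rewrite -sumrMnl; apply: ler_sum => i _; rewrite normrM mulr2n.
  have := sqr_ge0 (`|u ord0 i| - `|v ord0 i|).
  rewrite sqrrB !real_normK ?num_real // -!expr2 mulr2n; lra.
by move: h hu hv; rewrite mulr2n; lra.
Qed.

Lemma l2normZ a u : 0 <= a -> l2norm (a *: u) = a * l2norm u.
Proof.
move=> a0; rewrite /l2norm; have -> : dot (a *: u) (a *: u) = a ^+ 2 * dot u u.
  by rewrite /dot !mulr_sumr; apply: eq_bigr => i _; rewrite !mxE; ring.
by rewrite sqrtrM ?sqr_ge0 // sqrtr_sqr ger0_norm.
Qed.

Lemma norm_dot_small u v c : 0 < c -> l2norm u <= 1 -> l2norm v <= c^-1 ->
  `|dot u v| <= c^-1.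
Proof.
move=> c0 hu hv; have := @norm_dot_le1 u (c *: v) hu.
rewrite l2normZ ?(ltW c0) // dotZr normrM gtr0_norm // => h.
rewrite -[c^-1]mulr1 ler_pdivlMl //; apply: h.
by rewrite mulrC -ler_pdivlMr // mul1r.
Qed.

End Dot.

(** * Rounding to a shifted grid *)

Section Grid.
Variables (R : realType) (K b0 : nat).
Hypotheses (K0 : (0 < K)%N) (b00 : (0 < b0)%N).

Local Notation beta := (beta R b0).
Local Notation alpha := (alpha R K b0).
Local Notation delta := (delta R b0).
Local Notation grid := (grid R K b0).
Local Notation cell := (cell K b0).
Local Notation start := (start R K b0).
Let al0 l : 0 < alpha l := alpha_gt0 R K0 b00 l.
Let be0 l : 0 < beta l := beta_gt0 R b00 l.
Let beal l : beta l <= alpha l := beta_le_alpha R K0 b00 l.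

Lemma start_le l kk : (kk <= K)%N -> start l kk <= -1.
Proof.
move=> kK; rewrite /start /alpha [K%:R * _]mulrC.
have : delta l * kk%:R <= delta l * K%:R.
  by rewrite ler_wpM2l ?ler_nat // mulr_ge0 ?ler0n // ltW.
lra.
Qed.

(** As m <= 1, clamping keeps [y] within [beta] of [m]. If [y] lies above the start of the grid,
    rounding down loses at most [alpha], and [beta <= alpha]; if it lies below, then start <= -1 <=
    m <= y + beta < start + beta. *)
Lemma grid_close l kk x m : (kk <= K)%N -> `|m| <= 1 -> `|x - m| <= beta l ->
  `|grid l kk (cell l kk x) - m| <= 2 * alpha l.
Proof.
move=> kK m1 xm; have sl := start_le l kK; have := al0 l; have := beal l.
rewrite /grid /cell; set s := start l kk in sl *.
set y := Num.min x 1 => hb ha.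
have ym : m - beta l <= y <= m + beta l.
  move: m1 xm; rewrite !ler_norml /y => /andP[? ?] /andP[? ?].
  by rewrite le_min ge_min; apply/andP; split; [apply/andP; split|apply/orP; left]; have := be0 l; lra.
move: m1; rewrite !ler_norml => /andP[m1 m2]; move/andP: ym => [y1 y2].
have [q0|q0] := lerP 0 ((y - s) / alpha l).
  have /andP[] := truncn_itv q0; rewrite ler_pdivlMr // ltr_pdivrMr //.
  rewrite -natr1; move: ((Num.truncn _)%:R) => z; rewrite mulrDl mul1r ![z * _]mulrC.
  by move=> ? ?; apply/andP; split; lra.
have -> : Num.truncn ((y - s) / alpha l) = 0%N.
  by apply/truncn0Pn; rewrite -ltNge; lra.
move: q0; rewrite pmulr_llt0 ?invr_gt0 // => q0.
by rewrite mulr0; apply/andP; split; lra.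
Qed.

Definition bad (l : nat) (m : R) (kk : nat) : Prop :=
  exists z : nat, `|grid l kk z - m| <= beta l.

(** Cells are thus determined by comparisons with boundaries, which is how they are shown to agree
    and how the program finds them. *)
Lemma cell_gt l kk x z : (z < cell l kk x)%N = (grid l kk z.+1 <= Num.min x 1).
Proof.
rewrite /cell truncn_gt_nat ler_pdivlMr // /grid lerBrDl.
by rewrite [alpha l * _]mulrC.
Qed.

Lemma cell_eq l kk x m : ~ bad l m kk -> `|x - m| <= beta l ->
  cell l kk x = cell l kk m.
Proof.
move=> nb xm; have H z : (z < cell l kk x)%N = (z < cell l kk m)%N.
  rewrite !cell_gt !le_min; congr (_ && _).
  have : ~~ (`|grid l kk z.+1 - m| <= beta l).
    by apply/negP => h; apply: nb; exists z.+1.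
  move: xm; rewrite !ler_norml negb_and -!ltNge => /andP[h1 h2] /orP[h|h].
    by apply/idP/idP => _; have := be0 l; lra.
  by apply/idP/idP => ?; exfalso; have := be0 l; lra.
have := H (cell l kk x); have := H (cell l kk m); rewrite !ltnn; lia.
Qed.

(** The boundaries for all offsets form a single progression of step [delta], with index
    [kk + K * z]. Two of them within 2 [beta] < [delta] of each other coincide, and reduction modulo
    [K] recovers the offset. *)
Lemma bad_uniq l m kk kk' : (kk < K)%N -> (kk' < K)%N ->
  bad l m kk -> bad l m kk' -> kk = kk'.
Proof.
move=> k1 k2 [z hz] [z' hz'].
have E : (kk + K * z = kk' + K * z')%N.
  have gE k w : grid l k w = (0 - 1 - alpha l) + delta l * (k + K * w)%:R.
    rewrite /grid /start /alpha natrD natrM; ring.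
  have {hz hz'} : `|grid l kk z - grid l kk' z'| <= 2 * beta l.
    by move: hz hz'; rewrite !ler_norml => /andP[? ?] /andP[? ?]; apply/andP; split; lra.
  rewrite !gE; move: (kk + K * z)%N (kk' + K * z')%N => a b.
  rewrite opprD addrACA subrr add0r -mulrBr normrM [`|delta l|]gtr0_norm; last first.
    by rewrite mulr_gt0.
  rewrite /delta mulrAC => h; apply/eqP; rewrite eqn_leq -[(a <= b)%N]ltnS -[(b <= a)%N]ltnS -!(ltr_nat R) -!natr1.
  have : `|a%:R - b%:R : R| < 1 by have := be0 l; nra.
  by rewrite ltr_norml => /andP[h1 h2]; apply/andP; split; lra.
by move/(congr1 (modn^~ K)): E; rewrite ![(_ + K * _)%N]addnC ![(K * _)%N]mulnC !modnMDl !modn_small.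
Qed.

End Grid.

(** * Error of one elimination phase *)

Section Analysis.
Variables (R : realType) (d T : nat) (N : seq 'rV[R]_d) (K b0 : nat).
Hypotheses (d0 : (0 < d)%N) (T0 : (0 < T)%N) (K0 : (0 < K)%N) (b00 : (0 < b0)%N).
Hypothesis uN : unit_arms N.
Hypothesis N0 : (0 < size N)%N.
Variable theta : 'rV[R]_d.
Hypothesis htheta : l2norm theta <= 1.

Local Notation alpha := (alpha R K b0).

Definition mu (k : nat) : R := dot theta (arm N k).

Lemma mu_le1 k : `|mu k| <= 1.
Proof.
rewrite /mu; have [kN|kN] := ltnP k (size N).
  by apply: norm_dot_le1 => //; apply: uN; exact: mem_nth.
rewrite /arm nth_default // /dot big1 ?normr0 // => i _.
by rewrite mxE mulr0.
Qed.

Definition close_slots (l : nat) (st : pstate) (v : nat -> R) : Prop :=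
  forall j, (j < d)%N -> if (spanner T N st).2 j is k.+1
    then `|v j - mu k| <= 2 * alpha l else v j = 0.

(** The mean of an arm is the combination of the basis means with the coordinates of the arm. There
    are d coordinates of absolute value at most 2, each multiplied by a slot error of at most 2
    alpha; for an artificial slot that error is |theta_j| / T. *)
Lemma est_close l st v k : T%:R^-1 <= 2 * alpha l -> close_slots l st v ->
  (k < size N)%N -> st.1 k ->
  `|est d (spanner T N st).1 v k - mu k| <= 4 * d%:R * alpha l.
Proof.
move=> hT hv kN ak; set x := spanner T N st.
have rx : represents N T x by exact: span_represents.
rewrite /mu (rx k kN) dot_sumr /est -sumrB.
apply: (le_trans (ler_norm_sum _ _ _)).
have -> : 4 * d%:R * alpha l = \sum_(j < d) (4 * alpha l).
  by rewrite sumr_const card_ord -[RHS]mulr_natr; ring.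
apply: ler_sum => j _; rewrite -mulrBr normrM.
have h1 : `|x.1 k j| <= 2 by apply: span_bounded.
have h2 : `|v j - dot theta (basis_vec N T x.2 j)| <= 2 * alpha l.
  have := hv j (ltn_ord j); rewrite -/x /basis_vec.
  case: (x.2 j) => [->|p //]; rewrite sub0r normrN.
  apply: le_trans hT; rewrite dotZr normrM gtr0_norm ?invr_gt0 ?ltr0n //.
  rewrite -[X in _ <= X]mulr1 ler_wpM2l ?invr_ge0 ?ler0n //.
  apply: le_trans (le_trans (coord_le_l2norm theta j) htheta).
  rewrite /dot (bigD1 j) //= big1 ?addr0 => [|i /negbTE ij]; last by rewrite mxE ij andbF mulr0.
  by rewrite mxE !eqxx mulr1.
by have := normr_ge0 (x.1 k j); have := normr_ge0 (v j - dot theta (basis_vec N T x.2 j)); nra.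
Qed.

Variable kstar : nat.
Hypothesis kstarN : (kstar < size N)%N.
Hypothesis kstar_max : forall k, (k < size N)%N -> mu k <= mu kstar.

(** [tau] is twice the estimation error 4 d alpha, so the best arm survives; a survivor is within
    [tau] plus two more such errors of it, 16 d alpha in all. *)
Lemma next_good l st v : wf_state N st -> T%:R^-1 <= 2 * alpha l -> close_slots l st v ->
  st.1 kstar ->
  (next_state T N K b0 l v st).1 kstar /\
  forall k, (k < size N)%N -> (next_state T N K b0 l v st).1 k ->
    mu kstar - mu k <= 16 * d%:R * alpha l.
Proof.
move=> [w1 w2] hT hv sk; rewrite /next_state /=.
have [b1 b2 b3] := argbestP (est d (spanner T N st).1 v) w1 w2.
have E k := est_close hT hv (k := k).
set b := argbest _ _ _ _ in b1 b2 b3 *.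
have := E _ b1 b2; have := E _ kstarN sk; have := b3 _ kstarN sk; have := kstar_max b1.
rewrite sk /tau !ler_norml => h1 h2 /andP[h3 h4] /andP[h5 h6]; split; first by lra.
move=> k kN /andP[ak h7]; have := E _ kN ak; rewrite ler_norml => /andP[h8 h9].
lra.
Qed.

End Analysis.

(** Telescoping: with b^2 - a^2 = 1, the inequality 1 / b <= 2 (b - a) is (b - a)^2 >= 0. *)
Lemma sum_invsqrt (R : realType) (T : nat) :
  \sum_(t < T) (Num.sqrt t.+1%:R)^-1 <= 2 * Num.sqrt T%:R :> R.
Proof.
elim: T => [|T IH]; first by rewrite big_ord0 sqrtr0 mulr0.
rewrite big_ord_recr /=; apply: (le_trans (lerD IH (lexx _))).
set a := Num.sqrt T%:R; set b := Num.sqrt T.+1%:R.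
have b0 : 0 < b by rewrite sqrtr_gt0 ltr0n.
have a0 : 0 <= a by rewrite sqrtr_ge0.
have a2 : a ^+ 2 = T%:R by rewrite sqr_sqrtr.
have b2 : b ^+ 2 = T%:R + 1 by rewrite sqr_sqrtr // natr1.
rewrite -lerBrDl -(ler_pM2r b0) mulVf ?gt_eqF //.
have := sqr_ge0 (b - a); nra.
Qed.

(** * Runs under good noise *)

Section Good.
Variables (R : realType) (d T : nat) (N : seq 'rV[R]_d) (K b0 : nat).
Hypotheses (d0 : (0 < d)%N) (T0 : (0 < T)%N) (K0 : (0 < K)%N) (b00 : (0 < b0)%N).
Hypothesis uN : unit_arms N.
Hypothesis N0 : (0 < size N)%N.
Variable theta : 'rV[R]_d.
Hypothesis htheta : l2norm theta <= 1.

Local Notation beta := (beta R b0).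
Local Notation alpha := (alpha R K b0).
Local Notation mu := (mu N theta).
Local Notation slot_arm := (slot_arm T N).

(** The threshold is [b0] times the square root of the block length 4^l. Only completed phases are
    constrained, since only their means feed later rounds. *)
Definition good (eta : nat -> R) : Prop :=
  forall l j, (sched d l.+1 <= T)%N -> (j < d)%N ->
  `|\sum_(i < 4 ^ l) eta (sched d l + j * 4 ^ l + i)%N| <= b0%:R * 2 ^+ l.

Variables (kk : nat -> nat) (r eta : nat -> R).
Hypothesis kkK : forall l, (kk l <= K)%N.

Local Notation run := (real_run T N K b0 kk r).

Hypothesis reward : forall t, (t < T)%N -> r t = mu (index_at T N run t) + eta t.
Hypothesis good_eta : good eta.

Lemma pow4 l : (4 ^ l)%:R = 2 ^+ l * 2 ^+ l :> R.
Proof. by rewrite -exprMn -natrM -natrX. Qed.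

Lemma block_mean_close l j : (sched d l.+1 <= T)%N -> (j < d)%N ->
  `|block_sum d T r l j / (4 ^ l)%:R - mu (slot_arm (run l) j)| <= beta l.
Proof.
move=> lT jd.
have lt i : (i < 4 ^ l)%N -> (sched d l + j * 4 ^ l + i < T)%N.
  by move=> il; apply: leq_trans (block_lt jd il) lT.
have p2 : (0 : R) < 2 ^+ l by rewrite exprn_gt0.
have p4 : (0 : R) < (4 ^ l)%:R by rewrite pow4 mulr_gt0.
have -> : block_sum d T r l j = mu (slot_arm (run l) j) * (4 ^ l)%:R +
    \sum_(i < 4 ^ l) eta (sched d l + j * 4 ^ l + i)%N.
  rewrite /block_sum (eq_bigl xpredT) => [|i]; last by rewrite lt.
  rewrite mulr_natr -[in X in _ *+ X](card_ord (4 ^ l)) -sumr_const -big_split.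
  apply: eq_bigr => i _ /=.
  by rewrite reward ?lt // /index_at phase_of_block // slot_of_block.
rewrite mulrDl mulfK ?gt_eqF // addrAC subrr add0r normrM.
rewrite [`|_^-1|]gtr0_norm ?invr_gt0 // ler_pdivrMr //.
apply: le_trans (good_eta lT jd) _; rewrite pow4 /beta mulrA.
by rewrite divfK ?gt_eqF.
Qed.

Lemma invT_le l : (sched d l.+1 <= T)%N -> T%:R^-1 <= 2 * alpha l.
Proof.
rewrite schedS => h.
have h1 : (2 ^ l <= T)%N.
  have h2 : (2 ^ l <= 4 ^ l)%N by rewrite -[4%N]/(2 * 2)%N expnMn leq_pmulr ?expn_gt0.
  by nia.
have := beta_le_alpha R K0 b00 l; have : 2%:R ^- l <= beta l.
  by rewrite /beta ler_peMl ?invr_ge0 ?exprn_ge0 // ler1n.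
have : T%:R^-1 <= (2 : R) ^- l.
  by rewrite lef_pV2 ?posrE ?exprn_gt0 ?ltr0n // -natrX ler_nat.
have := beta_gt0 R b00 l; lra.
Qed.

Lemma close_real l : (sched d l.+1 <= T)%N ->
  close_slots T N K b0 theta l (run l) (slot_val T N K b0 l (kk l) (run l) (cells d T K b0 kk r l)).
Proof.
move=> lT j jd; rewrite /slot_val; case E : (_ j) => [//|k].
apply: grid_close => //; first exact: mu_le1.
by have := block_mean_close lT jd; rewrite {1}/slot_arm E.
Qed.

Variable kstar : nat.
Hypothesis kstarN : (kstar < size N)%N.
Hypothesis kstar_max : forall k, (k < size N)%N -> mu k <= mu kstar.

Lemma kstar_active l : (sched d l <= T)%N -> (run l).1 kstar.
Proof.
elim: l => [//|l IH] lT; have lT' : (sched d l <= T)%N.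
  by apply: leq_trans lT; rewrite schedS leq_addr.
exact: (next_good d0 T0 uN htheta kstarN kstar_max (run_phases_wf _ _ _ _ _ N0)
  (invT_le lT) (close_real lT) (IH lT')).1.
Qed.

(** A round of phase l + 1 plays a survivor of phase l, whose gap is at most 16 d alpha_l = 48 d K
    b0 / 2^l, while t + 1 <= 16 d 4^l gives sqrt(t + 1) <= 4 sqrt(d) 2^l. The product of the two
    bounds is the constant 192 d sqrt(d) K b0. *)
Lemma round_regret t : (t < T)%N ->
  mu kstar - mu (index_at T N run t) <=
  192 * d%:R * Num.sqrt d%:R * K%:R * b0%:R * (Num.sqrt t.+1%:R)^-1.
Proof.
move=> tT; have /andP[h1 h2] := phase_ofP d0 t.
have s0 : 0 < Num.sqrt t.+1%:R :> R by rewrite sqrtr_gt0 ltr0n.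
have d1 : (1 : R) <= d%:R by rewrite ler1n.
have sd1 : (1 : R) <= Num.sqrt d%:R by rewrite -[X in X <= _]sqrtr1 ler_wsqrtr.
have kb1 : (1 : R) <= K%:R * b0%:R by rewrite -natrM ler1n muln_gt0 K0.
rewrite ler_pdivlMr //.
rewrite /index_at; set st := run _; set j := slot_of _ _.
have wst : wf_state N st by apply: run_phases_wf.
have [kN ka] := slot_arm_lt T j wst.
case E : (phase_of d t) @st h1 h2 wst kN ka => [|l] st h1 h2 wst kN ka.
  (* No elimination precedes phase 0: there the gap is at most 2 and t < d. *)
  have m1 := mu_le1 uN htheta kstar.
  have m2 := mu_le1 uN htheta (slot_arm st j).
  have g2 : mu kstar - mu (slot_arm st j) <= 2.
    by move: m1 m2; rewrite !ler_norml => /andP[? ?] /andP[? ?]; lra.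
  have ts : Num.sqrt t.+1%:R <= Num.sqrt d%:R :> R.
    rewrite ler_wsqrtr // ler_nat; move: h2; rewrite schedS sched0; lia.
  apply: (@le_trans _ _ (2 * Num.sqrt d%:R)).
    by apply: (le_trans (ler_wpM2r (ltW s0) g2)); rewrite ler_pM2l.
  have : 1 <= d%:R * (K%:R * b0%:R) :> R by nra.
  by rewrite -!mulrA [Num.sqrt d%:R * _]mulrC !mulrA => ?; nra.
have lT : (sched d l.+1 <= T)%N by apply: leq_trans h1 (ltnW tT).
have g := (next_good d0 T0 uN htheta kstarN kstar_max
  (run_phases_wf _ _ _ _ _ N0) (invT_le lT) (close_real lT)
  (kstar_active (leq_trans _ lT))).2 _ kN ka.
have p2 : (0 : R) < 2 ^+ l by rewrite exprn_gt0.
have ts : Num.sqrt t.+1%:R <= 4 * Num.sqrt d%:R * 2 ^+ l :> R.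
  rewrite -(@ler_pXn2r _ 2) ?nnegrE ?sqrtr_ge0 ?mulr_ge0 ?exprn_ge0 ?sqrtr_ge0 //.
  rewrite sqr_sqrtr ?ler0n //.
  have -> : (4 * Num.sqrt d%:R * 2 ^+ l) ^+ 2 = (16 * d * 4 ^ l)%:R :> R.
    by rewrite !exprMn sqr_sqrtr // !natrM pow4; ring.
  rewrite ler_nat.
  by have := sched_mul3 d l.+2; rewrite 2!expnS; lia.
have {}g := g (leq_sched d (leqnSn l)).
apply: (le_trans (ler_pM _ _ g ts)); rewrite ?sqrtr_ge0 ?subr_ge0 ?kstar_max //.
have -> : 16 * d%:R * alpha l * (4 * Num.sqrt d%:R * 2 ^+ l) =
  16 * d%:R * K%:R * 3 * 4 * Num.sqrt d%:R * (beta l * 2 ^+ l).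
  by rewrite alpha_beta; ring.
by rewrite /beta divfK ?gt_eqF // le_eqVlt; apply/orP; left; apply/eqP; ring.
Qed.

Lemma total_regret :
  \sum_(t < T) (mu kstar - mu (index_at T N run t)) <=
  384 * d%:R * Num.sqrt d%:R * K%:R * b0%:R * Num.sqrt T%:R.
Proof.
apply: (@le_trans _ _ (\sum_(t < T) (192 * d%:R * Num.sqrt d%:R * K%:R * b0%:R *
    (Num.sqrt t.+1%:R)^-1))).
  by apply: ler_sum => t _; exact: round_regret.
rewrite -mulr_sumr; have := sum_invsqrt R T.
have : 0 <= 192 * d%:R * Num.sqrt d%:R * K%:R * b0%:R :> R.
  by rewrite !mulr_ge0 ?ler0n ?sqrtr_ge0.
set M := _ * b0%:R => M0 h; apply: (le_trans (ler_wpM2l M0 h)).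
by rewrite /M le_eqVlt; apply/orP; left; apply/eqP; ring.
Qed.

(** The true means are rounded with the same offsets. Up to phase l this depends on the offsets
    before l only, so being [unlucky] in phase l is an event about the offsets up to l, independent
    of the noise. *)
Definition ideal_run : nat -> pstate :=
  run_phases T N K b0 (fun l st => slot_val T N K b0 l (kk l) st
    (fun j => cell K b0 l (kk l) (mu (slot_arm st j)))).

Definition unlucky (l : nat) : Prop := exists j : 'I_d,
  bad K b0 l (mu (slot_arm (ideal_run l) j)) (kk l).

(** As long as the states agree, the same arms are played and the empirical means are within [beta]
    of the means that the ideal run rounds; with no boundary nearby the cells agree, and so do the
    next states. *)
Lemma real_run_ideal l : (sched d l <= T)%N ->
  (forall l', (l' < l)%N -> ~ unlucky l') -> run l = ideal_run l.
Proof.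
elim: l => [//|l IH] lT hl; have lT' : (sched d l <= T)%N.
  by apply: leq_trans lT; rewrite schedS leq_addr.
have E := IH lT' (fun l' h => hl l' (ltnW h)).
rewrite /real_run /run_of /ideal_run /= -/(run_of _ _ _ _ _ _) -/(real_run _ _ _ _ _ _) -/ideal_run.
rewrite E; apply: next_congr => j jd; rewrite /slot_val.
case Ej : (_ j) => [//|k]; congr (grid _ _ _ _ _ _).
apply: cell_eq => //.
  by move=> hb; apply: (hl l (ltnSn l)); exists (Ordinal jd).
by rewrite -E; exact: block_mean_close.
Qed.

End Good.

(** * Concentration and replicability *)

Section Independence.
Context {R : realType} {d0 : measure_display} {Omega : measurableType d0}.
Variable P : probability Omega R.

Import HBNNSimple.

(** Functions of [X] are monotone limits of simple ones, so a factorization known for indicators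
    extends to them. The weight [Z] will stand for the other factors of a product. *)
Lemma integral_fun_of_indic (X : {RV P >-> R}) (Z : Omega -> R) (c : R) :
  0 <= c -> measurable_fun setT Z -> (forall w, 0 <= Z w) ->
  (forall B, measurable B ->
    \int[P]_w (Z w * \1_B (X w))%:E = c%:E * \int[P]_w (\1_B (X w))%:E)%E ->
  forall f : R -> R, measurable_fun setT f -> (forall x, 0 <= f x) ->
    (\int[P]_w (Z w * f (X w))%:E = c%:E * \int[P]_w (f (X w))%:E)%E.
Proof.
move=> c0 mZ Z0 HB f mf f0.
have mX : measurable_fun setT (X : Omega -> R) by exact: measurable_funP.
have simple (h : {nnsfun R >-> R}) :
    (\int[P]_w (Z w * h (X w))%:E = c%:E * \int[P]_w (h (X w))%:E)%E.
  have mi y : measurable_fun setT (fun w => \1_(h @^-1` [set y]) (X w) : R).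
    by apply: (measurableT_comp (measurable_indic _)).
  have nn y w : 0 <= y * \1_(h @^-1` [set y]) (X w).
    by rewrite -lee_fin EFinM nnfun_muleindic_ge0.
  under [LHS]eq_integral => w _.
    rewrite fimfunE EFinM -fsumEFin // ge0_mule_fsumr; last first.
      by move=> y; rewrite lee_fin nn.
    over.
  rewrite [LHS]ge0_integral_fsum //; last 2 first.
    by move=> y; apply/measurable_EFinP; apply: measurable_funM => //; apply: measurable_funM.
    by move=> y w _; rewrite -EFinM lee_fin mulr_ge0.
  under [in RHS]eq_integral => w _ do rewrite fimfunE -fsumEFin //.
  rewrite [in RHS]ge0_integral_fsum //; last 2 first.
    by move=> y; apply/measurable_EFinP; apply: measurable_funM.
    by move=> y w _; rewrite lee_fin.
  rewrite ge0_mule_fsumr; last first.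
    by move=> y; apply: integral_ge0 => w _; rewrite lee_fin.
  apply: eq_fsbigr => y; rewrite inE /= => -[x _ hy].
  have y0 : 0 <= y by rewrite -hy.
  transitivity (y%:E * \int[P]_w (Z w * \1_(h @^-1` [set y]) (X w))%:E)%E.
    rewrite -ge0_integralZl //; last 2 first.
      by apply/measurable_EFinP; apply: measurable_funM.
      by move=> w _; rewrite lee_fin mulr_ge0.
    by apply: eq_integral => w _; rewrite -!EFinM mulrCA.
  rewrite HB // muleCA; congr (_ * _)%E.
  by rewrite -ge0_integralZl //; exact/measurable_EFinP.
have mEf : measurable_fun setT (EFin \o f) by apply/measurable_EFinP.
pose f_ := nnsfun_approx measurableT mEf.
have fE x : EFin \o f_ ^~ x @ \oo --> (f x)%:E.
  by apply: cvg_nnsfun_approx => //= y _; rewrite lee_fin.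
have nd x m n : (m <= n)%N -> f_ m x <= f_ n x.
  by move=> mn; exact/lefP/nd_nnsfun_approx.
have L : (\int[P]_w (Z w * f_ n (X w))%:E @[n --> \oo] -->
    \int[P]_w (Z w * f (X w))%:E)%E.
  have := @cvg_monotone_convergence _ _ _ P setT measurableT
    (fun n w => (Z w * f_ n (X w))%:E).
  have -> : (fun x => limn ((fun n w => (Z w * f_ n (X w))%:E) ^~ x)) =
      (fun w => (Z w * f (X w))%:E).
    apply/funext => w; apply/cvg_lim => //.
    exact: (@cvgeZl _ _ _ (fun n => (f_ n (X w))%:E) _ (Z w)%:E isT (fE (X w))).
  apply.
  - by move=> n; apply/measurable_EFinP/measurable_funM => //; exact: measurableT_comp.
  - by move=> n w _; rewrite lee_fin mulr_ge0.
  - by move=> w _ m n mn; rewrite lee_fin ler_wpM2l // nd.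
have M : (\int[P]_w (f_ n (X w))%:E @[n --> \oo] --> \int[P]_w (f (X w))%:E)%E.
  have := @cvg_monotone_convergence _ _ _ P setT measurableT
    (fun n w => (f_ n (X w))%:E).
  have -> : (fun x => limn ((fun n w => (f_ n (X w))%:E) ^~ x)) =
      (fun w => (f (X w))%:E).
    by apply/funext => w; apply/cvg_lim => //; exact: fE.
  apply.
  - by move=> n; apply/measurable_EFinP; exact: measurableT_comp.
  - by move=> n w _; rewrite lee_fin.
  - by move=> w _ m n mn; rewrite lee_fin nd.
have {M} M : (c%:E * \int[P]_w (f_ n (X w))%:E @[n --> \oo] -->
    c%:E * \int[P]_w (f (X w))%:E)%E by apply: cvgeZl.
rewrite -(cvg_lim (@ereal_hausdorff R) L) -(cvg_lim (@ereal_hausdorff R) M).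
by congr (limn _); apply/funext => n; exact: simple.
Qed.

Lemma prod_indic (I : eqType) (J : seq I) (A : I -> set Omega) w :
  \prod_(i <- J) \1_(A i) w = \1_(\bigcap_(i in [set` J]) A i) w :> R.
Proof.
rewrite indicE; have [h|h] := pselect ((\bigcap_(i in [set` J]) A i) w).
  rewrite (mem_set h) big_seq big1 // => i iJ; rewrite indicE mem_set //; exact: h.
rewrite (memNset h); have [i iJ ni] : exists2 i, i \in J & ~ A i w.
  apply: contrapT => H; apply: h => i /= iJ; apply: contrapT => ni; apply: H.
  by exists i.
by rewrite (big_rem i) //= indicE memNset // mul0r.
Qed.

Variables (I : eqType) (X : I -> {RV P >-> R}).
Hypothesis indepX : mutually_independent X.

(** Independence is a statement about events, hence about products of indicators. In the auxiliary
    claim [H] these are exchanged for the functions [f i] one index at a time: [J1] holds the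
    indices already exchanged, [J2] those still carrying an indicator. *)
Lemma expectation_prod_indep (f : I -> R -> R) (e : I -> R) (J : seq I) :
  uniq J -> (forall i, measurable_fun setT (f i)) -> (forall i x, 0 <= f i x) ->
  (forall i, i \in J -> \int[P]_w (f i (X i w))%:E = (e i)%:E)%E ->
  (\int[P]_w (\prod_(i <- J) f i (X i w))%:E = (\prod_(i <- J) e i)%:E)%E.
Proof.
move=> uJ mf f0 he.
suff H (J1 J2 : seq I) (B : I -> set R) : uniq (J1 ++ J2) ->
    {subset J1 <= J} -> (forall i, measurable (B i)) ->
    (\int[P]_w ((\prod_(i <- J1) f i (X i w)) *
       (\prod_(i <- J2) \1_(B i) (X i w)))%:E =
     (\prod_(i <- J1) e i)%:E * \prod_(i <- J2) P (X i @^-1` B i))%E.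
  have := H J [::] (fun=> setT); rewrite cats0 => /(_ uJ (fun=> id) (fun=> measurableT)).
  by rewrite big_nil mule1 => <-; apply: eq_integral => w _; rewrite big_nil mulr1.
have mX i : measurable_fun setT (X i : Omega -> R) by exact: measurable_funP.
elim: J1 J2 B => [|i J1 IH] J2 B uJ12 sJ mB.
  rewrite big_nil mul1e -(indepX uJ12 mB).
  under eq_integral => w _.
    rewrite big_nil mul1r (eq_bigr (fun i => \1_(X i @^-1` B i) w)) // prod_indic.
    over.
  rewrite integral_indic ?setIT //.
  apply: fin_bigcap_measurable => [|i _]; first exact: finite_seq.
  by rewrite -[_ @^-1` _]setTI; exact: mX.
have uJ' : uniq (J1 ++ i :: J2) by rewrite -cat1s uniq_catCA.
have sJ1 : {subset J1 <= J} by move=> j jJ; apply: sJ; rewrite inE jJ orbT.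
have iJ2 : i \notin J2.
  by move: uJ'; rewrite cat_uniq /= => /and4P[].
set Z := fun w => (\prod_(j <- J1) f j (X j w)) * (\prod_(j <- J2) \1_(B j) (X j w)).
have Z0 w : 0 <= Z w by rewrite mulr_ge0 // prodr_ge0 // => j _; rewrite indicE.
have mZ : measurable_fun setT Z.
  apply: measurable_funM; apply: measurable_prod => j _.
    exact: measurableT_comp.
  exact: (measurableT_comp (measurable_indic (mB j))).
have e0 j : j \in J -> 0 <= e j.
  by move=> jJ; rewrite -lee_fin -he //; apply: integral_ge0 => w _; rewrite lee_fin.
have mXB j : measurable (X j @^-1` B j) by rewrite -[_ @^-1` _]setTI; exact: mX.
have Pfin j : P (X j @^-1` B j) = (fine (P (X j @^-1` B j)))%:E.
  by rewrite fineK // fin_num_measure.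
pose c := \prod_(j <- J1) e j * \prod_(j <- J2) fine (P (X j @^-1` B j)).
have cE : ((\prod_(j <- J1) e j)%:E * \prod_(j <- J2) P (X j @^-1` B j) = c%:E)%E.
  rewrite /c EFinM; congr (_ * _)%E; elim: (J2) => [|j J3 IHJ]; first by rewrite !big_nil.
  by rewrite !big_cons IHJ EFinM {1}Pfin.
have c0 : 0 <= c.
  apply: mulr_ge0; last by apply: prodr_ge0 => j _; exact: fine_ge0.
  by rewrite big_seq; apply: prodr_ge0 => j jJ; apply/e0/sJ1.
(* The induction hypothesis with [i] still among the indicators, carrying the arbitrary set [C]. *)
have HC C : measurable C ->
    (\int[P]_w (Z w * \1_C (X i w))%:E = c%:E * \int[P]_w (\1_C (X i w))%:E)%E.
  move=> mC; have := IH (i :: J2) (fun j => if j == i then C else B j) uJ' sJ1 _.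
  rewrite big_cons eqxx => H.
  transitivity ((\prod_(j <- J1) e j)%:E * (P (X i @^-1` C) * \prod_(j <- J2) P (X j @^-1` B j)))%E.
    have E (U : Type) (idx : U) op (G : I -> set R -> U) :
        \big[op/idx]_(j <- J2) G j (if j == i then C else B j) = \big[op/idx]_(j <- J2) G j (B j).
      rewrite big_seq [RHS]big_seq; apply: eq_bigr => j jJ2.
      by case: eqP => // ji; move: iJ2; rewrite -ji jJ2.
    rewrite (E _ _ _ (fun j D => P (X j @^-1` D))) in H.
    rewrite -H => [|j]; last by case: ifP.
    apply: eq_integral => w _; rewrite /Z big_cons eqxx.
    rewrite (E _ _ _ (fun j D => \1_D (X j w))); congr (_%:E); ring.
  rewrite muleCA cE muleC; congr (_ * _)%E.
  have mXC : measurable (X i @^-1` C) by rewrite -[_ @^-1` _]setTI; exact: mX.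
  by rewrite -[X in P X = _]setIT -integral_indic //.
have := integral_fun_of_indic c0 mZ Z0 HC (mf i) (f0 i).
rewrite he ?mem_head //; last by apply: sJ; rewrite mem_head.
move=> key; transitivity (c%:E * (e i)%:E)%E.
  by rewrite -key; apply: eq_integral => w _; rewrite /Z big_cons; congr (_%:E); ring.
by rewrite -cE big_cons mulrC EFinM muleAC.
Qed.

End Independence.

(** * Measurability of maps with countably many values *)

Section Discrete.
Context {d0 : measure_display} {Omega : measurableType d0}.

(** States, indices and lists carry no sigma-algebra here. With countably many values, measurable
    fibres suffice for all preimages. *)
Definition discretely_measurable (T : Type) (f : Omega -> T) : Prop :=
  forall t, measurable (f @^-1` [set t]).

Lemma discrete_preimage (T : countType) (f : Omega -> T) (Q : set T) :
  discretely_measurable f -> measurable (f @^-1` Q).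
Proof.
move=> mf; have -> : f @^-1` Q = \bigcup_t (if pselect (Q t) then f @^-1` [set t] else set0).
  apply/seteqP; split=> [w Qw|w [t _]].
    by exists (f w) => //; case: pselect.
  by case: pselect => // Qt /= ->.
apply: countable_bigcupT_measurable => [|t]; first exact: countableP.
by case: pselect => h; [exact: mf|exact: measurable0].
Qed.

Lemma discrete_comp (T : countType) (U : Type) (f : Omega -> T) (g : T -> U) :
  discretely_measurable f -> discretely_measurable (fun w => g (f w)).
Proof. by move=> mf u; exact: (discrete_preimage (fun t => g t = u) mf). Qed.

Lemma discrete_cst (T : Type) (t : T) : discretely_measurable (fun=> t).
Proof.
move=> u; have [->|h] := pselect (t = u).
  by rewrite (_ : _ @^-1` _ = setT) //; apply/seteqP; split.
by rewrite (_ : _ @^-1` _ = set0) //; apply/seteqP; split.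
Qed.

Lemma discrete_pair (T U : Type) (f : Omega -> T) (g : Omega -> U) :
  discretely_measurable f -> discretely_measurable g ->
  discretely_measurable (fun w => (f w, g w)).
Proof.
move=> mf mg [t u].
rewrite (_ : _ @^-1` _ = (f @^-1` [set t]) `&` (g @^-1` [set u])).
  exact: measurableI.
by apply/seteqP; split=> w /= [-> ->].
Qed.

Lemma discrete_map (S : Type) (T : Type) (f : S -> Omega -> T) (s : seq S) :
  (forall i, discretely_measurable (f i)) ->
  discretely_measurable (fun w => [seq f i w | i <- s]).
Proof.
move=> mf; elim: s => [|i s IH] /=; first exact: discrete_cst.
move=> [|t u]; first by rewrite (_ : _ @^-1` _ = set0) //; apply/seteqP; split.
rewrite (_ : _ @^-1` _ = (f i @^-1` [set t]) `&`
    ((fun w => [seq f i w | i <- s]) @^-1` [set u])).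
  by apply: measurableI; [exact: mf|exact: IH].
by apply/seteqP; split=> w /= [-> ->].
Qed.

Lemma discrete_truncn (R : realType) (X : Omega -> R) :
  measurable_fun setT X -> discretely_measurable (fun w => Num.truncn (X w)).
Proof.
move=> mX n; case: n => [|n].
  rewrite (_ : _ @^-1` _ = X @^-1` `]-oo, 1[).
    by rewrite -[_ @^-1` _]setTI; exact: mX.
  apply/seteqP; split=> w /=; rewrite in_itv /= => h.
    by move/truncn0Pn: h; rewrite -ltNge.
  by apply/truncn0Pn; rewrite -ltNge.
rewrite (_ : _ @^-1` _ = X @^-1` `[n.+1%:R, n.+2%:R[).
  by rewrite -[_ @^-1` _]setTI; exact: mX.
apply/seteqP; split=> w /=; rewrite in_itv /= => h; last exact: truncn_def.
have h0 : 0 <= X w.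
  by apply: (le_trans ler01); rewrite -truncn_gt0 h.
by rewrite -h truncn_itv.
Qed.

End Discrete.

(** * Chernoff bound for sums of subgaussian variables *)

Section TailBound.
Context {R : realType} {d0 : measure_display} {Omega : measurableType d0}.
Variable P : probability Omega R.

Lemma mmt_gen_funE (X : Omega -> R) t :
  ('M_P X t = \int[P]_w (expR (t * X w))%:E)%E.
Proof. by rewrite /mmt_gen_fun unlock; apply: eq_integral => w _ /=; rewrite mulrC. Qed.

(** Subgaussianity is given for the noise of the first execution; it reaches the second because the
    moment generating function depends on the law alone. *)
Lemma same_law_mmt (X Y : {RV P >-> R}) t : same_law X Y -> 'M_P X t = 'M_P Y t.
Proof.
move=> h; rewrite !mmt_gen_funE.
have E (Z : {RV P >-> R}) : (\int[P]_w (expR (t * Z w))%:E =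
    \int[distribution P Z]_x (expR (t * x))%:E)%E.
  rewrite ge0_integral_pushforward //.
  by apply/measurable_EFinP; apply: measurableT_comp => //; exact: measurable_funM.
by rewrite !E; apply: eq_measure_integral => A mA _; exact: h.
Qed.

Lemma markov_exp (S : Omega -> R) (c a : R) : measurable_fun setT S ->
  (P [set w | (a <= c * S w)%R] <= \int[P]_w (expR (c * S w))%:E * (expR (- a))%:E)%E.
Proof.
move=> mS; have mc : measurable_fun setT (fun w => c * S w) by exact: measurable_funM.
have mA : measurable [set w | a <= c * S w].
  rewrite (_ : [set w | _] = setT `&` (fun w => c * S w) @^-1` `[a, +oo[); first exact: mc.
  by apply/seteqP; split=> w /=; rewrite in_itv /= andbT => // -[].
rewrite expRN lee_pdivlMr ?expR_gt0 // -[P _]mule1 -[X in (P X)]setIT.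
rewrite -integral_indic // mule1 muleC -ge0_integralZl //; last 1 first.
  exact/measurable_EFinP/measurable_indic.
apply: ge0_le_integral => //.
- by apply: measurable_funeM; exact/measurable_EFinP/measurable_indic.
- by apply/measurable_EFinP; exact: measurableT_comp.
- move=> w _; rewrite -EFinM lee_fin indicE; have [h|h] := pselect (a <= c * S w).
    by rewrite mem_set // mulr1 ler_expR.
  by rewrite memNset // mulr0 expR_ge0.
Qed.

Variables (I : eqType) (X : I -> {RV P >-> R}).
Hypothesis indepX : mutually_independent X.

Lemma expectation_exp_sum (J : seq I) (c : R) : uniq J ->
  (forall i, i \in J -> 'M_P (X i) c <= (expR (c ^+ 2 / 2))%:E)%E ->
  (\int[P]_w (expR (c * \sum_(i <- J) X i w))%:E <=
    (expR ((size J)%:R * (c ^+ 2 / 2)))%:E)%E.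
Proof.
move=> uJ hm.
pose e i := fine ('M_P (X i) c).
have he i : i \in J -> (\int[P]_w (expR (c * X i w))%:E = (e i)%:E)%E.
  move=> iJ; rewrite -mmt_gen_funE /e fineK // ge0_fin_numE.
    by apply: le_lt_trans (hm i iJ) _; rewrite ltry.
  by rewrite mmt_gen_funE; apply: integral_ge0 => w _; rewrite lee_fin expR_ge0.
have := @expectation_prod_indep _ _ _ P I X indepX (fun _ x => expR (c * x)) e J uJ _ _ he.
under eq_integral => w _ do rewrite -expR_sum -mulr_sumr.
move=> -> => [|i|i x]; last by rewrite expR_ge0.
  rewrite lee_fin expRM_natl.
  rewrite (_ : expR _ ^+ _ = \prod_(i <- J) expR (c ^+ 2 / 2)); last first.
    by rewrite big_const_seq count_predT iter_mulr_1.
  rewrite big_seq [in X in _ <= X]big_seq; apply: ler_prod => i iJ.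
  rewrite -!lee_fin -he // -mmt_gen_funE hm // andbT.
  by rewrite mmt_gen_funE; apply: integral_ge0 => w _; rewrite lee_fin expR_ge0.
by apply: measurableT_comp => //; exact: measurable_funM.
Qed.

Lemma subgaussian_sum_tail (J : seq I) (a : R) : uniq J -> (0 < size J)%N -> 0 < a ->
  (forall i, i \in J -> forall c, 'M_P (X i) c <= (expR (c ^+ 2 / 2))%:E)%E ->
  (P [set w | (a < `|\sum_(i <- J) X i w|)%R] <=
    (2 * expR (- (a ^+ 2 / (2 * (size J)%:R))))%:E)%E.
Proof.
move=> uJ J0 a0 hm; set n : R := (size J)%:R.
have n0 : 0 < n by rewrite ltr0n.
have mS : measurable_fun setT (fun w => \sum_(i <- J) X i w).
  by apply: measurable_sum => i; exact: measurable_funP.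
(* Both tails at once, s = 1 and s = -1. The choice c = s a / n is the optimal one: n c^2 / 2 - a^2
   / n = - a^2 / (2 n). *)
have half s : s ^+ 2 = 1 ->
  (P [set w | (a ^+ 2 / n <= s * (a / n) * (\sum_(i <- J) X i w))%R] <=
    (expR (- (a ^+ 2 / (2 * n))))%:E)%E.
  move=> s2; apply: le_trans (markov_exp _ _ mS) _.
  apply: (@le_trans _ _ ((expR (n * ((s * (a / n)) ^+ 2 / 2)))%:E * (expR (- (a ^+ 2 / n)))%:E)%E).
    apply: lee_wpmul2r; first by rewrite lee_fin expR_ge0.
    by apply: expectation_exp_sum => // i iJ; exact: hm.
  rewrite -EFinM lee_fin -expRD ler_expR exprMn s2 mul1r le_eqVlt; apply/orP; left.
  by apply/eqP; field; rewrite gt_eqF.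
have mA s : measurable [set w | a ^+ 2 / n <= s * (a / n) * (\sum_(i <- J) X i w)].
  rewrite (_ : [set w | _] = setT `&` (fun w => s * (a / n) * (\sum_(i <- J) X i w)) @^-1` `[a ^+ 2 / n, +oo[).
    by apply: measurable_funM => //; exact: measurable_funP.
  by apply/seteqP; split=> w /=; rewrite in_itv /= andbT => // -[].
have mB : measurable [set w | a < `|\sum_(i <- J) X i w|].
  rewrite (_ : [set w | _] = setT `&` (fun w => `|\sum_(i <- J) X i w|) @^-1` `]a, +oo[).
    by apply: measurableT_comp => //; exact: measurable_funP.
  by apply/seteqP; split=> w /=; rewrite in_itv /= andbT => // -[].
apply: (@le_trans _ _ (P ([set w | (a ^+ 2 / n <= 1 * (a / n) * (\sum_(i <- J) X i w))%R] `|`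
   [set w | (a ^+ 2 / n <= (- 1) * (a / n) * (\sum_(i <- J) X i w))%R]))).
  apply: le_measure; rewrite ?inE //; first exact: measurableU.
  move=> w /=; have an : 0 < a / n by rewrite divr_gt0.
  have -> : a ^+ 2 / n = (a / n) * a by rewrite expr2 mulrAC.
  rewrite mul1r mulN1r mulNr -mulrN !ler_pM2l // => h.
  have [s0|s0] := lerP 0 (\sum_(i <- J) X i w).
    by left; move: h; rewrite ger0_norm // => /ltW.
  by right; move: h; rewrite ltr0_norm // => /ltW.
apply: (le_trans (measureU2 _ _ _)) => //.
rewrite (_ : 2 * expR _ = expR (- (a ^+ 2 / (2 * n))) + expR (- (a ^+ 2 / (2 * n)))); last by ring.
rewrite EFinD; apply: leeD; apply: half; first by rewrite expr1n.
by rewrite sqrrN expr1n.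
Qed.

End TailBound.

(** * The policy along its own history *)

Section History.
Variables (R : realType) (d : nat) (alg : policy R d) (theta : 'rV[R]_d).
Variables (xi eta : nat -> R).

Lemma size_history t : size (history alg theta xi eta t) = t.
Proof. by elim: t => [|t IH] //=; rewrite size_rcons IH. Qed.

Lemma history_take t T : (t <= T)%N ->
  take t (history alg theta xi eta T) = history alg theta xi eta t.
Proof.
elim: T => [|T IH]; first by case: t.
rewrite leq_eqVlt => /orP[/eqP->|tT]; first by rewrite take_oversize ?size_history.
by rewrite /= -cats1 takel_cat ?IH // size_history.
Qed.

Lemma nth_history x t T : (t < T)%N -> nth x (history alg theta xi eta T) t =
  let a := alg xi (history alg theta xi eta t) in (a, dot theta a + eta t).
Proof.
move=> tT; rewrite -(nth_take x (ltnSn t)) history_take //=.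
by rewrite nth_rcons size_history ltnn eqxx.
Qed.

End History.

Section LinHistory.
Variables (R : realType) (d T : nat) (N : seq 'rV[R]_d) (K b0 : nat).
Hypothesis d0 : (0 < d)%N.
Variables (theta : 'rV[R]_d) (xi eta : nat -> R).

Local Notation alg := (lin_alg T N K b0).

Definition rewards (t : nat) : R := dot theta (alg xi (history alg theta xi eta t)) + eta t.

Definition indices : nat -> nat :=
  index_at T N (real_run T N K b0 (offset K xi) rewards).

(** At each round the policy recomputes the run from a longer prefix; by causality all these runs
    agree, where they matter, with the single run on the sequence [rewards]. Hence one function
    [indices] describes the whole play. *)
Lemma lin_alg_history t :
  alg xi (history alg theta xi eta t) = arm N (indices t).
Proof.
rewrite {1}/lin_alg size_history /indices /index_at.
congr (arm N (slot_arm _ _ _ _)); apply: real_run_causal => // i it.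
have it' : (i < t)%N by apply: leq_trans it _; case/andP: (phase_ofP d0 t).
by rewrite (nth_history _ _ _ _ _ it').
Qed.

Lemma rewardsE t : rewards t = mu N theta (indices t) + eta t.
Proof. by rewrite /rewards lin_alg_history. Qed.

Lemma actionsE : actions alg theta xi eta T = [seq arm N (indices t) | t <- iota 0 T].
Proof.
apply: (@eq_from_nth _ 0); rewrite /actions ?size_map ?size_history ?size_iota // => t tT.
rewrite (nth_map (0, 0)) ?size_history // nth_history //= lin_alg_history.
by rewrite (nth_map 0%N) ?size_iota // nth_iota.
Qed.

End LinHistory.

Section Measurability.
Context {R : realType} {d0 : measure_display} {Omega : measurableType d0}.
Variable P : probability Omega R.
Variables (d T : nat) (N : seq 'rV[R]_d) (K b0 : nat).
Hypothesis dpos : (0 < d)%N.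
Variables (theta : 'rV[R]_d) (xi eta : nat -> {RV P >-> R}).

Lemma discrete_measurable_real (S : countType) (f : Omega -> S) (g : S -> R) :
  discretely_measurable f -> measurable_fun setT (fun w => g (f w)).
Proof.
by move=> mf _ B mB; rewrite setTI; exact: (discrete_preimage (fun t => B (g t)) mf).
Qed.

Lemma discrete_offset l : discretely_measurable (fun w => offset K (xi ^~ w) l).
Proof.
apply: (@discrete_comp _ _ nat _ (fun w => Num.truncn (K%:R * xi l w)) (minn K)).
by apply: discrete_truncn; apply: measurable_funM => //; exact: measurable_funP.
Qed.

(** Strong induction on [t]: earlier indices are measurable, hence so are earlier rewards, block
    means and cells; the index at [t] is a function of finitely many offsets and cells. *)
Lemma discrete_indices t :
  discretely_measurable (fun w => indices T N K b0 theta (xi ^~ w) (eta ^~ w) t).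
Proof.
elim/ltn_ind: t => t IH.
pose r w := rewards T N K b0 theta (xi ^~ w) (eta ^~ w).
have mr s : (s < t)%N -> measurable_fun setT (fun w => r w s).
  move=> st; rewrite /r; under eq_fun => w do rewrite rewardsE //.
  apply: measurable_funD; last exact: measurable_funP.
  exact: (discrete_measurable_real (mu N theta) (IH s st)).
pose kk w := offset K (xi ^~ w).
have mcell l j : (sched d l.+1 <= t)%N -> (j < d)%N ->
    discretely_measurable (fun w => cells d T K b0 (kk w) (r w) l j).
  move=> lt jd; apply: discrete_truncn; apply: measurable_funM => //.
  apply: measurable_funB; last first.
    exact: (discrete_measurable_real (start R K b0 l) (discrete_offset l)).
  apply: measurable_minr => //; apply: measurable_funM => //.
  rewrite (_ : (fun w => block_sum d T (r w) l j) = (fun w => \sum_(i < 4 ^ l)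
    if (sched d l + j * 4 ^ l + i < T)%N
    then r w (sched d l + j * 4 ^ l + i)%N else 0)); last first.
    by apply/funext => w; rewrite /block_sum big_mkcond.
  apply: measurable_sum => i.
  have [_|_] // := boolP (sched d l + j * 4 ^ l + i < T)%N; apply: mr.
  exact: leq_trans (block_lt jd (ltn_ord i)) lt.
pose n := phase_of d t.
(* The finite data are coded as lists of natural numbers. The guard is there because [discrete_map]
   asks for measurability at every index, including those beyond the reach of [mcell]. *)
pose f w := ([seq kk w l | l <- iota 0 n],
  [seq [seq (if (sched d l.+1 <= t)%N && (j < d)%N then cells d T K b0 (kk w) (r w) l j else 0%N)
       | j <- iota 0 d] | l <- iota 0 n]).
have mf : discretely_measurable f.
  apply: discrete_pair; apply: discrete_map => l; first exact: discrete_offset.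
  apply: discrete_map => j.
  have [/andP[]|_] := boolP ((sched d l.+1 <= t)%N && (j < d)%N); [exact: mcell|exact: discrete_cst].
pose g (x : seq nat * seq (seq nat)) := slot_arm T N
  (run_of T N K b0 (nth 0%N x.1) (fun l => nth 0%N (nth [::] x.2 l)) n) (slot_of d t).
have := discrete_comp g mf; congr discretely_measurable.
apply/funext => w; rewrite /g /indices /index_at; congr (slot_arm _ _ _ _).
apply: run_congr => l j st ln jd; rewrite /slot_val.
rewrite (nth_map 0%N) ?size_iota // nth_iota // add0n.
case: (_ j) => // _; congr (grid _ _ _ _ _ _).
rewrite (nth_map 0%N) ?size_iota // nth_iota // add0n.
rewrite (nth_map 0%N) ?size_iota // nth_iota // add0n jd.
suff -> : (sched d l.+1 <= t)%N by [].
have /andP[h _] := phase_ofP dpos t.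
exact: leq_trans (leq_sched d ln) h.
Qed.

End Measurability.

(** * Union bound, subfamilies and uniform digits *)

Section UnionBound.
Context {R : realType} {d0 : measure_display} {Omega : measurableType d0}.
Variable P : probability Omega R.

Lemma union_bound (I : eqType) (s : seq I) (F : I -> set Omega) (c : I -> R)
    (E : set Omega) :
  measurable E -> (forall i, i \in s -> measurable (F i)) ->
  (forall i, i \in s -> P (F i) <= (c i)%:E)%E ->
  (forall w, E w -> exists2 i, i \in s & F i w) ->
  (P E <= (\sum_(i <- s) c i)%:E)%E.
Proof.
move=> mE mF hc hE.
have mU (r : seq I) : {subset r <= s} -> measurable (\big[setU/set0]_(i <- r) F i).
  elim: r => [|i r IH] sr; first by rewrite big_nil.
  rewrite big_cons; apply: measurableU; first by apply: mF; rewrite sr ?mem_head.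
  by apply: IH => j jr; rewrite sr // inE jr orbT.
apply: (@le_trans _ _ (P (\big[setU/set0]_(i <- s) F i))).
  apply: le_measure; rewrite ?inE //; first exact: mU.
  move=> w /hE[i iS Fi]; rewrite (big_rem i) //=; by left.
suff H (r : seq I) : {subset r <= s} ->
    (P (\big[setU/set0]_(i <- r) F i) <= (\sum_(i <- r) c i)%:E)%E by apply: H.
elim: r => [|i r IH] sr; first by rewrite !big_nil measure0.
have sr' : {subset r <= s} by move=> j jr; rewrite sr // inE jr orbT.
rewrite !big_cons EFinD; apply: le_trans (leeD (hc i _) (IH sr')).
  by apply: measureU2; [apply: mF; rewrite sr ?mem_head | exact: mU].
by rewrite sr ?mem_head.
Qed.

Lemma mutually_independent_inj (I J : eqType) (X : I -> {RV P >-> R}) (g : J -> I) :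
  injective g -> mutually_independent X -> mutually_independent (fun j => X (g j)).
Proof.
move=> ig hX s B us mB.
(* Indices outside the image of [g] get the full set. *)
pose B' i := if pselect (exists j, g j = i) is left h then B (projT1 (cid h)) else setT.
have B'E j : B' (g j) = B j.
  rewrite /B'; case: pselect => [h|[]]; last by exists j.
  by congr B; apply: ig; case: (cid h).
have := hX [seq g j | j <- s] B'; rewrite map_inj_uniq // => /(_ us).
rewrite big_map; under eq_bigr => j _ do rewrite B'E.
move=> <- => [|i]; last by rewrite /B'; case: pselect.
congr (P _); apply/seteqP; split=> w h.
  by move=> i /= /mapP[j js ->]; rewrite B'E; exact: h.
by move=> j js; rewrite -B'E; apply: h => /=; rewrite map_f.
Qed.

Lemma lee_prod_EFin (I : Type) (s : seq I) (F : I -> \bar R) (c : I -> R) :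
  (forall i, 0 <= F i)%E -> (forall i, F i <= (c i)%:E)%E ->
  (\prod_(i <- s) F i <= (\prod_(i <- s) c i)%:E)%E.
Proof.
move=> F0 Fc; elim: s => [|i s IH]; first by rewrite !big_nil.
by rewrite !big_cons EFinM; apply: lee_pmul => //; exact: prode_ge0.
Qed.

Lemma uniform_prob_le (B : set R) (a b : R) : measurable B -> a <= b ->
  (forall x, B x -> 0 <= x <= 1 -> a <= x <= b) ->
  (uniform_prob (@ltr01 R) B <= (b - a)%:E)%E.
Proof.
move=> mB ab hB; rewrite /uniform_prob integral_uniform_pdf.
apply: (@le_trans _ _ (\int[lebesgue_measure]_(x in `[a, b]) 1%E)%E).
  rewrite (eq_integral (fun=> 1%E)) => [|x]; last first.
    rewrite inE /= in_itv /= => -[_ x01].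
    by rewrite /uniform_pdf x01 subr0 invr1.
  apply: ge0_subset_integral => //; first exact: measurableI.
  by move=> x [Bx]; rewrite /= !in_itv /= => x01; exact: hB.
rewrite integral_cst //=. rewrite mul1e lebesgue_measure_itv /= lte_fin.
by case: ltP => // ba; rewrite lee_fin subr_ge0.
Qed.

(** Bound on the law of an offset: [K] digits of mass 1/K, and mass 0 for the value [K], which a
    draw in [0, 1] takes only at 1. *)
Definition digit_prob (K k : nat) : R := if (k < K)%N then K%:R^-1 else 0.

Definition digit_set (K k : nat) : set R := [set x | minn K (Num.truncn (K%:R * x)) = k].

Lemma measurable_digit_set K k : measurable (digit_set K k).
Proof.
apply: (@discrete_comp _ _ nat _ (fun x : R => Num.truncn (K%:R * x)) (minn K)).
by apply: discrete_truncn; exact: measurable_funM.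
Qed.

Lemma uniform_digit (X : {RV P >-> R}) K k : (0 < K)%N -> uniform01 X ->
  (P (X @^-1` digit_set K k) <= (digit_prob K k)%:E)%E.
Proof.
move=> K0 uX; have := uX _ (measurable_digit_set K k).
rewrite {1}/distribution /pushforward => ->.
have Kp : (0 : R) < K%:R by rewrite ltr0n.
rewrite /digit_prob; case: ifP => kK.
  have -> : (K%:R : R)^-1 = k.+1%:R / K%:R - k%:R / K%:R.
    by rewrite -mulrBl -natr1 addrAC subrr add0r mul1r.
  apply: uniform_prob_le; first exact: measurable_digit_set.
    by rewrite ler_pM2r ?invr_gt0 // ler_nat.
  move=> x; rewrite /digit_set /= => hk /andP[x0 x1].
  have hx : Num.truncn (K%:R * x) = k.
    by move: hk kK; rewrite /minn; case: ltnP => // _ ->; rewrite ltnn.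
  have /andP[h1 h2] := truncn_itv (mulr_ge0 (ltW Kp) x0).
  by rewrite ler_pdivrMr // ler_pdivlMr // -hx [x * _]mulrC h1 ltW.
rewrite -[X in (_ <= X%:E)%E](subrr (1 : R)); apply: uniform_prob_le => //; first exact: measurable_digit_set.
move=> x; rewrite /digit_set /= => hk /andP[x0 x1]; rewrite x1 andbT.
have h : (K <= Num.truncn (K%:R * x))%N.
  by move: hk kK; rewrite /minn; case: ltnP => [/ltnW//|_ <- /negbT]; rewrite -leqNgt.
have : (K%:R : R) <= K%:R * x.
  by rewrite -truncn_ge_nat // mulr_ge0 // ltW.
by rewrite -{1}[K%:R]mulr1 ler_pM2l.
Qed.

Lemma sum_digit_prob K : (0 < K)%N -> \sum_(k < K.+1) digit_prob K k = 1.
Proof.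
move=> K0; rewrite big_ord_recr /= /digit_prob ltnn addr0.
under eq_bigr => i _ do rewrite ltn_ord.
by rewrite sumr_const card_ord -[LHS]mulr_natl mulfV // pnatr_eq0; lia.
Qed.

Lemma digit_prob_ge0 K k : 0 <= digit_prob K k.
Proof. by rewrite /digit_prob; case: ifP => // _; rewrite invr_ge0. Qed.

End UnionBound.

(** * Probability of an unlucky offset *)

Section Unlucky.
Context {R : realType} {d0 : measure_display} {Omega : measurableType d0}.
Variable P : probability Omega R.
Variables (d T : nat) (N : seq 'rV[R]_d) (K b0 : nat).
Hypotheses (dpos : (0 < d)%N) (K0 : (0 < K)%N) (b00 : (0 < b0)%N).
Variables (theta : 'rV[R]_d) (xi : nat -> {RV P >-> R}).
Hypothesis uxi : forall k, uniform01 (xi k).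
Hypothesis ixi : mutually_independent xi.

Definition unlucky_set (l : nat) : set Omega :=
  [set w | unlucky T N K b0 theta (offset K (xi ^~ w)) l].

Lemma unlucky_congr kk kk' l : (forall i, (i <= l)%N -> kk i = kk' i) ->
  unlucky T N K b0 theta kk l -> unlucky T N K b0 theta kk' l.
Proof.
move=> h [j hj]; exists j; rewrite -h // (_ : ideal_run _ _ _ _ _ kk' l =
  ideal_run T N K b0 theta kk l) //.
by apply: run_congr => i k st il kd; rewrite h // ltnW.
Qed.

Lemma measurable_unlucky_set l : measurable (unlucky_set l).
Proof.
have mf : discretely_measurable (fun w => [seq offset K (xi ^~ w) i | i <- iota 0 l.+1]).
  by apply: discrete_map => i; exact: discrete_offset.
have := discrete_preimage (fun s => unlucky T N K b0 theta (nth 0%N s) l) mf.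
congr measurable; apply/seteqP; split=> w; apply: unlucky_congr => i il;
  by rewrite (nth_map 0%N) ?size_iota ?ltnS // nth_iota ?ltnS.
Qed.

(** Conditioning on the earlier offsets is done by enumeration: the event is covered by the cases of
    earlier offsets [f], slot [j] and current offset [k] with [k] bad. By independence a case has
    probability at most the product of its digit probabilities. For fixed [f] and [j] the ideal
    state is fixed, so at most one [k < K] is bad, contributing 1/K; summing over the d slots, and
    over all [f] with total mass 1, gives d/K. *)
Lemma unlucky_prob l : (P (unlucky_set l) <= (d%:R / K%:R)%:E)%E.
Proof.
(* The earlier offsets [f], followed by the candidate [k] from phase [l] on. *)
pose ext (f : {ffun 'I_l -> 'I_K.+1}) (k : nat) (i : nat) : nat :=
  if insub i is Some i' then f i' : nat else k.
pose isbad (x : {ffun 'I_l -> 'I_K.+1} * ('I_d * 'I_K.+1)) : bool :=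
  `[< bad K b0 l (mu N theta (slot_arm T N (ideal_run T N K b0 theta (ext x.1 x.2.2) l) x.2.1)) x.2.2 >].
pose F (x : {ffun 'I_l -> 'I_K.+1} * ('I_d * 'I_K.+1)) := \bigcap_(i in [set` iota 0 l.+1]) (xi i @^-1` digit_set K (ext x.1 x.2.2 i)).
pose c (x : {ffun 'I_l -> 'I_K.+1} * ('I_d * 'I_K.+1)) : R :=
  (\prod_(i < l) digit_prob K (x.1 i)) * digit_prob K x.2.2.
have mdig i k : measurable (xi i @^-1` digit_set K k).
  by rewrite -[_ @^-1` _]setTI; apply: measurable_funP => //; exact: measurable_digit_set.
have extl f k (i : 'I_l) : ext f k i = f i by rewrite /ext valK.
have extk f k : ext f k l = k by rewrite /ext insubF // ltnn.
apply: (@le_trans _ _ (\sum_(x <- [seq x <- enum {: {ffun 'I_l -> 'I_K.+1} * ('I_d * 'I_K.+1)} | isbad x]) c x)%:E).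
  apply: (@union_bound _ _ _ P _ _ F); first exact: measurable_unlucky_set.
  - move=> x _; apply: fin_bigcap_measurable => [|i _]; [exact: finite_seq|exact: mdig].
  - move=> x _; rewrite /F ixi ?iota_uniq //; last by move=> i; exact: measurable_digit_set.
    rewrite -[X in iota _ X]subn0 -/(index_iota 0 l.+1) big_mkord big_ord_recr /= /c EFinM extk.
    apply: lee_pmul => //; last exact: uniform_digit.
      by apply: prode_ge0.
    by apply: lee_prod_EFin => i; rewrite ?measure_ge0 // extl; exact: uniform_digit.
  - move=> w [j hj].
    have oK i : (offset K (xi ^~ w) i < K.+1)%N by rewrite ltnS geq_minl.
    pose f := [ffun i : 'I_l => Ordinal (oK i)].
    have E i : (i <= l)%N -> ext f (offset K (xi ^~ w) l) i = offset K (xi ^~ w) i.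
      rewrite /ext leq_eqVlt => /orP[/eqP->|il]; first by rewrite insubF ?ltnn.
      by rewrite insubT /= ffunE.
    exists (f, (j, Ordinal (oK l))).
      rewrite mem_filter mem_enum andbT; apply/asboolP => /=.
      rewrite (_ : ideal_run _ _ _ _ _ (ext _ _) l =
        ideal_run T N K b0 theta (offset K (xi ^~ w)) l) //.
      by apply: run_congr => i k st il kd; rewrite /= E // ltnW.
    move=> i il; have {}il : (i <= l)%N.
      by have : i \in iota 0 l.+1 by []; rewrite mem_iota.
    by rewrite /digit_set /= E.
rewrite lee_fin big_filter big_enum_cond /=.
rewrite big_mkcond /= -(pair_bigA _ (fun f y => if isbad (f, y) then c (f, y) else 0)) /=.
apply: (@le_trans _ _ (\sum_(f : {ffun 'I_l -> 'I_K.+1}) (\prod_(i < l) digit_prob K (f i)) * (d%:R / K%:R))).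
  apply: ler_sum => f _.
  apply: (@le_trans _ _ ((\prod_(i < l) digit_prob K (f i)) *
     \sum_(y : 'I_d * 'I_K.+1) if isbad (f, y) then digit_prob K y.2 else 0)).
    rewrite mulr_sumr; apply: ler_sum => y _; rewrite /c /=.
    by case: ifP => _ //; rewrite mulr0.
  apply: ler_wpM2l; first by apply: prodr_ge0 => i _; exact: digit_prob_ge0.
  rewrite -(pair_bigA _ (fun j k => if isbad (f, (j, k)) then digit_prob K k else 0)) /=.
  rewrite -[d in d%:R]card_ord mulr_natl -sumr_const; apply: ler_sum => j _.
  (* The state entering phase [l] reads offsets below [l] only, hence is the same for every
     candidate [k]; this makes [bad_uniq] applicable. *)
  have indep_k k : ideal_run T N K b0 theta (ext f k) l = ideal_run T N K b0 theta (ext f 0%N) l.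
    apply: run_congr => i j' st il kd; rewrite /ext; case: insubP => // /negP[]; exact: il.
  have [[k0 /andP[k0K bk0]]|nk] := pselect (exists k0 : 'I_K.+1, (k0 < K)%N && isbad (f, (j, k0))).
    rewrite (bigD1 k0) //= bk0 /digit_prob k0K big1 ?addr0 // => k kk0.
    case: ifP => // bk; case: ifP => // kK; case/eqP: kk0; apply: val_inj => /=.
    move/asboolP: bk0; move/asboolP: bk; rewrite /= !indep_k.
    exact: bad_uniq.
  rewrite big1 ?invr_ge0 // => k _; case: ifP => // bk; rewrite /digit_prob.
  by case: ifP => // kK; case: nk; exists k; rewrite kK.
rewrite -mulr_suml -[X in _ <= X]mul1r ler_wpM2r ?divr_ge0 //.
(* Distributivity: the sum over all [f] of the products is a product of sums, each equal to 1. *)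
by rewrite -(bigA_distr_bigA (fun _ k => digit_prob K (k : 'I_K.+1))) /= big1 // => i _; exact: sum_digit_prob.
Qed.

End Unlucky.

(** * Replicability and expected regret *)

Section Guarantees.
Context {R : realType} {d0 : measure_display} {Omega : measurableType d0}.
Variable P : probability Omega R.
Variables (d T L : nat) (N : seq 'rV[R]_d) (K b0 : nat).
Hypotheses (dpos : (0 < d)%N) (T0 : (0 < T)%N) (K0 : (0 < K)%N) (b00 : (0 < b0)%N).
Hypothesis TL : (T < 2 ^ L)%N.
Hypothesis uN : unit_arms N.
Hypothesis N0 : (0 < size N)%N.
Variable theta : 'rV[R]_d.
Hypothesis htheta : l2norm theta <= 1.

Lemma sched_lt_L l : (sched d l.+1 <= T)%N -> (l < L)%N.
Proof.
rewrite schedS => h; have h1 : (2 ^ l <= T)%N.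
  have h2 : (2 ^ l <= 4 ^ l)%N by rewrite -[4%N]/(2 * 2)%N expnMn leq_pmulr ?expn_gt0.
  by nia.
by rewrite -(@ltn_exp2l 2) //; exact: leq_ltn_trans TL.
Qed.

Definition bad_noise (eta : nat -> {RV P >-> R}) : set Omega :=
  [set w | ~ good d T b0 (eta ^~ w)].

Definition noise_prob : R := (L * d)%:R * (2 * expR (- (b0%:R ^+ 2 / 2))).

Section Noise.
Variable eta : nat -> {RV P >-> R}.
Hypothesis ieta : mutually_independent (fun t : 'I_T => eta t).
Hypothesis mmt_eta : forall t, (t < T)%N -> forall c,
  ('M_P (eta t) c <= (expR (c ^+ 2 / 2))%:E)%E.

Let blk l j w : R := \sum_(i < 4 ^ l) eta (sched d l + j * 4 ^ l + i)%N w.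

Let F l j : set Omega := if (sched d l.+1 <= T)%N && (j < d)%N
  then [set w | b0%:R * 2 ^+ l < `|blk l j w|] else set0.

Let measurable_F l j : measurable (F l j).
Proof.
rewrite /F; case: ifP => // _.
rewrite (_ : [set w | _] = setT `&` (fun w => `|blk l j w|) @^-1` `]b0%:R * 2 ^+ l, +oo[).
  apply: measurableT_comp => //; apply: measurable_sum => i; exact: measurable_funP.
by apply/seteqP; split=> w /=; rewrite in_itv /= andbT => // -[].
Qed.

Let bad_noiseE w : bad_noise eta w <-> exists l j, F l j w.
Proof.
split=> [ng|[l [j]]].
  apply: contrapT => H; apply: ng => l j lT jd; rewrite leNgt; apply/negP => h.
  by apply: H; exists l, j; rewrite /F lT jd.
rewrite /F; case: ifP => // /andP[lT jd] /= h g.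
by have := g l j lT jd; rewrite leNgt h.
Qed.

Lemma measurable_bad_noise : measurable (bad_noise eta).
Proof.
rewrite (_ : bad_noise eta = \bigcup_l \bigcup_j F l j).
  by apply: bigcupT_measurable => l; apply: bigcupT_measurable => j; exact: measurable_F.
apply/seteqP; split=> w; first by move/bad_noiseE => [l [j h]]; exists l => //; exists j.
by move=> [l _ [j _ h]]; apply/bad_noiseE; exists l, j.
Qed.

Lemma bad_noise_prob : (P (bad_noise eta) <= noise_prob%:E)%E.
Proof.
have -> : noise_prob = \sum_(x <- enum {: 'I_L * 'I_d}) 2 * expR (- (b0%:R ^+ 2 / 2)).
  by rewrite big_enum sumr_const card_prod !card_ord /noise_prob mulr_natl.
apply: (@union_bound _ _ _ P _ _ (fun x : 'I_L * 'I_d => F x.1 x.2)).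
- exact: measurable_bad_noise.
- by move=> x _; exact: measurable_F.
- move=> [l j] _; rewrite /F; case: ifP => [/andP[lT jd]|_]; last first.
    by rewrite measure0 lee_fin mulr_ge0 ?expR_ge0.
  pose base := (sched d l + j * 4 ^ l)%N.
  pose J : seq 'I_T := pmap insub (iota base (4 ^ l)).
  have lt i : (i < 4 ^ l)%N -> (base + i < T)%N.
    by move=> il; apply: leq_trans (block_lt jd il) lT.
  have mapJ : [seq val t | t <- J] = iota base (4 ^ l).
    rewrite /J (@pmap_filter _ _ insub val); last by move=> x; exact: insubK.
    apply/all_filterP/allP => i; rewrite mem_iota => /andP[h1 h2].
    by rewrite isSome_insub -(subnKC h1) lt //; lia.
  have sJ : size J = (4 ^ l)%N by rewrite -(size_map val) mapJ size_iota.
  have uJ : uniq J by rewrite pmap_sub_uniq // iota_uniq.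
  have blkE w : blk l j w = \sum_(t <- J) eta t w.
    rewrite -(big_map val xpredT (fun t => eta t w)) mapJ.
    rewrite -[base]addn0 iotaDl big_map -[X in iota _ X]subn0 -/(index_iota 0 _) big_mkord.
    by [].
  have a0 : 0 < b0%:R * 2 ^+ l :> R by rewrite mulr_gt0 ?exprn_gt0 ?ltr0n.
  have J0 : (0 < size J)%N by rewrite sJ expn_gt0.
  have := subgaussian_sum_tail ieta uJ J0 a0 (fun t _ => mmt_eta (ltn_ord t)).
  (* The block length cancels against the threshold, so a single [b0] gives the same failure
     probability in every phase. *)
  rewrite sJ pow4 (_ : (b0%:R * 2 ^+ l) ^+ 2 / (2 * (2 ^+ l * 2 ^+ l)) = b0%:R ^+ 2 / 2 :> R); last first.
    by field; rewrite expf_neq0.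
  by congr (P _ <= _)%E; apply/seteqP; split=> w /=; rewrite blkE.
- move=> w /bad_noiseE[l [j h]].
  have /andP[lT jd] : (sched d l.+1 <= T)%N && (j < d)%N by move: h; rewrite /F; case: ifP.
  by exists (Ordinal (sched_lt_L lT), Ordinal jd); rewrite ?mem_enum.
Qed.

End Noise.

Variable xi : nat -> {RV P >-> R}.
Hypothesis uxi : forall k, uniform01 (xi k).

Local Notation alg := (lin_alg T N K b0).
Local Notation idx eta w := (indices T N K b0 theta (xi ^~ w) (eta ^~ w)).

Let offK w l : (offset K (xi ^~ w) l <= K)%N.
Proof. exact: geq_minl. Qed.

Lemma indices_ideal (eta : nat -> {RV P >-> R}) w : ~ bad_noise eta w ->
  (forall l, (l < L)%N -> ~ unlucky_set T N K b0 theta xi l w) ->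
  forall t, (t < T)%N ->
  idx eta w t = index_at T N (ideal_run T N K b0 theta (offset K (xi ^~ w))) t.
Proof.
move=> /contrapT g nu t tT; rewrite /indices /index_at.
have /andP[h1 h2] := phase_ofP dpos t.
rewrite (@real_run_ideal _ _ _ _ _ _ dpos K0 b00 theta (offset K (xi ^~ w)) _ (eta ^~ w)) //.
- by move=> s _; exact: rewardsE.
- exact: leq_trans h1 (ltnW tT).
- move=> l lt; apply: nu; apply: sched_lt_L.
  by apply: leq_trans (leq_sched d lt) _; exact: leq_trans h1 (ltnW tT).
Qed.

(** Outside the noise failures of the two executions and the unlucky offsets of the first [L]
    phases, both executions play the indices of the ideal run. *)
Lemma agree_prob (eta1 eta2 : nat -> {RV P >-> R}) (rho : R) :
  mutually_independent xi ->
  mutually_independent (fun t : 'I_T => eta1 t) ->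
  mutually_independent (fun t : 'I_T => eta2 t) ->
  (forall t, (t < T)%N -> forall c, 'M_P (eta1 t) c <= (expR (c ^+ 2 / 2))%:E)%E ->
  (forall t, (t < T)%N -> forall c, 'M_P (eta2 t) c <= (expR (c ^+ 2 / 2))%:E)%E ->
  noise_prob + noise_prob + L%:R * (d%:R / K%:R) <= rho ->
  ((1 - rho)%:E <= P [set w | actions alg theta (xi ^~ w) (eta1 ^~ w) T =
       actions alg theta (xi ^~ w) (eta2 ^~ w) T])%E.
Proof.
move=> ixi i1 i2 m1 m2 hrho; set E := [set w | _].
have mE : measurable E.
  have mi (eta : nat -> {RV P >-> R}) :
      discretely_measurable (fun w => [seq idx eta w t | t <- iota 0 T]).
    by apply: discrete_map => t; exact: discrete_indices.
  have := discrete_preimage (fun x : seq nat * seq nat =>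
    [seq arm N i | i <- x.1] = [seq arm N i | i <- x.2]) (discrete_pair (mi eta1) (mi eta2)).
  by congr measurable; apply/seteqP; split=> w; rewrite /E /= !actionsE // -!map_comp.
have PE : P E = (1 - P (~` E))%E.
  have fE : P E \is a fin_num by rewrite fin_num_measure.
  by rewrite probability_setC // -(fineK fE) -!EFinB; congr (_%:E); ring.
rewrite PE EFinB leeB //.
(* [None] and [Some None] index the noise failures of the two executions, the rest the unlucky
   phases. *)
pose F (o : option (option 'I_L)) : set Omega := match o with
  | None => bad_noise eta1 | Some None => bad_noise eta2
  | Some (Some l) => unlucky_set T N K b0 theta xi l end.
pose c (o : option (option 'I_L)) : R := match o with
  | None => noise_prob | Some None => noise_prob | Some (Some l) => d%:R / K%:R end.
have hs : \sum_(o <- None :: Some None :: [seq Some (Some l) | l <- enum 'I_L]) c o <= rho.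
  rewrite !big_cons big_map /= big_enum sumr_const card_ord -[(_ / _) *+ _]mulr_natl.
  by rewrite addrA.
apply: le_trans (_ : _ <= (\sum_(o <- None :: Some None :: [seq Some (Some l) | l <- enum 'I_L]) c o)%:E)%E _; last by rewrite lee_fin.
apply: (@union_bound _ _ _ P _ _ F).
- exact: measurableC.
- move=> [[l|]|] _ /=; [exact: measurable_unlucky_set|exact: measurable_bad_noise|exact: measurable_bad_noise].
- move=> [[l|]|] _ /=; [exact: unlucky_prob|exact: bad_noise_prob|exact: bad_noise_prob].
- move=> w nE; apply: contrapT => H; apply: nE.
  have n1 : ~ bad_noise eta1 w by move=> h; apply: H; exists None => //; rewrite inE.
  have n2 : ~ bad_noise eta2 w by move=> h; apply: H; exists (Some None) => //; rewrite !inE.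
  have nu l : (l < L)%N -> ~ unlucky_set T N K b0 theta xi l w.
    move=> lL h; apply: H; exists (Some (Some (Ordinal lL))) => //.
    by rewrite !inE /=; apply/mapP; exists (Ordinal lL); rewrite ?mem_enum.
  rewrite /E /= !actionsE //; apply/eq_in_map => t; rewrite mem_iota => /= tT.
  by rewrite (indices_ideal n1 nu tT) (indices_ideal n2 nu tT).
Qed.

Variable A : set 'rV[R]_d.
Hypothesis netA : is_net T A N.
Hypothesis A1 : forall a, A a -> l2norm a <= 1.

(** The three terms: elimination on good noise, replacing the supremum over [A] by the best arm of
    the net (1/T per round), and at most 2 per round on bad noise. *)
Lemma regret_bound (eta : nat -> {RV P >-> R}) :
  mutually_independent (fun t : 'I_T => eta t) ->
  (forall t, (t < T)%N -> forall c, 'M_P (eta t) c <= (expR (c ^+ 2 / 2))%:E)%E ->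
  (expected_regret A alg T theta xi eta <=
    (384 * d%:R * Num.sqrt d%:R * K%:R * b0%:R * Num.sqrt T%:R + 1 +
     2 * T%:R * noise_prob)%:E)%E.
Proof.
move=> ie me; set M := 384 * _ * _ * _ * _ * _.
have Tp : (0 : R) < T%:R by rewrite ltr0n.
pose S w : R := \sum_(t < T) mu N theta (idx eta w t).
have SE w : \sum_(a <- actions alg theta (xi ^~ w) (eta ^~ w) T) dot theta a = S w.
  rewrite actionsE // big_map -[X in iota _ X]subn0 -/(index_iota 0 _) big_mkord.
  by [].
have mS : measurable_fun setT S.
  apply: measurable_sum => t.
  by apply: (discrete_measurable_real (mu N theta)); exact: discrete_indices.
have St w : `|S w| <= T%:R.
  apply: (le_trans (ler_norm_sum _ _ _)).
  rewrite -[T in T%:R]card_ord -sumr_const; apply: ler_sum => t _; exact: mu_le1.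
pose ks := argbest N (fun=> true) (mu N theta) 0%N.
have [ksN _ ksmax] : [/\ (ks < size N)%N, true & forall k, (k < size N)%N -> true ->
    mu N theta k <= mu N theta ks] by exact: argbestP.
pose s := sup [set dot theta a | a in A].
have [_ _ NA near] := netA.
have nonempty : [set dot theta a | a in A] !=set0.
  by exists (dot theta (nth 0 N 0)); exists (nth 0 N 0) => //; apply: NA; exact: mem_nth.
have s1 : s <= 1.
  apply: ge_sup => // x [a Aa <-]; have := norm_dot_le1 htheta (A1 Aa).
  by rewrite ler_norml => /andP[].
have s2 : s <= mu N theta ks + T%:R^-1.
  apply: ge_sup => // x [a Aa <-]; have [a' a'N aa'] := near a Aa.
  have := norm_dot_small Tp htheta aa'; rewrite dotBr ler_norml => /andP[_ h].
  have := ksmax (index a' N); rewrite index_mem => /(_ a'N isT).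
  by rewrite {1}/mu /arm nth_index //; lra.
(* The bound holds pointwise, for every value of the offsets; only the indicator of bad noise is
   left to be integrated. *)
have key w : T%:R * s - (M + 1) - 2 * T%:R * \1_(bad_noise eta) w <= S w.
  rewrite indicE; have [h|h] := pselect (bad_noise eta w).
    rewrite (mem_set h) mulr1.
    have := St w; rewrite ler_norml => /andP[h1 h2].
    have M0 : 0 <= M by rewrite !mulr_ge0 ?ler0n ?sqrtr_ge0.
    have : T%:R * s <= T%:R by rewrite -[X in _ <= X]mulr1 ler_pM2l.
    lra.
  rewrite (memNset h) mulr0 subr0.
  have := @total_regret _ _ _ _ _ _ dpos T0 K0 b00 uN N0 theta htheta
    (offset K (xi ^~ w)) _ (eta ^~ w) (offK w)
    (fun t _ => rewardsE T N K b0 dpos theta (xi ^~ w) (eta ^~ w) t) (contrapT h)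
    ks ksN (fun k kN => ksmax k kN isT).
  rewrite sumrB sumr_const card_ord -[_ *+ T]mulr_natl => h'.
  have {}h' : T%:R * mu N theta ks - S w <= M by exact: h'.
  have : T%:R * s <= T%:R * mu N theta ks + 1.
    have -> : T%:R * mu N theta ks + 1 = T%:R * (mu N theta ks + T%:R^-1).
      by rewrite mulrDr mulfV // gt_eqF.
    by rewrite ler_pM2l.
  move: h'; lra.
rewrite /expected_regret unlock -/s.
under eq_integral => w _ do rewrite SE.
have mB := measurable_bad_noise eta.
have bi (f : Omega -> R) (c : R) : measurable_fun setT f -> (forall w, `|f w| <= c) ->
    P.-integrable setT (EFin \o f).
  move=> mf fc; apply: measurable_bounded_integrable => //.
    by rewrite -ge0_fin_numE // fin_num_measure.
  exists c; split; first exact: num_real.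
  by move=> y cy w _; apply: le_trans (fc w) (ltW cy).
have mi : measurable_fun setT (fun w => 2 * T%:R * \1_(bad_noise eta) w : R).
  by apply: measurable_funM => //; exact: measurable_indic.
have ii : P.-integrable setT (EFin \o (fun w => 2 * T%:R * \1_(bad_noise eta) w : R)).
  apply: (bi _ (2 * T%:R)) => // w; rewrite indicE; case: (_ \in _).
    by rewrite mulr1 ger0_norm // mulr_ge0.
  by rewrite mulr0 normr0 mulr_ge0.
have ic (c : R) : P.-integrable setT (EFin \o (fun=> c)).
  by apply: (bi _ `|c|) => //; exact: measurable_cst.
have le1 : ((T%:R * s - (M + 1))%:E - \int[P]_w (2 * T%:R * \1_(bad_noise eta) w)%:E <= \int[P]_w (S w)%:E)%E.
  have -> : ((T%:R * s - (M + 1))%:E = \int[P]_w (T%:R * s - (M + 1))%:E)%E.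
    by rewrite integral_cst //= probability_setT mule1.
  rewrite -integralB_EFin //; apply: le_integral => //.
  - by apply: integrableB => //; exact: ic.
  - exact: (bi S T%:R).
  - by move=> w _; rewrite -EFinB lee_fin; exact: key.
have le2 : (\int[P]_w (2 * T%:R * \1_(bad_noise eta) w)%:E <= (2 * T%:R * noise_prob)%:E)%E.
  under eq_integral => w _ do rewrite EFinM.
  rewrite ge0_integralZl //; last exact/measurable_EFinP/measurable_indic.
  rewrite integral_indic // setIT [in X in (_ <= X)%E]EFinM.
  by apply: lee_wpmul2l; [rewrite lee_fin mulr_ge0 | exact: bad_noise_prob].
have fS : (\int[P]_w (S w)%:E)%E \is a fin_num by apply: integrable_fin_num => //; exact: (bi S T%:R).
have fI : (\int[P]_w (2 * T%:R * \1_(bad_noise eta) w)%:E)%E \is a fin_num by apply: integrable_fin_num.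
rewrite -(fineK fS) -(fineK fI) in le1 le2 *.
move: le1 le2; rewrite -!EFinB !lee_fin; lra.
Qed.

End Guarantees.

(** * The program *)

Definition block (l : seq cmd) : cmd := foldr Seq Skip l.

(* Counts cell c from 1 to the content of cell nn; cell 3 holds 1. *)
Definition For (c nn : nat) (body : cmd) : cmd :=
  Seq (Do (ILit c 1)) (While (ILe c nn) (Seq body (Do (IAdd c c 3)))).

(** * Program logic for total correctness with time bounds *)

Section Hoare.
Variables (R : realType) (d : nat) (N : seq 'rV[R]_d) (xi r : nat -> R).
Implicit Types (s : state R d) (p q : cmd) (n m : nat).

Definition ok p s n (Q : state R d -> Prop) : Prop :=
  exists s' m, [/\ exec N xi r p s s' m, (m <= n)%N & Q s'].

Lemma ok_weaken p s n n' (Q Q' : state R d -> Prop) :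
  ok p s n Q -> (n <= n')%N -> (forall s', Q s' -> Q' s') -> ok p s n' Q'.
Proof.
move=> [s' [m [h1 h2 h3]]] nn' QQ'; exists s', m; split=> //; last exact: QQ'.
exact: leq_trans nn'.
Qed.

Lemma ok_skip s n (Q : state R d -> Prop) : Q s -> ok (block [::]) s n Q.
Proof. by move=> h; exists s, 0%N; split=> //; exact: ExecSkip. Qed.

Lemma ok_do i s s' n (Q : state R d -> Prop) :
  step N xi r i s = Some s' -> Q s' -> ok (Do i) s n.+1 Q.
Proof. by move=> h q; exists s', 1%N; split=> //; exact: ExecDo. Qed.

Lemma ok_seq p q s m n Q :
  ok p s m (fun s' => ok q s' n Q) -> ok (Seq p q) s (m + n) Q.
Proof.
move=> [s' [m' [h1 h2 [s'' [n' [h3 h4 h5]]]]]].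
by exists s'', (m' + n')%N; split=> //; [exact: ExecSeq h3|exact: leq_add h2 h4].
Qed.

Lemma ok_cons p l s m n Q :
  ok p s m (fun s' => ok (block l) s' n Q) -> ok (block (p :: l)) s (m + n) Q.
Proof. exact: ok_seq. Qed.

Lemma ok_instr i l s s' n Q : step N xi r i s = Some s' ->
  ok (block l) s' n Q -> ok (block (Do i :: l)) s n.+1 Q.
Proof. by move=> h q; rewrite -add1n; apply: ok_cons; apply: (@ok_do _ _ s' 0); [exact: h|exact: q]. Qed.

Lemma ok_last p s n Q : ok p s n Q -> ok (block [:: p]) s n Q.
Proof.
move=> h; rewrite -[n]addn0; apply: ok_cons; apply: ok_weaken h _ _ => // s' q.
exact: ok_skip.
Qed.

Lemma ok_if c p q s n Q :
  ok (if eval_test c s then p else q) s n Q -> ok (If c p q) s n.+1 Q.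
Proof.
case: ifPn => hc [s' [m [h1 h2 h3]]]; exists s', m.+1; split=> //.
  exact: ExecIfTrue.
exact: ExecIfFalse.
Qed.

Lemma ok_while (I : nat -> state R d -> Prop) (B : nat) c p s t Q :
  I 0%N s ->
  (forall i s, I i s -> eval_test c s -> (i < B)%N /\ ok p s t (I i.+1)) ->
  (forall i s, I i s -> ~~ eval_test c s -> Q s) ->
  ok (While c p) s (B * t.+1).+1 Q.
Proof.
move=> I0 hb hQ.
suff H k i s' : (B - i <= k)%N -> (i <= B)%N -> I i s' ->
    ok (While c p) s' ((B - i) * t.+1).+1 Q.
  by have := H B 0%N s; rewrite subn0; apply.
elim: k i s' => [|k IH] i s' hk iB Ii.
  case ec : (eval_test c s'); first by have [] := hb _ _ Ii ec; lia.
  by exists s', 1%N; split=> //; [apply: ExecWhileFalse; rewrite ec | apply: hQ Ii _; rewrite ec].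
case ec : (eval_test c s'); last first.
  by exists s', 1%N; split=> //; [apply: ExecWhileFalse; rewrite ec | apply: hQ Ii _; rewrite ec].
have [iltB [s1 [m1 [h1 h2 h3]]]] := hb _ _ Ii ec.
have [||s2 [m2 [h4 h5 h6]]] := IH i.+1 s1 _ _ h3; [lia|exact: iltB|].
exists s2, (m1 + m2).+1; split=> //; first exact: ExecWhileTrue h4.
rewrite (_ : (B - i = (B - i.+1).+1)%N); last lia.
by rewrite mulSn; lia.
Qed.

Variable W : nat.
Hypothesis W64 : (64 <= W)%N.

Lemma pow_W k : (64 * W ^ k <= W ^ k.+1)%N.
Proof. by rewrite expnS leq_mul2r W64 orbT. Qed.

(** All costs are rounded up to powers of one number [W] that bounds every loop length. A loop
    raises the exponent by two: one for the iterations, one to absorb the tests. *)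
Lemma ok_while_W (I : nat -> state R d -> Prop) (B k : nat) c p s Q :
  (B <= W)%N -> I 0%N s ->
  (forall i s, I i s -> eval_test c s -> (i < B)%N /\ ok p s (W ^ k) (I i.+1)) ->
  (forall i s, I i s -> ~~ eval_test c s -> Q s) ->
  ok (While c p) s (W ^ k.+2) Q.
Proof.
move=> BW I0 hb hQ; apply: (ok_weaken (ok_while I0 hb hQ)) => //.
have h1 := pow_W k; have h2 := pow_W k.+1.
have h0 : (0 < W ^ k)%N by rewrite expn_gt0; lia.
apply: (@leq_trans (W * (W ^ k).+1).+1); first by rewrite ltnS leq_mul2r BW orbT.
rewrite mulnS -expnS; have : (W <= W ^ k.+1)%N by rewrite expnS leq_pmulr.
lia.
Qed.

(** The counter starts at 1, so [I i] goes with the counter value [i.+1]; the body has to yield the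
    invariant for the state after the increment. *)
Lemma ok_for (I : nat -> state R d -> Prop) (n k : nat) c nn body s Q :
  (n <= W)%N -> c != nn -> c != 3%N -> imem s nn = n -> imem s 3 = 1%N ->
  I 0%N (set_idx s c 1) ->
  (forall i s, (i < n)%N -> I i s ->
    imem s c = i.+1 -> imem s nn = n -> imem s 3 = 1%N ->
    ok body s (W ^ k) (fun s' => [/\ imem s' c = i.+1, imem s' nn = n,
      imem s' 3 = 1%N & I i.+1 (set_idx s' c i.+2)])) ->
  (forall s, I n s -> Q s) ->
  ok (For c nn body) s (W ^ k.+2) Q.
Proof.
move=> nW cnn c3 snn s3 I0 hb hQ.
pose J i (s : state R d) := [/\ imem s c = i.+1, imem s nn = n, imem s 3 = 1%N, (i <= n)%N & I i s].
apply: (@ok_weaken _ _ (1 + (n * (W ^ k + 1).+1).+1)) => [| |s' h]; last exact: h.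
  apply: ok_seq; apply: ok_do => //=.
  apply: (@ok_while J).
  - by split=> //=; rewrite ?eqxx // eq_sym ?(negbTE cnn) ?(negbTE c3).
  - move=> i s' [h1 h2 h3 h4 h5] /=; rewrite h1 h2 => il; split=> //.
    apply: ok_seq; apply: (ok_weaken (hb i s' il h5 h1 h2 h3)) => // s1 [g1 g2 g3 g4].
    apply: ok_do => //=; rewrite g1 g3 addn1.
    by split=> //=; rewrite ?eqxx // eq_sym ?(negbTE cnn) ?(negbTE c3).
  - move=> i s' [h1 h2 h3 h4 h5] /=; rewrite h1 h2 -leqNgt => h.
    by apply: hQ; rewrite (_ : n = i) //; lia.
have h1 := pow_W k; have h2 := pow_W k.+1.
have h0 : (0 < W ^ k)%N by rewrite expn_gt0; lia.
have h3 : (n * (W ^ k + 1).+1 <= W * (W ^ k + 1).+1)%N by rewrite leq_mul2r nW orbT.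
have h4 : (W <= W ^ k.+1)%N by rewrite expnS leq_pmulr.
have h5 : (W * (W ^ k + 1).+1 = W ^ k.+1 + 2 * W)%N by rewrite expnS; lia.
by lia.
Qed.

End Hoare.

Arguments block : simpl never.
Arguments For : simpl never.

(* Index cells: 0 T, 1 d, 2 number of arms, 3 one, 4 row length d + 2, 5 base
   address 64, 6 address of the row after the table, 7 number of pivot steps,
   8 d + 1, 9 zero, 10 plays per slot, 18 and 19 number and row address of the
   best arm, 60 number of the next round counted from 1, 65 to 64 + d the basis.
   Real cells: 0 rho, 1 one, 2 T, 4 K, 5 d, 10 plays per slot, 11 beta, 12 delta,
   13 alpha, 14 start.  The row of an arm holds its activity flag, its d
   coordinates in the basis and its estimate. *)
Definition rows_loop (body : cmd) : cmd :=
  block [:: Do (IAdd 31 5 9);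
    For 30 2 (block [:: body; Do (IAdd 31 31 4)])].

Definition init_table : cmd :=
  block [:: rows_loop (block [:: Do (ISub 32 30 3);
      For 40 1 (block [:: Do (ISub 51 40 3); Do (RArm 50 32 51);
        Do (ROp RMul 50 50 2); Do (IAdd 51 31 40); Do (RStore 51 50)]);
      Do (IAdd 51 31 8); Do (RLit 50 0); Do (RStore 51 50)]);
    For 40 1 (block [:: Do (IAdd 50 5 40); Do (ILit 51 0); Do (IStore 50 51)])].

(** Index cell 21 is 0 as long as nothing is found and otherwise the column counted from 1. Cell 22
    holds the arm counted from 1, which is already its code in the basis, and cell 23 its row
    address. *)
Definition search_prog : cmd :=
  block [:: Do (ILit 21 0);
    rows_loop (block [:: Do (RLoad 50 31);
      If (RLe 1 50)
        (For 40 1 (block [:: Do (IAdd 50 31 40); Do (RLoad 50 50);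
          Do (ROp RMul 50 50 50); Do (RLit 51 4);
          If (RLe 50 51) (block [::])
            (block [:: Do (IAdd 21 40 9); Do (IAdd 22 30 9); Do (IAdd 23 31 9)])]))
        (block [::])])].

(** The pivot row is itself overwritten, so it is first copied behind the table and its pivot entry
    saved in real cell 24. The inner loop also spoils column [i], which receives its quotient
    afterwards. *)
Definition pivot_prog : cmd :=
  block [:: For 40 1 (block [:: Do (IAdd 50 23 40); Do (RLoad 50 50);
      Do (IAdd 51 6 40); Do (RStore 51 50)]);
    Do (IAdd 50 23 21); Do (RLoad 24 50);
    rows_loop (block [:: Do (IAdd 32 31 21); Do (RLoad 30 32);
      Do (ROp RDiv 30 30 24);
      For 40 1 (block [:: Do (IAdd 52 31 40); Do (RLoad 50 52);
        Do (IAdd 51 6 40); Do (RLoad 51 51); Do (ROp RMul 51 51 30);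
        Do (ROp RSub 50 50 51); Do (RStore 52 50)]);
      Do (RStore 32 30)]);
    Do (IAdd 50 5 21); Do (IStore 50 22)].

Definition span_prog : cmd :=
  For 20 7 (block [:: search_prog; If (ILe 3 21) pivot_prog (block [::])]).

(** The integer part of [K * xi] is never formed: 1 is subtracted as long as possible, and each time
    the start of the grid moves up by [delta]. *)
Definition draw_prog : cmd :=
  block [:: Do (RLit 50 3); Do (ROp RMul 12 50 11); Do (ROp RMul 13 4 12);
    Do (RDraw 50); Do (ROp RMul 50 4 50);
    Do (RLit 14 0); Do (ROp RSub 14 14 1); Do (ROp RSub 14 14 13);
    While (RLe 1 50)
      (block [:: Do (ROp RSub 50 50 1); Do (ROp RAdd 14 14 12)])].

Definition play_prog : cmd :=
  block [:: Do (IAdd 50 5 20); Do (ILoad 21 50);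
    If (ILe 3 21) (Do (ISub 22 21 3)) (Do (IAdd 22 18 9));
    Do (RLit 25 0);
    For 30 10 (If (ILe 60 0)
      (block [:: Do (RPlay 22 50); Do (ROp RAdd 25 25 50); Do (IAdd 60 60 3)])
      (block [::]))].

(** Real cell 26 climbs the boundaries while the next one, in cell 27, does not exceed the clamped
    mean; an artificial slot is then reset to 0. *)
Definition round_prog : cmd :=
  block [:: Do (ROp RDiv 25 25 10);
    If (RLe 1 25) (Do (RLit 25 1)) (block [::]);
    Do (RLit 50 0); Do (ROp RAdd 26 14 50); Do (ROp RAdd 27 26 13);
    While (RLe 27 25)
      (block [:: Do (ROp RAdd 26 26 13); Do (ROp RAdd 27 26 13)]);
    If (ILe 3 21) (block [::]) (Do (RLit 26 0))].

Definition est_prog : cmd :=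
  rows_loop (block [:: Do (IAdd 50 31 20); Do (RLoad 50 50);
    Do (ROp RMul 50 50 26); Do (IAdd 51 31 8); Do (RLoad 52 51);
    Do (ROp RAdd 52 52 50); Do (RStore 51 52)]).

Definition slots_prog : cmd :=
  For 20 1 (block [:: play_prog; round_prog; est_prog]).

Definition best_prog : cmd :=
  block [:: Do (IAdd 50 19 8); Do (RLoad 20 50);
    rows_loop (block [:: Do (RLoad 50 31);
      If (RLe 1 50)
        (block [:: Do (IAdd 50 31 8); Do (RLoad 51 50);
          If (RLe 20 51)
            (block [:: Do (RLoad 20 50); Do (ISub 18 30 3); Do (IAdd 19 31 9)])
            (block [::])])
        (block [::])])].

Definition elim_prog : cmd :=
  block [:: Do (RLit 50 8); Do (ROp RMul 21 50 5); Do (ROp RMul 21 21 13);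
    rows_loop (block [:: Do (IAdd 50 31 8); Do (RLoad 50 50);
      Do (ROp RAdd 50 50 21);
      If (RLe 20 50) (block [::])
        (block [:: Do (RLit 50 0); Do (RStore 31 50)])])].

(** Indices cannot be multiplied, so the block length is quadrupled by two doublings. *)
Definition phase_prog : cmd :=
  block [:: draw_prog; init_table; span_prog; slots_prog; best_prog; elim_prog;
    Do (IAdd 10 10 10); Do (IAdd 10 10 10); Do (RLit 50 4);
    Do (ROp RMul 10 10 50); Do (RLit 50 2); Do (ROp RDiv 11 11 50)].

(** Conversions and roundings are counting loops: the least i with i rho > 1, the least i with 2^i >
    T, the least i with i^2 above the confidence level. *)
Definition setup_prog : cmd :=
  block [:: Do (ILit 3 1); Do (ILit 5 64); Do (ILit 9 0); Do (IAdd 8 1 3);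
    Do (IAdd 4 8 3); Do (RLit 1 1);
    Do (RLit 2 0); For 50 0 (Do (ROp RAdd 2 2 1));
    Do (RLit 5 0); For 50 1 (Do (ROp RAdd 5 5 1));
    Do (IAdd 6 5 9); For 50 2 (Do (IAdd 6 6 4));
    Do (IAdd 51 0 1); Do (ILit 7 0); For 50 1 (Do (IAdd 7 7 51));
    Do (RLit 30 0); Do (RLit 31 0);
    While (RLe 31 1) (block [:: Do (ROp RAdd 30 30 1); Do (ROp RMul 31 30 0)]);
    Do (RLit 32 0); Do (ILit 50 1);
    While (ILe 50 0) (block [:: Do (IAdd 50 50 50); Do (ROp RAdd 32 32 1)]);
    Do (ROp RAdd 33 32 5); Do (ROp RAdd 33 33 30); Do (RLit 34 8);
    Do (ROp RMul 33 34 33);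
    Do (RLit 11 0); Do (RLit 35 0);
    While (RLe 35 33) (block [:: Do (ROp RAdd 11 11 1); Do (ROp RMul 35 11 11)]);
    Do (ROp RMul 4 34 5); Do (ROp RMul 4 4 32); Do (ROp RMul 4 4 30);
    Do (ILit 10 1); Do (ILit 60 1); Do (ILit 18 0); Do (IAdd 19 5 9);
    Do (RLit 10 1);
    rows_loop (Do (RStore 31 1))].

Definition bandit_prog : cmd :=
  block [:: setup_prog; While (ILe 60 0) phase_prog].

Ltac step := apply: ok_instr; [reflexivity|rewrite /=].

(** * Memory layout and frame conditions *)

Section Machine.
Variables (R : realType) (d T : nat) (N : seq 'rV[R]_d) (K : nat) (rho : R).
Variables (xi r : nat -> R).
Implicit Types (s : state R d) (tb : nat -> nat -> R) (e : nat -> R)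
  (act : nat -> bool) (b : nat -> nat).

Local Notation nN := (size N).
Local Notation w := d.+2.

Record stat s : Prop := Stat {
  st0 : imem s 0 = T; st1 : imem s 1 = d; st2 : imem s 2 = nN;
  st3 : imem s 3 = 1%N; st4 : imem s 4 = w; st5 : imem s 5 = 64%N;
  st6 : imem s 6 = (64 + nN * w)%N; st7 : imem s 7 = (d * (d + T))%N;
  st8 : imem s 8 = d.+1; st9 : imem s 9 = 0%N;
  sr1 : rmem s 1 = 1; sr2 : rmem s 2 = T%:R; sr4 : rmem s 4 = K%:R;
  sr5 : rmem s 5 = d%:R }.

(* Cell 60 holds the number of the next round, counted from 1. *)
Record keep0 (m : nat) s s' : Prop := Keep0 {
  keep0I : forall a, (a < m)%N -> imem s' a = imem s a;
  keep0R : forall a, (a < m)%N -> rmem s' a = rmem s a;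
  keep0D : drawn s' = drawn s }.

(** The frame condition of parts that play no arm; [keep0] serves those that do. *)
Definition keep (m : nat) s s' : Prop :=
  [/\ keep0 m s s', imem s' 60 = imem s 60 & plays s' = plays s].

Lemma keepI m s s' : keep m s s' -> forall a, (a < m)%N -> imem s' a = imem s a.
Proof. by case=> -[]. Qed.

Lemma keepR m s s' : keep m s s' -> forall a, (a < m)%N -> rmem s' a = rmem s a.
Proof. by case=> -[]. Qed.

Lemma keep0_le m m' s s' : (m' <= m)%N -> keep0 m s s' -> keep0 m' s s'.
Proof. by move=> h [h1 h2 h3]; split=> // a am; [apply: h1|apply: h2]; apply: leq_trans h. Qed.

Lemma keep_le m m' s s' : (m' <= m)%N -> keep m s s' -> keep m' s s'.
Proof. by move=> h [h1 h2 h3]; split=> //; exact: keep0_le h1. Qed.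

Lemma keep0_trans m s1 s2 s3 : keep0 m s1 s2 -> keep0 m s2 s3 -> keep0 m s1 s3.
Proof.
by move=> [h1 h2 h3] [g1 g2 g3]; split=> [a am|a am|]; rewrite ?g1 ?g2 ?g3 ?h1 ?h2.
Qed.

Lemma keep_trans m s1 s2 s3 : keep m s1 s2 -> keep m s2 s3 -> keep m s1 s3.
Proof.
move=> [h1 h2 h3] [g1 g2 g3].
by split; [exact: keep0_trans h1 g1 | rewrite g2 | rewrite g3].
Qed.

Lemma keep0_idx m s s' a v : (m <= a)%N -> keep0 m s s' -> keep0 m s (set_idx s' a v).
Proof. by move=> ma [h1 h2 h3]; split=> //= c cm; rewrite ifN ?h1 //; lia. Qed.

Lemma keep0_real m s s' a v : (m <= a)%N -> keep0 m s s' -> keep0 m s (set_real s' a v).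
Proof. by move=> ma [h1 h2 h3]; split=> //= c cm; rewrite ifN ?h2 //; lia. Qed.

Lemma keep_idx m s s' a v : (m <= a)%N -> a != 60%N -> keep m s s' ->
  keep m s (set_idx s' a v).
Proof.
move=> ma /negbTE a60 [h1 h2 h3]; split=> //=; first exact: keep0_idx.
by rewrite eq_sym a60.
Qed.

Lemma keep_real m s s' a v : (m <= a)%N -> keep m s s' -> keep m s (set_real s' a v).
Proof. by move=> ma [h1 h2 h3]; split=> //; exact: keep0_real. Qed.

Lemma keep0_stat m s s' : (10 <= m)%N -> keep0 m s s' -> stat s -> stat s'.
Proof.
by move=> m10 [h1 h2 _] []; split; rewrite ?h1 ?h2 //; lia.
Qed.

Lemma keep_stat m s s' : (10 <= m)%N -> keep m s s' -> stat s -> stat s'.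
Proof. by move=> m10 [h _ _]; exact: keep0_stat h. Qed.

Lemma stat_idx s a v : (10 <= a)%N -> stat s -> stat (set_idx s a v).
Proof. by move=> h; apply: (@keep0_stat a) => //; exact: keep0_idx. Qed.

Lemma stat_real s a v : (10 <= a)%N -> stat s -> stat (set_real s a v).
Proof. by move=> h; apply: (@keep0_stat a) => //; exact: keep0_real. Qed.

Definition tabR s act tb e : Prop := forall k, (k < nN)%N ->
  [/\ rmem s (64 + k * w)%N = (act k)%:R,
      forall j, (j < d)%N -> rmem s (64 + k * w + j.+1)%N = tb k j &
      rmem s (64 + k * w + d.+1)%N = e k].

Definition basR s b : Prop := forall j, (j < d)%N -> imem s (64 + j.+1)%N = b j.

Definition rowR s (v : nat -> R) : Prop :=
  forall j, (j < d)%N -> rmem s (64 + nN * w + j.+1)%N = v j.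

Lemma rowR_ext s v v' : rowR s v -> (forall j, (j < d)%N -> v j = v' j) -> rowR s v'.
Proof. by move=> h e j jd; rewrite h ?e. Qed.

Lemma addr_inj k c k' c' : (c < w)%N -> (c' < w)%N ->
  ((64 + k * w + c)%N == (64 + k' * w + c')%N) = (k == k') && (c == c').
Proof.
move=> cw cw'; rewrite -!addnA eqn_add2l; apply/eqP/andP => [h|[/eqP-> /eqP->]//].
have hk : k = k'.
  by have := congr1 (divn^~ w) h; rewrite !divnMDl // !divn_small // !addn0.
by move: h; rewrite hk => /addnI ->.
Qed.

Lemma high_addr x n : (x < 64)%N -> ((64 + n)%N == x) = false.
Proof. lia. Qed.

Lemma high_addr2 x n c : (x < 64)%N -> ((64 + n + c)%N == x) = false.
Proof. by rewrite -addnA; exact: high_addr. Qed.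

Lemma tabR_real s act tb e x v : (x < 64)%N -> tabR s act tb e -> tabR (set_real s x v) act tb e.
Proof. by move=> x64 h k kN; have [h1 h2 h3] := h k kN; split=> [|j jd|] /=; rewrite ?high_addr ?high_addr2 //; exact: h2. Qed.

Lemma rowR_real s v x y : (x < 64)%N -> rowR s v -> rowR (set_real s x y) v.
Proof. by move=> x64 h j jd /=; rewrite high_addr2 ?h. Qed.

Lemma tabR_idx s act tb e a n : tabR s act tb e -> tabR (set_idx s a n) act tb e.
Proof. by []. Qed.

Lemma rowR_idx s v a n : rowR s v -> rowR (set_idx s a n) v.
Proof. by []. Qed.

Lemma basR_idx s b a v : (a <= 64)%N -> basR s b -> basR (set_idx s a v) b.
Proof. by move=> x64 h j jd /=; rewrite ifN ?h //; lia. Qed.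

Lemma basR_store s b i v : (i < d)%N -> basR s b -> basR (set_idx s (64 + i.+1) v) (upd b i v).
Proof.
move=> id h j jd /=; rewrite /upd eqn_add2l eqSS.
by case: eqP => // _; exact: h.
Qed.

Lemma tabR_ext s act tb e act' tb' e' : tabR s act tb e ->
  (forall k, (k < nN)%N -> act k = act' k) ->
  (forall k j, (k < nN)%N -> (j < d)%N -> tb k j = tb' k j) ->
  (forall k, (k < nN)%N -> e k = e' k) -> tabR s act' tb' e'.
Proof.
move=> h ha ht he k kN; have [h1 h2 h3] := h k kN.
by split=> [|j jd|]; [rewrite h1 ha|rewrite h2 ?ht|rewrite h3 he].
Qed.

Let a0 k : (64 + k * w)%N = (64 + k * w + 0)%N. Proof. by rewrite addn0. Qed.

Lemma tabR_store_tb s act tb e k i v : (k < nN)%N -> (i < d)%N ->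
  tabR s act tb e ->
  tabR (set_real s (64 + k * w + i.+1) v) act (upd tb k (upd (tb k) i v)) e.
Proof.
move=> kN id h k' k'N; have [h1 h2 h3] := h k' k'N; split=> [|j jd|] /=.
- by rewrite [X in X == _]a0 addr_inj // ?andbF //; lia.
- rewrite addr_inj ?eqSS; try lia; rewrite /upd.
  have [_ hk _] := h k kN; case: eqP => [->|_] /=; last exact: h2.
  by case: eqP => // _; exact: hk.
- by rewrite addr_inj; try lia; rewrite eqSS [d == i]gtn_eqF ?andbF.
Qed.

Lemma tabR_store_e s act tb e k v : (k < nN)%N -> tabR s act tb e ->
  tabR (set_real s (64 + k * w + d.+1) v) act tb (upd e k v).
Proof.
move=> kN h k' k'N; have [h1 h2 h3] := h k' k'N; split=> [|j jd|] /=.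
- by rewrite [X in X == _]a0 addr_inj // ?andbF //; lia.
- by rewrite addr_inj ?eqSS; try lia; rewrite [j == d]ltn_eqF ?andbF // h2.
- by rewrite addr_inj; try lia; rewrite eqxx andbT /upd; case: eqP.
Qed.

Lemma tabR_store_act s act tb e k (v : bool) : (k < nN)%N -> tabR s act tb e ->
  tabR (set_real s (64 + k * w) v%:R) (upd act k v) tb e.
Proof.
move=> kN h k' k'N; have [h1 h2 h3] := h k' k'N; split=> [|j jd|] /=.
- by rewrite [X in X == _]a0 [X in _ == X]a0 addr_inj; try lia; rewrite eqxx andbT /upd; case: eqP.
- by rewrite [X in _ == X]a0 addr_inj; try lia; rewrite andbF h2.
- by rewrite [X in _ == X]a0 addr_inj; try lia; rewrite andbF.
Qed.

Lemma tabR_store_row s act tb e i v : (i < d)%N -> tabR s act tb e ->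
  tabR (set_real s (64 + nN * w + i.+1) v) act tb e.
Proof.
move=> id h k' k'N; have [h1 h2 h3] := h k' k'N; split=> [|j jd|] /=.
- by rewrite [X in X == _]a0 addr_inj // ?andbF //; lia.
- by rewrite addr_inj; try lia; rewrite [k' == _]ltn_eqF // h2.
- by rewrite addr_inj; try lia; rewrite [k' == _]ltn_eqF.
Qed.

Lemma rowR_store s v i x : (i < d)%N -> rowR s v ->
  rowR (set_real s (64 + nN * w + i.+1) x) (upd v i x).
Proof.
move=> id h j jd /=; rewrite /upd addr_inj ?eqxx ?eqSS; try lia.
by case: eqP => // _; exact: h.
Qed.

Lemma rowR_store_tb s v k c x : (k < nN)%N -> (c < w)%N -> rowR s v ->
  rowR (set_real s (64 + k * w + c) x) v.
Proof.
move=> kN cw h j jd /=; rewrite addr_inj; try lia.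
by rewrite [nN == k]gtn_eqF //= h.
Qed.

Variable W : nat.
Hypothesis W64 : (64 <= W)%N.
Hypotheses (dW : (d <= W)%N) (nNW : (nN <= W)%N).

(** The invariant has to survive changes of cells 30 and 31, the counter and the row address, which
    the loop itself updates. *)
Lemma ok_rows (I : nat -> state R d -> Prop) (k : nat) body s Q :
  stat s ->
  (forall i s' v, I i s' -> I i (set_idx s' 30 v)) ->
  (forall i s' v, I i s' -> I i (set_idx s' 31 v)) ->
  (forall i s', I i s' -> stat s') ->
  I 0%N s ->
  (forall i s', (i < nN)%N -> I i s' -> stat s' ->
    imem s' 30 = i.+1 -> imem s' 31 = (64 + i * w)%N ->
    ok N xi r body s' (W ^ k) (fun s'' => [/\ imem s'' 30 = i.+1,
      imem s'' 31 = (64 + i * w)%N & I i.+1 s''])) ->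
  (forall s', I nN s' -> Q s') ->
  ok N xi r (rows_loop body) s (W ^ k.+4) Q.
Proof.
move=> ss I30 I31 Ik I0 hb hQ.
have h1 := pow_W W64 k; have h2 := pow_W W64 k.+1; have h3 := pow_W W64 k.+2; have h4 := pow_W W64 k.+3.
have h0 : (0 < W ^ k)%N by rewrite expn_gt0; lia.
apply: (@ok_weaken _ _ _ _ _ _ _ (W ^ k.+3 + 1).+1 _ Q) => //; last by lia.
step; rewrite (st5 ss) (st9 ss).
pose J i (s' : state R d) := I i s' /\ imem s' 31 = (64 + i * w)%N.
apply: ok_cons; apply: (@ok_for _ _ _ _ _ W W64 J nN k.+1) => //=.
- by rewrite (st2 ss).
- by rewrite (st3 ss).
- by split=> //=; [apply: I30; exact: I31].
- move=> i s' iN [Ii i31] i30 i2 i3.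
  have ss' := Ik _ _ Ii.
  apply: (@ok_weaken _ _ _ _ _ _ _ (W ^ k + 1) (W ^ k.+1) _ _ _ _ (fun s' h => h)); last first.
    by move: h0 h1; move: (W ^ k)%N (W ^ k.+1)%N; clear; lia.
  apply: ok_cons; apply: (ok_weaken (hb i s' iN Ii ss' i30 i31)) => // s1 [g1 g2 g3].
  have ss1 := Ik _ _ g3.
  step; apply: ok_skip; rewrite g2 (st4 ss1); split=> //=.
  + by rewrite (st2 ss1).
  + by rewrite (st3 ss1).
  + by split; [apply/I30/I31 | rewrite /= mulSn; lia].
- by move=> s' [Ii _]; apply: ok_skip; exact: hQ.
Qed.

Definition memR (m : nat) (s0 : state R d) act tb e b s : Prop :=
  [/\ keep m s0 s, tabR s act tb e & basR s b].

Lemma memR_idx m s0 act tb e b s a v : [&& (m <= a)%N, (a <= 64)%N & a != 60%N] ->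
  memR m s0 act tb e b s -> memR m s0 act tb e b (set_idx s a v).
Proof.
by move=> /and3P[h1 h2 h3] [i1 i2 i3]; split=> //; [exact: keep_idx | exact: basR_idx].
Qed.

Lemma memR_real m s0 act tb e b s a v : (m <= a < 64)%N ->
  memR m s0 act tb e b s -> memR m s0 act tb e b (set_real s a v).
Proof.
by move=> /andP[h1 h2] [i1 i2 i3]; split=> //; [exact: keep_real | exact: tabR_real].
Qed.

Lemma memR_refl m s act tb e b : tabR s act tb e -> basR s b ->
  memR m s act tb e b s.
Proof. by []. Qed.

Lemma memR_stat m s0 act tb e b s : memR m s0 act tb e b s -> (10 <= m)%N ->
  stat s0 -> stat s.
Proof. by move=> [h _ _] m10 ss; exact: keep_stat m10 h ss. Qed.

Lemma memR_ext m s0 act tb e b act' tb' e' s : memR m s0 act tb e b s ->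
  (forall k, (k < nN)%N -> act k = act' k) ->
  (forall k j, (k < nN)%N -> (j < d)%N -> tb k j = tb' k j) ->
  (forall k, (k < nN)%N -> e k = e' k) -> memR m s0 act' tb' e' b s.
Proof. by move=> [i1 i2 i3] h1 h2 h3; split=> //; exact: tabR_ext i2 h1 h2 h3. Qed.

Lemma memR_trans m m' s0 s1 s2 act tb e b : (m <= m')%N -> keep m s0 s1 ->
  memR m' s1 act tb e b s2 -> memR m s0 act tb e b s2.
Proof. by move=> mm k1 [i1 i2 i3]; split=> //; exact: keep_trans k1 (keep_le mm i1). Qed.

Lemma keep_store m s0 s a v : (m <= 64)%N -> keep m s0 s ->
  keep m s0 (set_real s (64 + a) v).
Proof. by move=> m64; apply: keep_real; exact: leq_trans (leq_addr _ _). Qed.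

Lemma memR_store_tb m s0 act tb e b s k i v : (m <= 64)%N -> (k < nN)%N ->
  (i < d)%N -> memR m s0 act tb e b s ->
  memR m s0 act (upd tb k (upd (tb k) i v)) e b (set_real s (64 + k * w + i.+1) v).
Proof.
move=> m64 kN id [i1 i2 i3]; split=> //; last exact: tabR_store_tb.
by rewrite -addnA; exact: keep_store.
Qed.

Lemma memR_store_e m s0 act tb e b s k v : (m <= 64)%N -> (k < nN)%N ->
  memR m s0 act tb e b s ->
  memR m s0 act tb (upd e k v) b (set_real s (64 + k * w + d.+1) v).
Proof.
move=> m64 kN [i1 i2 i3]; split=> //; last exact: tabR_store_e.
by rewrite -addnA; exact: keep_store.
Qed.

Lemma memR_store_act m s0 act tb e b s k (v : bool) : (m <= 64)%N -> (k < nN)%N ->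
  memR m s0 act tb e b s ->
  memR m s0 (upd act k v) tb e b (set_real s (64 + k * w) v%:R).
Proof.
by move=> m64 kN [i1 i2 i3]; split=> //; [exact: keep_store | exact: tabR_store_act].
Qed.

Lemma memR_store_row m s0 act tb e b s i v : (m <= 64)%N -> (i < d)%N ->
  memR m s0 act tb e b s ->
  memR m s0 act tb e b (set_real s (64 + nN * w + i.+1) v).
Proof.
move=> m64 id [i1 i2 i3]; split=> //; last exact: tabR_store_row.
by rewrite -addnA; exact: keep_store.
Qed.

Lemma memR_store_bas m s0 act tb e b s i v : (m <= 64)%N -> (i < d)%N ->
  memR m s0 act tb e b s ->
  memR m s0 act tb e (upd b i v) (set_idx s (64 + i.+1) v).
Proof.
move=> m64 id [i1 i2 i3]; split=> //; last exact: basR_store.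
by apply: keep_idx => //; exact: leq_trans (leq_addr _ _).
Qed.

Lemma memR_bas m s0 act tb e b b' s : memR m s0 act tb e b s ->
  (forall j, (j < d)%N -> b j = b' j) -> memR m s0 act tb e b' s.
Proof. by move=> [i1 i2 i3] h; split=> // j jd; rewrite i3 ?h. Qed.

Lemma ok_le p s n n' (Q : state R d -> Prop) : ok N xi r p s n Q -> (n <= n')%N ->
  ok N xi r p s n' Q.
Proof. by move=> h nn'; exact: ok_weaken h nn' _. Qed.

Lemma ok_short l s k (Q : state R d -> Prop) : ok N xi r (block l) s 32 Q ->
  ok N xi r (block l) s (W ^ k.+1) Q.
Proof.
move=> h; apply: (ok_le h); have := pow_W W64 k.
have : (0 < W ^ k)%N by rewrite expn_gt0; move: W64; clear; lia.
by move: (W ^ k)%N (W ^ k.+1)%N; clear; lia.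
Qed.

End Machine.

(* As 64 <= W, a power of W absorbs 64 copies of the previous one. *)
Ltac wl :=
  match goal with W64 : is_true (64 <= _)%N |- _ =>
    move: (pow_W W64 0) (pow_W W64 1) (pow_W W64 2) (pow_W W64 3) (pow_W W64 4)
      (pow_W W64 5) (pow_W W64 6) (pow_W W64 7) (pow_W W64 8) (pow_W W64 9)
      (pow_W W64 10) (pow_W W64 11) (pow_W W64 12) (pow_W W64 13)
      (pow_W W64 14) (pow_W W64 15) (pow_W W64 16);
    rewrite expn0;
    repeat match goal with |- context [expn ?w ?k] => move: (expn w k) end;
    clear; lia
  end.

Ltac row H := repeat first [exact: H | apply: rowR_idx | apply: rowR_real; first by []].

Ltac mem H := repeat first [exact: H | apply: memR_idx; first by [] | apply: memR_real; first by []].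

(** * Correctness of the pieces of a phase *)

Section TableInit.
Variables (R : realType) (d T : nat) (N : seq 'rV[R]_d) (K : nat).
Variables (xi r : nat -> R) (W : nat).
Hypothesis W64 : (64 <= W)%N.
Hypotheses (dW : (d <= W)%N) (nNW : (size N <= W)%N).
Implicit Types (s : state R d) (tb : nat -> nat -> R) (e : nat -> R)
  (act : nat -> bool) (b : nat -> nat).

Local Notation nN := (size N).
Local Notation w := d.+2.
Local Notation stat := (stat T N K).
Local Notation memR := (memR N).
Local Notation ok := (ok N xi r).

Definition tb_init (k j : nat) : R := rv_coord (arm N k) j * T%:R.

Lemma init_table_ok s act tb e b : stat s -> memR 30 s act tb e b s ->
  ok init_table s (W ^ 10) (memR 30 s act tb_init (fun=> 0) (fun=> 0%N)).
Proof.
move=> ss Is; apply: (@ok_le _ _ _ _ _ _ _ (W ^ 8 + (W ^ 3 + 1))); last by wl.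
apply: ok_cons; apply: (@ok_rows _ _ T _ K _ _ W W64 dW nNW
  (fun i => memR 30 s act (fun k j => if (k < i)%N then tb_init k j else tb k j)
    (fun k => if (k < i)%N then 0 else e k) b) 4) => //.
- by move=> i s' v; exact: memR_idx.
- by move=> i s' v; exact: memR_idx.
- by move=> i s' h; exact: memR_stat h isT ss.
- move=> i s1 iN I1 ss1 s30 s31.
  apply: (@ok_le _ _ _ _ _ _ _ (W ^ 3 + 10).+1); last by wl.
  step; rewrite s30 (st3 ss1) subSS subn0.
  pose J j s' := [/\ imem s' 30 = i.+1, imem s' 31 = (64 + i * w)%N, imem s' 32 = i &
    memR 30 s act (fun k c => if (k < i)%N || ((k == i) && (c < j)%N) then tb_init k c else tb k c)
      (fun k => if (k < i)%N then 0 else e k) b s'].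
  apply: ok_cons; apply: (@ok_for _ _ _ _ _ W W64 J d 1) => //=.
  + by rewrite (st1 ss1).
  + by rewrite (st3 ss1).
  + split=> //=; do 2 apply: memR_idx => //.
    apply: memR_ext I1 _ _ _ => // k j kN jd; rewrite ltn0 andbF orbF //.
  + move=> j s2 jd [t30 t31 t32 I2] t40 t1 t3.
    have ss1' := memR_stat I2 isT ss.
    apply: (ok_short W64); step; rewrite t40 t3 subSS subn0.
    apply: ok_instr.
      by rewrite /= t32 iN insubT /=; reflexivity.
    rewrite /=; step; step; rewrite t31 t40; step.
    apply: ok_skip; split=> //=.
    split=> //; apply: memR_idx => //.
    apply: memR_ext; [apply: memR_store_tb => //; mem I2| by []| |by []].
    move=> k c kN cd; rewrite /upd ltnS [(c <= j)%N]leq_eqVlt.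
    case: (eqVneq k i) => [->|ki] /=; last by rewrite orbF.
    rewrite ltnn eqxx /=; case: (eqVneq c j) => [->|cj] //=.
    by rewrite /tb_init /rv_coord insubT (sr2 ss1').
  + move=> s2 [t30 t31 t32 I2].
    have ss2 := memR_stat I2 isT ss.
    step; rewrite t31 (st8 ss2); step; step; apply: ok_skip; split=> //.
    apply: memR_ext; [apply: memR_store_e => //; mem I2| by []| |].
      by move=> k c kN cd /=; rewrite cd andbT orbC -leq_eqVlt.
    by move=> k kN /=; rewrite /upd ltnS [(k <= i)%N]leq_eqVlt; case: (eqVneq k i).
- move=> s1 I1.
  have {}I1 : memR 30 s act tb_init (fun=> 0) b s1.
    by apply: memR_ext I1 _ _ _ => // k; [move=> j kN _|move=> kN]; rewrite kN.
  have ss1 := memR_stat I1 isT ss.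
  pose J j s' := memR 30 s act tb_init (fun=> 0) (fun i => if (i < j)%N then 0%N else b i) s'.
  apply: ok_cons; apply: (@ok_for _ _ _ _ _ W W64 J d 1) => //=.
  + by rewrite (st1 ss1).
  + by rewrite (st3 ss1).
  + by apply: memR_idx.
  + move=> j s2 jd I2 t40 t1 t3; have ss2 := memR_stat I2 isT ss.
    apply: (ok_short W64); step; rewrite (st5 ss2) t40; step; step.
    apply: ok_skip; split=> //.
    apply: memR_idx => //; apply: memR_bas.
      by apply: memR_store_bas => //; mem I2.
    by move=> i id /=; rewrite /upd ltnS [(i <= j)%N]leq_eqVlt; case: (eqVneq i j).
  + move=> s2 I2; apply: ok_skip; apply: memR_bas I2 _ => j jd.
    by rewrite jd.
Qed.

End TableInit.

Section Spanning.
Variables (R : realType) (d T : nat) (N : seq 'rV[R]_d) (K : nat).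
Variables (xi r : nat -> R) (W : nat).
Hypothesis W64 : (64 <= W)%N.
Hypotheses (dW : (d <= W)%N) (nNW : (size N <= W)%N).
Implicit Types (s : state R d) (tb : nat -> nat -> R) (e : nat -> R)
  (act : nat -> bool) (b : nat -> nat).

Local Notation nN := (size N).
Local Notation w := d.+2.
Local Notation stat := (stat T N K).
Local Notation memR := (memR N).
Local Notation ok := (ok N xi r).

Definition accR s (acc : option (nat * nat)) : Prop :=
  if acc is Some (k, j) then
    [/\ imem s 21 = j.+1, imem s 22 = k.+1 & imem s 23 = (64 + k * w)%N]
  else imem s 21 = 0%N.

Lemma accR_idx s acc a v : (23 < a)%N -> accR s acc -> accR (set_idx s a v) acc.
Proof.
by move=> h; case: acc => [[k j]|] /=; rewrite ?[_ == a]ltn_eqF //; lia.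
Qed.

Lemma search_ok s act tb e b : stat s -> memR 21 s act tb e b s ->
  ok search_prog s (W ^ 9) (fun s' => memR 21 s act tb e b s' /\
    accR s' (search N act tb)).
Proof.
move=> ss Is; apply: (@ok_le _ _ _ _ _ _ _ (W ^ 8 + 1).+1); last by wl.
step; apply: ok_cons.
pose acc i := iteri i (fun k acc => if act k then search_row d tb k acc else acc) None.
apply: (@ok_rows _ _ T _ K _ _ W W64 dW nNW
  (fun i s' => memR 21 s act tb e b s' /\ accR s' (acc i)) 4) => //.
- exact: stat_idx.
- by move=> i s' v [h1 h2]; split; [exact: memR_idx|exact: accR_idx].
- by move=> i s' v [h1 h2]; split; [exact: memR_idx|exact: accR_idx].
- by move=> i s' [h _]; exact: memR_stat h isT ss.
- by split=> //; apply: memR_idx.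
- move=> i s1 iN [I1 a1] ss1 s30 s31.
  apply: (@ok_le _ _ _ _ _ _ _ (((W ^ 3).+1 + 0).+1)); last by wl.
  have [_ tR _] := I1; have [f1 f2 f3] := tR i iN.
  step; rewrite s31 f1; apply: ok_cons; apply: ok_if; rewrite /= (sr1 ss1).
  case: ifP => [a|na]; last first.
    have nai : act i = false by move: na; case: (act i); rewrite ?lexx.
    apply: ok_skip; apply: ok_skip; rewrite /= s30 s31; split=> //; split; first exact: memR_real.
    by rewrite /acc /= nai.
  have ai : act i by move: a; case: (act i); rewrite ?ler10.
  pose J j s' := [/\ imem s' 30 = i.+1, imem s' 31 = (64 + i * w)%N,
    memR 21 s act tb e b s' & accR s' (iteri j
      (fun j acc => if tb i j * tb i j <= 4 then acc else Some (i, j)) (acc i))].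
  apply: (@ok_for _ _ _ _ _ W W64 J d 1) => //=.
  + by rewrite (st1 ss1).
  + by rewrite (st3 ss1).
  + by split=> //; mem I1.
  + move=> j s2 jd [t30 t31 I2 a2] t40 t1 t3; have ss2 := memR_stat I2 isT ss.
    have [_ tR2 _] := I2; have [g1 g2 g3] := tR2 i iN.
    apply: (ok_short W64); step; rewrite t31 t40; step; rewrite g2 //; step; step.
    apply: ok_last; apply: ok_if; rewrite /=.
    case: ifP => h.
      apply: ok_skip; split=> //; split=> //; first by mem I2.
      by rewrite /= h; apply: accR_idx.
    step; rewrite t40 (st9 ss2) addn0; step; rewrite t30 (st9 ss2) addn0; step; rewrite t31 (st9 ss2) addn0.
    apply: ok_skip; split=> //=.
    by split=> //=; [mem I2 | rewrite h].
  + move=> s2 [t30 t31 I2 a2]; apply: ok_skip; split=> //; split=> //.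
    by rewrite /acc /= ai.
- by move=> s1 h; apply: ok_skip.
Qed.

Lemma pivot_ok s act tb e b p i : stat s -> memR 21 s act tb e b s ->
  (p < nN)%N -> (i < d)%N -> accR s (Some (p, i)) ->
  ok pivot_prog s (W ^ 9)
    (memR 21 s act (pivot (tb, b) p i).1 e (pivot (tb, b) p i).2).
Proof.
move=> ss Is pN id [c21 c22 c23].
apply: (@ok_le _ _ _ _ _ _ _ (W ^ 3 + (W ^ 8 + 10).+2)); last by wl.
pose J0 j s' := memR 40 s act tb e b s' /\
  rowR N s' (fun c => if (c < j)%N then tb p c else rmem s (64 + nN * w + c.+1)%N).
have k40 : memR 40 s act tb e b s by case: Is => [_ ? ?]; split.
apply: ok_cons; apply: (@ok_for _ _ _ _ _ W W64 J0 d 1) => //=.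
- by rewrite (st1 ss).
- by rewrite (st3 ss).
- by split=> //; exact: memR_idx.
- move=> j s2 jd [I2 r2] t40 t1 t3; have ss2 := memR_stat I2 isT ss.
  have [k2 tR2 _] := I2; have kI := keepI k2; have [g1 g2 g3] := tR2 p pN.
  apply: (ok_short W64); step; rewrite kI // c23 t40; step; rewrite g2 //; step; rewrite (st6 ss2) t40; step.
  apply: ok_skip; split=> //=; split.
    by apply: memR_idx => //; apply: memR_store_row => //; mem I2.
  apply: (@rowR_ext _ _ _ _ (upd (fun c => if (c < j)%N then tb p c else rmem s (64 + nN * w + c.+1)%N) j (tb p j))).
    by apply: rowR_idx; apply: rowR_store => //; row r2.
  by move=> c cd; rewrite /upd ltnS [(c <= j)%N]leq_eqVlt; case: (eqVneq c j) => [->|].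
move=> s2 [I2 r2]; have ss2 := memR_stat I2 isT ss.
have {}r2 : rowR N s2 (tb p) by apply: rowR_ext r2 _ => c cd; rewrite cd.
have [kp tR2 _] := I2; have [g1 g2 g3] := tR2 p pN.
step; rewrite !(keepI kp) // c23 c21; step; rewrite g2 //.
set s3 := set_real _ 24 _.
have ss3 : stat s3 by apply: stat_real => //; exact: stat_idx.
have I3 : memR 25 s3 act tb e b s3.
  by case: I2 => [_ h1 h2]; split=> //; exact: tabR_real.
have r3 : rowR N s3 (tb p) by apply: rowR_real.
pose pv := pivot (tb, b) p i.
apply: ok_cons; apply: (@ok_rows _ _ T _ K _ _ W W64 dW nNW
  (fun k s' => memR 25 s3 act (fun k' c => if (k' < k)%N then pv.1 k' c else tb k' c) e b s' /\
     rowR N s' (tb p)) 4) => //.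
- by move=> k s' v [h1 h2]; split=> //; exact: memR_idx.
- by move=> k s' v [h1 h2]; split=> //; exact: memR_idx.
- by move=> k s' [h _]; exact: memR_stat h isT ss3.
- move=> k s4 kN [I4 r4] ss4 s30 s31.
  apply: (@ok_le _ _ _ _ _ _ _ ((W ^ 3 + 10).+3)); last by wl.
  have [k4 tR4 _] := I4; have kI4 := keepI k4; have kR4 := keepR k4; have [h1 h2 h3] := tR4 k kN.
  have e21 : imem s4 21 = i.+1 by rewrite kI4 //= !(keepI kp) // c21.
  step; rewrite s31 e21; step; rewrite h2 // ltnn; step; rewrite kR4 //=.
  set f := tb k i / tb p i.
  (* Rows before [k] are new and row [k] is new before column [j]. Column [i] of row [k] is
     provisional; the quotient [f] is stored there after this loop. *)
  pose J j s' := [/\ [/\ imem s' 30 = k.+1, imem s' 31 = (64 + k * w)%N, imem s' 32 = (64 + k * w + i.+1)%N &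
      rmem s' 30 = f],
    memR 25 s3 act (fun k' c => if (k' < k)%N then pv.1 k' c else
       if (k' == k) && (c < j)%N then tb k c - tb p c * f else tb k' c) e b s' &
    rowR N s' (tb p)].
  apply: ok_cons; apply: (@ok_for _ _ _ _ _ W W64 J d 1) => //=.
  + by rewrite (st1 ss4).
  + by rewrite (st3 ss4).
  + split=> //.
    apply: memR_ext; [mem I4|by []| |by []].
    by move=> k' c _ _; rewrite ltn0 andbF.
  + move=> j s5 jd [[t30 t31 t32 t30r] I5 r5] t40 t1 t3; have ss5 := memR_stat I5 isT ss3.
    have [_ tR5 _] := I5; have [q1 q2 q3] := tR5 k kN.
    apply: (ok_short W64); step; rewrite t31 t40; step; rewrite q2 // ltnn eqxx ltnn /=.
    step; rewrite (st6 ss5) t40; step; rewrite r5 //; step; rewrite t30r; step; step.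
    apply: ok_skip; split=> //=; split=> //=; last by apply: rowR_idx; apply: rowR_store_tb => //; exact: leqW.
    apply: memR_idx => //; apply: memR_ext; [apply: memR_store_tb => //; mem I5|by []| |by []].
    move=> k' c k'N cd /=; rewrite /upd ltnS [(c <= j)%N]leq_eqVlt.
    case: (eqVneq k' k) => [->|nk] //=; rewrite ltnn eqxx /=.
    by case: (eqVneq c j) => [->|].
  + move=> s5 [[t30 t31 t32 t30r] I5 r5].
    step; rewrite t32 t30r; apply: ok_skip; split=> //; split; last by apply: rowR_store_tb => //; exact: leqW.
    apply: memR_ext; [apply: memR_store_tb => //; mem I5|by []| |by []].
    move=> k' c k'N cd /=; rewrite /upd ltnS [(k' <= k)%N]leq_eqVlt.
    case: (eqVneq k' k) => [->|nk] //=; rewrite ltnn eqxx cd /=.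
    by rewrite -/f; case: (eqVneq c i).
- move=> s4 [I4 r4]; have ss4 := memR_stat I4 isT ss3.
  have {}I4 : memR 25 s3 act pv.1 e b s4.
    by apply: memR_ext I4 _ _ _ => // k c kN cd; rewrite kN.
  have [kp4 _ _] := I4.
  have e21 : imem s4 21 = i.+1 by rewrite (keepI kp4) //= !(keepI kp) // c21.
  have e22 : imem s4 22 = p.+1 by rewrite (keepI kp4) //= !(keepI kp) // c22.
  step; rewrite (st5 ss4) e21; step; rewrite e22; apply: ok_skip.
  apply: memR_store_bas => //; apply: memR_idx => //.
  apply: memR_trans I4 => //; apply: keep_real => //; apply: keep_idx => //.
  exact: keep_le kp.
Qed.

Hypothesis fW : (d * (d + T) <= W)%N.

Lemma span_ok s act tb e b : stat s -> memR 20 s act tb e b s ->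
  let x := iter (d * (d + T)) (span_step N act) (tb, b) in
  ok span_prog s (W ^ 12) (memR 20 s act x.1 e x.2).
Proof.
move=> ss Is x.
pose xs n := iter n (span_step N act) (tb, b).
apply: (@ok_for _ _ _ _ _ W W64 (fun n => memR 20 s act (xs n).1 e (xs n).2) (d * (d + T)) 10) => //=.
- by rewrite (st7 ss).
- by rewrite (st3 ss).
- exact: memR_idx.
- move=> n s1 nF I1 t20 t7 t3; have ss1 := memR_stat I1 isT ss.
  apply: (@ok_le _ _ _ _ _ _ _ (W ^ 9 + ((W ^ 9).+1 + 0))); last by wl.
  have I1' : memR 21 s1 act (xs n).1 e (xs n).2 s1 by case: I1 => [_ ? ?].
  apply: ok_cons; apply: (ok_weaken (search_ok ss1 I1')) => // s2 [I2 a2].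
  have ss2 := memR_stat I2 isT ss1.
  have I2' : memR 21 s2 act (xs n).1 e (xs n).2 s2 by case: I2 => [_ ? ?].
  have [k2 _ _] := I2; have [k1 _ _] := I1.
  have := searchP N act (xs n).1; rewrite /span_step.
  case: (search N act (xs n).1) a2 => [[p i]|] a2 hs.
    have [pN ap id _] := hs; have [c21 c22 c23] := a2.
    apply: ok_cons; apply: ok_if; rewrite /= (st3 ss2) c21 /=.
    apply: (ok_weaken (pivot_ok ss2 I2' pN id a2)) => //; rewrite -surjective_pairing => s3 I3; apply: ok_skip.
    have [k3 _ _] := I3; rewrite !(keepI k3) // !(keepI k2) //; split=> //.
    apply: memR_idx => //; apply: memR_trans I3 => //.
    exact: keep_trans k1 (keep_le _ k2).
  apply: ok_cons; apply: ok_if; rewrite /= (st3 ss2) a2 /=.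
  apply: ok_skip; apply: ok_skip; rewrite !(keepI k2) //; split=> //.
  by apply: memR_idx => //; apply: memR_trans I2.
Qed.

End Spanning.

Ltac tab H := repeat first [exact: H | apply: tabR_idx | apply: tabR_real; first by []].

Ltac k0 := repeat first [apply: keep0_idx; first by [] | apply: keep0_real; first by []].

Lemma big_ord_recr_cond (V : nmodType) n (P : pred nat) (F : nat -> V) :
  \sum_(i < n.+1 | P i) F i = \sum_(i < n | P i) F i + (if P n then F n else 0).
Proof. by rewrite big_mkcond big_ord_recr -big_mkcond. Qed.

Lemma iota_rcons n : iota 0 n.+1 = rcons (iota 0 n) n.
Proof. by rewrite -addn1 iotaD cats1. Qed.

Section Estimation.
Variables (R : realType) (d T : nat) (N : seq 'rV[R]_d) (K : nat).
Variables (xi r : nat -> R) (W : nat).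
Hypothesis W64 : (64 <= W)%N.
Hypotheses (dW : (d <= W)%N) (nNW : (size N <= W)%N).
Implicit Types (s : state R d) (tb : nat -> nat -> R) (e : nat -> R)
  (act : nat -> bool) (b : nat -> nat).

Local Notation nN := (size N).
Local Notation w := d.+2.
Local Notation stat := (stat T N K).
Local Notation memR := (memR N).
Local Notation ok := (ok N xi r).

Lemma est_ok s act tb e b j v : stat s -> tabR N s act tb e -> basR s b ->
  (j < d)%N -> imem s 20 = j.+1 -> rmem s 26 = v ->
  ok est_prog s (W ^ 5) (memR 28 s act tb (fun k => e k + tb k j * v) b).
Proof.
move=> ss ts bs jd s20 s26.
apply: (@ok_rows _ _ T _ K _ _ W W64 dW nNW
  (fun i => memR 28 s act tb (fun k => if (k < i)%N then e k + tb k j * v else e k) b) 1) => //.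
- by move=> i s' x; exact: memR_idx.
- by move=> i s' x; exact: memR_idx.
- by move=> i s' h; exact: memR_stat h isT ss.
- move=> i s1 iN I1 ss1 s30 s31; have [k1 t1 _] := I1; have [h1 h2 h3] := t1 i iN.
  apply: (ok_short W64); step; rewrite s31 (keepI k1) // s20; step; rewrite h2 //.
  step; rewrite (keepR k1) // s26; step; rewrite s31 (st8 ss1); step; rewrite h3 ltnn; step; step.
  apply: ok_skip; split=> //.
  apply: memR_ext; [apply: memR_store_e => //; mem I1|by []|by []|].
  move=> k kN /=; rewrite /upd ltnS [(k <= i)%N]leq_eqVlt.
  by case: (eqVneq k i) => [->|].
- move=> s' h; apply: memR_ext h _ _ _ => // k kN; by rewrite kN.
Qed.

Definition played (pk : nat -> nat) (t : nat) s : Prop :=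
  imem s 60 = t.+1 /\ plays s = [seq (arm N (pk i), r i) | i <- iota 0 t].

(** [minn T base] counts the rounds played before the slot. Once the horizon is reached the
    remaining plays are skipped, matching the truncated sum in [block_sum]. *)
Lemma play_ok s act tb e b pk n base j p :
  stat s -> tabR N s act tb e -> basR s b -> (j < d)%N -> (n <= W)%N ->
  imem s 20 = j.+1 -> imem s 10 = n ->
  p = (if b j is k.+1 then k else imem s 18) -> (p < nN)%N ->
  (forall i, (i < n)%N -> pk (base + i)%N = p) ->
  played pk (minn T base) s ->
  ok play_prog s (W ^ 4) (fun s' =>
    [/\ keep0 21 s s', tabR N s' act tb e & basR s' b] /\
    [/\ imem s' 21 = b j,
      rmem s' 25 = \sum_(i < n | (base + i < T)%N) r (base + i)%N &
      played pk (minn T (base + n)) s']).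
Proof.
move=> ss ts bs jd nW s20 s10 hp pN hpk [hT hpl].
apply: (@ok_le _ _ _ _ _ _ _ ((1.+1 + (W ^ 3).+1).+2)); last by wl.
step; rewrite (st5 ss) s20; step; rewrite bs //.
set s1 := set_idx _ 21 _.
have C : ok (If (ILe 3 21) (Do (ISub 22 21 3)) (Do (IAdd 22 18 9))) s1 2
    (fun s' => s' = set_idx s1 22 p).
  apply: ok_if; rewrite /= (st3 ss) hp; case E : (b j) => [|k] /=.
    by apply: ok_do; [reflexivity|rewrite /= (st9 ss) addn0].
  by apply: ok_do; [reflexivity|rewrite /= E (st3 ss) subn1].
apply: ok_cons; apply: (ok_weaken C) => // _ ->.
step; set s2 := set_real _ 25 _.
have ss2 : stat s2 by apply: stat_real => //; do 3 apply: stat_idx => //.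
pose I i s' := [/\ keep0 21 s s', tabR N s' act tb e & basR s' b] /\
    [/\ imem s' 21 = b j, imem s' 22 = p,
      rmem s' 25 = \sum_(i' < i | (base + i' < T)%N) r (base + i')%N &
      played pk (minn T (base + i)) s'].
apply: ok_last; apply: (@ok_for _ _ _ _ _ W W64 I n 1) => //=.
- by rewrite (st3 ss).
- split; first split.
  + by rewrite /s2 /s1; k0.
  + by rewrite /s2 /s1; tab ts.
  + by do ! apply: basR_idx => //.
  + by rewrite big_ord0 addn0; split.
- move=> i s3 iN [[k3 t3 b3] [c21 c22 c25 [c60 cpl]]] t30 t10 t1.
  have ss3 : stat s3 by apply: keep0_stat k3 ss.
  apply: (@ok_le _ _ _ _ _ _ _ 10); last by wl.
  apply: ok_if; rewrite /= c60 (st0 ss3) gtn_min ltnn orFb.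
  have [lt|ge] := ltnP (base + i) T.
    have em : minn T (base + i) = (base + i)%N by apply/minn_idPr; exact: ltnW.
    have em' : minn T (base + i).+1 = (base + i).+1 by apply/minn_idPr.
    have sz : size (plays s3) = (base + i)%N by rewrite cpl size_map size_iota em.
    apply: ok_instr; first by rewrite /= c22 pN; reflexivity.
    rewrite /=; step; step; apply: ok_skip; rewrite /= t30 t10 t1; split=> //.
    split.
      split; last exact: b3.
        case: k3 => [a1 a2 a3]; split=> //= a am; rewrite !ifN; try lia; [exact: a1|exact: a2].
      move=> k kN; have [q1 q2 q3] := t3 k kN.
      by split=> [|c cd|] /=; rewrite ?high_addr ?high_addr2 //; exact: q2.
    split=> //.
    + by rewrite /= (big_ord_recr_cond _ (fun i => (base + i < T)%N) (fun i => r (base + i)%N)) lt c25 sz.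
    + rewrite addnS em'; split; first by rewrite /= c60 em addn1.
      by rewrite iota_rcons map_rcons hpk //= cpl em size_map size_iota.
  have em : minn T (base + i) = T by apply/minn_idPl.
  have em' : minn T (base + i).+1 = T by apply/minn_idPl; exact: leqW.
  apply: ok_skip; split=> //; split; first by split=> //; apply: keep0_idx.
  split=> //=; first by rewrite (big_ord_recr_cond _ (fun i => (base + i < T)%N) (fun i => r (base + i)%N)) ltnNge ge addr0.
  by rewrite addnS em'; rewrite em in c60 cpl.
- by move=> s3 [h1 [h2 _ h3 h4]].
Qed.

End Estimation.

Section Rounding.
Variables (R : realType) (d T : nat) (N : seq 'rV[R]_d) (K : nat).
Variables (xi r : nat -> R) (W : nat).
Hypothesis W64 : (64 <= W)%N.
Hypotheses (dW : (d <= W)%N) (nNW : (size N <= W)%N).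
Implicit Types (s : state R d) (tb : nat -> nat -> R) (e : nat -> R)
  (act : nat -> bool) (b : nat -> nat).

Local Notation nN := (size N).
Local Notation w := d.+2.
Local Notation stat := (stat T N K).
Local Notation memR := (memR N).
Local Notation ok := (ok N xi r).

Variable b0 : nat.
Hypotheses (K0 : (0 < K)%N) (b00 : (0 < b0)%N).

Lemma round_ok s act tb e b l kk q S bj : stat s -> tabR N s act tb e -> basR s b ->
  rmem s 10 = q -> rmem s 13 = alpha R K b0 l -> rmem s 14 = start R K b0 l kk ->
  rmem s 25 = S -> imem s 21 = bj -> (cell K b0 l kk (S / q) <= W)%N ->
  ok round_prog s (W ^ 4) (fun s' => memR 21 s act tb e b s' /\
    rmem s' 26 = if bj is _.+1 then grid R K b0 l kk (cell K b0 l kk (S / q)) else 0).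
Proof.
move=> ss ts bs s10 s13 s14 s25 s21 cW.
apply: (@ok_le _ _ _ _ _ _ _ ((2 + (W ^ 3 + 2).+3).+1)); last by wl.
step; rewrite s25 s10; set x := S / q in cW *.
have I0 : memR 22 s act tb e b s by exact: memR_refl.
have C : ok (If (RLe 1 25) (Do (RLit 25 1)) (block [::])) (set_real s 25 x) 2
    (fun s' => memR 22 s act tb e b s' /\ rmem s' 25 = Num.min x 1).
  apply: ok_if; rewrite /= (sr1 ss) minElt; case: leP => h.
    by apply: ok_do; [reflexivity | split=> //; mem I0].
  by apply: ok_skip; split=> //; mem I0.
apply: ok_cons; apply: (ok_weaken C) => // s1 [I1 c25]; have [k1 _ _] := I1.
step; step; step; rewrite addr0 (keepR k1) // (keepR k1) // s13 s14.
pose I z s' := [/\ memR 22 s act tb e b s', rmem s' 25 = Num.min x 1,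
  rmem s' 26 = grid R K b0 l kk z, rmem s' 27 = grid R K b0 l kk z.+1 &
  (z <= cell K b0 l kk x)%N].
have gS z : grid R K b0 l kk z + alpha R K b0 l = grid R K b0 l kk z.+1.
  by rewrite /grid -natr1; ring.
apply: ok_cons; apply: (@ok_while_W _ _ _ _ _ W W64 I (cell K b0 l kk x) 1) => //.
- split=> //=; first by mem I1.
    by rewrite /grid mulr0 addr0.
  by rewrite /grid mulr1.
- move=> z s2 [I2 d25 d26 d27 zle] /=; rewrite d25 d27 -cell_gt // => zlt; split=> //.
  have [k2 _ _] := I2.
  apply: (ok_short W64); step; step; rewrite d26 (keepR k2) // s13; apply: ok_skip.
  by split=> //=; rewrite ?gS //; mem I2.
- move=> z s2 [I2 d25 d26 d27 zle] /=; rewrite d25 d27 -cell_gt // -leqNgt => zge.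
  have zE : z = cell K b0 l kk x by apply/eqP; rewrite eqn_leq zle.
  have ss2 := memR_stat I2 isT ss; have [k2 t2 b2] := I2.
  apply: ok_last; apply: ok_if; rewrite /= (st3 ss2) (keepI k2) // s21.
  have k2' := keep_le (isT : (21 <= 22)%N) k2.
  case: bj s21 => [|p] s21 /=.
    apply: ok_do; first by reflexivity.
    by split=> //; apply: memR_real.
  by apply: ok_skip; split=> //; rewrite d26 zE.
Qed.

Lemma draw_ok s act tb e b l : stat s -> tabR N s act tb e -> basR s b ->
  rmem s 11 = beta R b0 l -> drawn s = l -> 0 <= xi l <= 1 -> (K <= W)%N ->
  ok draw_prog s (W ^ 4) (fun s' =>
    [/\ stat s', tabR N s' act tb e & basR s' b] /\
    [/\ forall a, imem s' a = imem s a, rmem s' 10 = rmem s 10, rmem s' 11 = rmem s 11,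
        drawn s' = l.+1 & plays s' = plays s] /\
    rmem s' 13 = alpha R K b0 l /\ rmem s' 14 = start R K b0 l (offset K xi l)).
Proof.
move=> ss ts bs s11 sd /andP[x0 x1] KW.
apply: (@ok_le _ _ _ _ _ _ _ ((W ^ 3).+1.+1 + 8)%N); last by wl.
rewrite addnC; step; step; rewrite s11; step; rewrite (sr4 ss) -/(delta R b0 l) -/(alpha R K b0 l).
step; rewrite sd; step; rewrite (sr4 ss); step; step; rewrite (sr1 ss); step.
set s0 := set_real _ 14 _.
have Kx0 : 0 <= K%:R * xi l by rewrite mulr_ge0.
(* A draw of at most 1 makes the subtraction loop stop after at most [K] turns, having counted
   exactly [offset]. *)
have tK : (Num.truncn (K%:R * xi l) <= K)%N.
  rewrite -ltnS truncn_lt_nat //; apply: (@le_lt_trans _ _ K%:R); last by rewrite ltr_nat.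
  by rewrite -[X in _ <= X]mulr1 ler_wpM2l.
have oE : offset K xi l = Num.truncn (K%:R * xi l) by apply/minn_idPr.
pose I z s' := [/\ [/\ stat s', tabR N s' act tb e & basR s' b],
  [/\ forall a, imem s' a = imem s a, rmem s' 10 = rmem s 10, rmem s' 11 = rmem s 11,
        drawn s' = l.+1 & plays s' = plays s],
  [/\ rmem s' 12 = delta R b0 l, rmem s' 13 = alpha R K b0 l &
   rmem s' 14 = start R K b0 l z], rmem s' 50 = K%:R * xi l - z%:R &
   (z <= offset K xi l)%N].
apply: (@ok_le _ _ _ _ _ _ _ (W ^ 3)%N); last by wl.
apply: ok_last; apply: (@ok_while_W _ _ _ _ _ W W64 I (offset K xi l) 1) => //.
- by rewrite oE; exact: leq_trans KW.
- split=> //.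
  + split=> //; rewrite /s0; case: (ss) => *; split=> //.
  + by split=> //; rewrite /start mulr0 addr0.
  + by rewrite subr0.
- move=> z s2 [[ss2 t2 b2] [i2 r10 r11 dr pl] [c12 c13 c14] c50 zle] /=.
  rewrite (sr1 ss2) c50 lerBrDl natr1 -truncn_ge_nat // -oE => zlt; split=> //.
  apply: (ok_short W64); step; step; rewrite c50 (sr1 ss2) c14 c12; apply: ok_skip; split=> //.
  + by split=> //; do 2 apply: stat_real => //.
  + by split=> //=; rewrite /start -natr1; ring.
  + by rewrite /= -natr1; ring.
- move=> z s2 [[ss2 t2 b2] h [c12 c13 c14] c50 zle] /=.
  rewrite (sr1 ss2) c50 lerBrDl natr1 -truncn_ge_nat // -oE -ltnNge ltnS => zge.
  have [h1 h2 h3 h4 h5] := h; split; first by [].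
  split; first by split=> //; rewrite h3.
  split; first by [].
  by rewrite c14; congr (start _ _ _ _ _); apply/eqP; rewrite eqn_leq zle.
Qed.

End Rounding.

Section PhaseBlocks.
Variables (R : realType) (d T : nat) (N : seq 'rV[R]_d) (K : nat).
Variables (xi r : nat -> R) (W : nat).
Hypothesis W64 : (64 <= W)%N.
Hypotheses (dW : (d <= W)%N) (nNW : (size N <= W)%N).
Implicit Types (s : state R d) (tb : nat -> nat -> R) (e : nat -> R)
  (act : nat -> bool) (b : nat -> nat).

Local Notation nN := (size N).
Local Notation w := d.+2.
Local Notation stat := (stat T N K).
Local Notation memR := (memR N).
Local Notation ok := (ok N xi r).

Variable b0 : nat.
Hypotheses (K0 : (0 < K)%N) (b00 : (0 < b0)%N).

Lemma played_keep pk t m s s' : keep m s s' -> played N r pk t s -> played N r pk t s'.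
Proof. by move=> [_ h1 h2] [h3 h4]; split; rewrite ?h1 ?h2. Qed.

Lemma slots_ok s (st : pstate) l kkf pk (x := spanner T N st)
    (v := slot_val T N K b0 l (kkf l) st (cells d T K b0 kkf r l)) :
  stat s -> tabR N s st.1 x.1 (fun=> 0) -> basR s x.2 ->
  imem s 10 = (4 ^ l)%N -> (4 ^ l <= W)%N -> imem s 18 = st.2 ->
  rmem s 10 = (4 ^ l)%:R -> rmem s 13 = alpha R K b0 l ->
  rmem s 14 = start R K b0 l (kkf l) -> wf_state N st ->
  (forall j i, (j < d)%N -> (i < 4 ^ l)%N ->
    pk (sched d l + j * 4 ^ l + i)%N = slot_arm T N st j) ->
  (forall j, (j < d)%N -> (cells d T K b0 kkf r l j <= W)%N) ->
  played N r pk (minn T (sched d l)) s ->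
  ok slots_prog s (W ^ 8) (fun s' => [/\ keep0 20 s s',
    tabR N s' st.1 x.1 (est d x.1 v), basR s' x.2 &
    played N r pk (minn T (sched d l.+1)) s']).
Proof.
move=> ss ts bs s10 nW s18 r10 r13 r14 wst hpk hc hpl.
(* Each slot adds its contribution to all estimates at once, so after [j] slots they are partial
   sums. *)
pose I j s' := [/\ keep0 20 s s',
  tabR N s' st.1 x.1 (fun k => \sum_(c < j) x.1 k c * v c), basR s' x.2 &
  played N r pk (minn T (sched d l + j * 4 ^ l)) s'].
apply: (@ok_for _ _ _ _ _ W W64 I d 6) => //=.
- by rewrite (st1 ss).
- by rewrite (st3 ss).
- split; [exact: keep0_idx| |exact: basR_idx|by rewrite mul0n addn0].
  by apply: tabR_idx; apply: (tabR_ext ts) => // k kN; rewrite big_ord0.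
- move=> j s1 jd [k1 t1 b1 p1] c20 c1 c3.
  have ss1 : stat s1 by apply: keep0_stat k1 ss.
  apply: (@ok_le _ _ _ _ _ _ _ (W ^ 4 + (W ^ 4 + W ^ 5))); last by wl.
  have s10' : imem s1 10 = (4 ^ l)%N by rewrite (keep0I k1).
  have hp : slot_arm T N st j = (if x.2 j is k.+1 then k else imem s1 18).
    by rewrite (keep0I k1) // s18.
  have H := play_ok xi W64 dW nNW ss1 t1 b1 jd nW c20 s10' hp
    (slot_arm_lt T j wst).1 (fun i il => hpk j i jd il) p1.
  apply: ok_cons; apply: (ok_weaken H) => //.
  move=> s2 [[k2 t2 b2] [c21 c25 p2]].
  have ss2 : stat s2 by apply: keep0_stat k2 ss1.
  apply: ok_cons; apply: (ok_weaken (round_ok xi r W64 K0 b00 (l := l) (kk := kkf l) ss2 t2 b2 erefl _ _ c25 c21 _)) => //.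
  + by rewrite (keep0R k2) // (keep0R k1).
  + by rewrite (keep0R k2) // (keep0R k1).
  + by rewrite (keep0R k2) // (keep0R k1) // r10; exact: hc.
  move=> s3 [I3 c26]; have ss3 := memR_stat I3 isT ss2; have [k3 t3 b3] := I3.
  have E26 : rmem s3 26 = v j.
    by rewrite c26 (keep0R k2) // (keep0R k1) // r10 /v /slot_val.
  have [k3' _ _] := k3.
  apply: ok_last; apply: (ok_weaken (est_ok xi r W64 dW nNW ss3 t3 b3 jd _ E26)) => //.
    by rewrite (keep0I k3') // (keep0I k2).
  move=> s4 [k4 t4 b4]; have ss4 : stat s4 by apply: keep_stat k4 ss3.
  have [k4' _ _] := k4; split.
  + by rewrite (keep0I k4') // (keep0I k3') // (keep0I k2).
  + by rewrite (st1 ss4).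
  + by rewrite (st3 ss4).
  + split=> //.
    * apply: keep0_idx => //; apply: keep0_trans k1 _.
      apply: keep0_le (_ : keep0 21 s1 s4) => //.
      by apply: keep0_trans k2 (keep0_trans k3' (keep0_le _ k4')).
    * by apply: tabR_idx; apply: tabR_ext t4 _ _ _ => // k kN; rewrite big_ord_recr.
    * have := played_keep k4 (played_keep k3 p2).
      by rewrite -addnA -mulSnr.
- by move=> s' [h1 h2 h3 h4]; split=> //; rewrite schedS.
Qed.

Lemma best_ok s act tb e b best : stat s -> tabR N s act tb e -> basR s b ->
  imem s 18 = best -> imem s 19 = (64 + best * w)%N -> (best < nN)%N ->
  let b' := argbest N act e best in
  ok best_prog s (W ^ 6) (fun s' => [/\ memR 18 s act tb e b s', imem s' 18 = b',
    imem s' 19 = (64 + b' * w)%N & rmem s' 20 = e b']).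
Proof.
move=> ss ts bs s18 s19 bN b'; have [_ _ h3] := ts best bN.
apply: (@ok_le _ _ _ _ _ _ _ ((W ^ 5).+2)); last by wl.
step; rewrite s19 (st8 ss); step; rewrite h3.
pose bi i := iteri i (fun k c => if act k && (e c <= e k) then k else c) best.
have biN i : (i <= nN)%N -> (bi i < nN)%N.
  by elim: i => [//|i IH] iN /=; case: ifP => // _; exact: IH (ltnW iN).
pose I i s' := [/\ memR 18 s act tb e b s', imem s' 18 = bi i,
  imem s' 19 = (64 + bi i * w)%N & rmem s' 20 = e (bi i)].
have I0 : memR 18 s act tb e b s by [].
apply: ok_last; apply: (@ok_rows _ _ T _ K _ _ W W64 dW nNW I 1) => //.
- by apply: stat_real => //; exact: stat_idx.
- by move=> i s' u [h1 h2 h4 h5]; split=> //; exact: memR_idx.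
- by move=> i s' u [h1 h2 h4 h5]; split=> //; exact: memR_idx.
- by move=> i s' [h _ _ _]; exact: memR_stat h isT ss.
- by split=> //; mem I0.
- move=> i s1 iN [I1 c18 c19 c20] ss1 s30 s31; have [k1 t1 _] := I1.
  have [q1 q2 q3] := t1 i iN.
  apply: (ok_short W64); step; rewrite s31 q1.
  apply: ok_last; apply: ok_if; rewrite /= (sr1 ss1).
  case: ifP => [a|na]; last first.
    have nai : act i = false by move: na; case: (act i); rewrite ?lexx.
    by apply: ok_skip; split=> //; split=> //=; rewrite ?nai //; apply: memR_real.
  have ai : act i by move: a; case: (act i); rewrite ?ler10.
  step; rewrite s31 (st8 ss1); step; rewrite q3.
  apply: ok_last; apply: ok_if; rewrite /= c20; case: ifP => le.
    step; rewrite q3; step; rewrite s30 (st3 ss1) subn1; step; rewrite s31 (st9 ss1) addn0.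
    apply: ok_skip; split=> //; split=> //=; rewrite ?ai ?le //.
    by mem I1.
  by apply: ok_skip; split=> //; split=> //=; rewrite ?ai ?le //; mem I1.
Qed.

Lemma elim_ok s act tb e b l v : stat s -> tabR N s act tb e -> basR s b ->
  rmem s 20 = v -> rmem s 13 = alpha R K b0 l ->
  ok elim_prog s (W ^ 6)
    (memR 20 s (fun k => act k && (v <= e k + tau R d K b0 l)) tb e b).
Proof.
move=> ss ts bs s20 s13.
apply: (@ok_le _ _ _ _ _ _ _ ((W ^ 5).+3)); last by wl.
step; step; rewrite (sr5 ss); step; rewrite s13 -/(tau R d K b0 l).
set act' := fun k => _; set s0 := set_real _ 21 _.
have ss0 : stat s0 by do 3 apply: stat_real => //.
have k0 : keep 20 s s0 by do 3 apply: keep_real => //.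
have I0 : memR 22 s0 act tb e b s0 by split=> //; rewrite /s0; tab ts.
have c20 : rmem s0 20 = v by [].
have c21 : rmem s0 21 = tau R d K b0 l by [].
clearbody s0; apply: ok_last; apply: (@ok_rows _ _ T _ K _ _ W W64 dW nNW
  (fun i => memR 22 s0 (fun k => if (k < i)%N then act' k else act k) tb e b) 1) => //.
- by move=> i s' u; exact: memR_idx.
- by move=> i s' u; exact: memR_idx.
- by move=> i s' h; exact: memR_stat h isT ss0.
- move=> i s1 iN I1 ss1 s30 s31; have [k1 t1 _] := I1; have [q1 q2 q3] := t1 i iN.
  apply: (ok_short W64); step; rewrite s31 (st8 ss1); step; rewrite q3; step.
  rewrite (keepR k1) // c21.
  apply: ok_last; apply: ok_if; rewrite /= (keepR k1) // c20; case: ifP => h.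
    apply: ok_skip; split=> //.
    apply: memR_ext; [mem I1| |by []|by []].
    move=> k kN /=; rewrite ltnS [(k <= i)%N]leq_eqVlt.
    by case: (eqVneq k i) => [->|//]; rewrite ltnn /act' h andbT.
  step; step; rewrite s31; apply: ok_skip; split=> //.
  apply: memR_ext; [apply: (memR_store_act false) => //; mem I1| |by []|by []].
  move=> k kN /=; rewrite /upd ltnS [(k <= i)%N]leq_eqVlt.
  by case: (eqVneq k i) => [->|//]; rewrite /act' h andbF.
- move=> s1 h; have h' : memR 22 s0 act' tb e b s1.
    by apply: memR_ext h _ _ _ => // k kN; rewrite kN.
  exact: (memR_trans (isT : (20 <= 22)%N) k0 h').
Qed.

End PhaseBlocks.

(** * The main loop *)

Section MainLoop.
Variables (R : realType) (d T : nat) (N : seq 'rV[R]_d) (K : nat).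
Variables (xi r : nat -> R) (W : nat).
Hypothesis W64 : (64 <= W)%N.
Hypotheses (dW : (d <= W)%N) (nNW : (size N <= W)%N).
Implicit Types (s : state R d) (tb : nat -> nat -> R) (e : nat -> R)
  (act : nat -> bool) (b : nat -> nat).

Local Notation nN := (size N).
Local Notation w := d.+2.
Local Notation stat := (stat T N K).
Local Notation memR := (memR N).
Local Notation ok := (ok N xi r).

(** The clamped value is at most 2 + alpha above the start of the grid, and alpha >= 3 / 2^l. This
    bounds the turns of the rounding loop. *)
Lemma cell_le (b0 : nat) l kk (x : R) : (0 < K)%N -> (0 < b0)%N ->
  (cell K b0 l kk x <= 2 ^ l + 1)%N.
Proof.
move=> K0 b00; have a0 := alpha_gt0 R K0 b00 l; have be0 := beta_gt0 R b00 l.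
have p2 : (0 : R) < 2 ^+ l by rewrite exprn_gt0.
have a3 : 3 <= alpha R K b0 l * 2 ^+ l.
  rewrite alpha_beta /beta mulrA divfK ?gt_eqF //.
  have : (1 : R) <= K%:R by rewrite ler1n.
  have : (1 : R) <= b0%:R by rewrite ler1n.
  by move=> ? ?; nra.
rewrite /cell -(ler_nat R) natrD natrX.
apply: (@le_trans _ _ ((2 + alpha R K b0 l) / alpha R K b0 l)); last first.
  by rewrite ler_pdivrMr // mulrDl mul1r; nra.
have m1 : Num.min x 1 - start R K b0 l kk <= 2 + alpha R K b0 l.
  have : Num.min x 1 <= 1 by rewrite ge_min lexx orbT.
  rewrite /start; have : 0 <= delta R b0 l * kk%:R.
    by rewrite !mulr_ge0 // ltW.
  lra.
have [h|h] := lerP 0 ((Num.min x 1 - start R K b0 l kk) / alpha R K b0 l).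
  by apply: (@le_trans _ _ ((Num.min x 1 - start R K b0 l kk) / alpha R K b0 l));
    [rewrite truncn_le | rewrite ler_pM2r ?invr_gt0].
rewrite (truncn0Pn _ _) ?divr_ge0 ?addr_ge0 ?(ltW a0) //.
by rewrite -ltNge (lt_trans h).
Qed.

Variable b0 : nat.
Hypotheses (K0 : (0 < K)%N) (b00 : (0 < b0)%N).
Hypotheses (dpos : (0 < d)%N) (T0 : (0 < T)%N) (N0 : (0 < size N)%N).
Hypotheses (KW : (K <= W)%N) (fW : (d * (d + T) <= W)%N) (TW : (3 * T + d + 1 <= W)%N).
Hypothesis xi01 : forall k, 0 <= xi k <= 1.

Local Notation run := (real_run T N K b0 (offset K xi) r).
Local Notation pk := (index_at T N run).

(** Coordinates, estimates and basis are existential because the next phase rebuilds them; among the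
    results of a phase only the activity flags and the incumbent arm carry over. *)
Definition phaseI l s : Prop := let st := run l in
  [/\ stat s, exists tb e b, tabR N s st.1 tb e /\ basR s b,
   [/\ imem s 10 = (4 ^ l)%N, imem s 18 = st.2 & imem s 19 = (64 + st.2 * w)%N],
   [/\ rmem s 10 = (4 ^ l)%:R, rmem s 11 = beta R b0 l & drawn s = l] &
   played N r pk (minn T (sched d l)) s].

Lemma phase_ok l s : (sched d l < T)%N -> phaseI l s ->
  ok phase_prog s (W ^ 13) (phaseI l.+1).
Proof.
move=> lT [ss [tb [e [b [ts bs]]]] [s10 s18 s19] [r10 r11 sd] hp].
set st := run l in ts s18 s19.
have wst : wf_state N st by exact: run_phases_wf.
have p4W : (4 ^ l <= W)%N.
  have := sched_mul3 d l; have : (4 ^ l <= d * 4 ^ l)%N by rewrite leq_pmull.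
  by move: TW lT; clear; lia.
have cW j : (cells d T K b0 (offset K xi) r l j <= W)%N.
  apply: leq_trans (cell_le l _ _ K0 b00) _.
  have h2 : (2 ^ l <= 4 ^ l)%N by rewrite -[4%N]/(2 * 2)%N expnMn leq_pmulr ?expn_gt0.
  have := sched_mul3 d l; have : (4 ^ l <= d * 4 ^ l)%N by rewrite leq_pmull.
  by move: TW lT h2; clear; lia.
apply: (@ok_le _ _ _ _ _ _ _ (W ^ 4 + (W ^ 10 + (W ^ 12 + (W ^ 8 + (W ^ 6 + (W ^ 6 + 10))))))); last by wl.
apply: ok_cons; apply: (ok_weaken (draw_ok r W64 ss ts bs r11 sd (xi01 l) KW)) => //.
move=> s1 [[ss1 t1 b1] [[i1 q10 q11 dr1 pl1] [q13 q14]]].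
have I1 : memR 30 s1 st.1 tb e b s1 by exact: memR_refl.
apply: ok_cons; apply: (ok_weaken (init_table_ok xi r W64 dW nNW ss1 I1)) => // s2 I2.
have ss2 := memR_stat I2 isT ss1; have [k2 t2 b2] := I2.
have I2' : memR 20 s2 st.1 (tb_init T N) (fun=> 0) (fun=> 0%N) s2 by exact: memR_refl.
apply: ok_cons; apply: (ok_weaken (span_ok xi r W64 dW nNW fW ss2 I2')) => //.
rewrite -/(tab_span N T (d * (d + T)) st.1) -/(spanner T N st) => s3 I3.
have ss3 := memR_stat I3 isT ss2; have [k3 t3 b3] := I3.
have [k2' _ _] := k2; have [k3' _ _] := k3.
have k13 : keep0 20 s1 s3 by apply: keep0_trans (keep0_le _ k2') k3'.
have hpl : played N r pk (minn T (sched d l)) s3.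
  apply: played_keep k3 _; apply: played_keep k2 _.
  by case: hp => a1 a2; split; rewrite ?i1 ?pl1.
have hpk j i : (j < d)%N -> (i < 4 ^ l)%N ->
    pk (sched d l + j * 4 ^ l + i)%N = slot_arm T N st j.
  by move=> jd il; rewrite /index_at phase_of_block // slot_of_block.
have st2 : st = (st.1, st.2) by case: (st).
have e10 : imem s3 10 = (4 ^ l)%N by rewrite (keep0I k13) // i1.
have e18 : imem s3 18 = st.2 by rewrite (keep0I k13) // i1.
have e19 : imem s3 19 = (64 + st.2 * w)%N by rewrite (keep0I k13) // i1.
have g10 : rmem s3 10 = (4 ^ l)%:R by rewrite (keep0R k13) // q10.
have g13 : rmem s3 13 = alpha R K b0 l by rewrite (keep0R k13).
have g14 : rmem s3 14 = start R K b0 l (offset K xi l) by rewrite (keep0R k13).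
apply: ok_cons; apply: (ok_weaken (slots_ok xi W64 dW nNW K0 b00 ss3 t3 b3 e10 p4W e18
  g10 g13 g14 wst hpk (fun j _ => cW j) hpl)) => //.
set v := slot_val _ _ _ _ _ _ _ _.
move=> s4 [k4 t4 b4 hpl4]; have ss4 : stat s4 by apply: keep0_stat k4 ss3.
have f18 : imem s4 18 = st.2 by rewrite (keep0I k4).
have f19 : imem s4 19 = (64 + st.2 * w)%N by rewrite (keep0I k4).
apply: ok_cons; apply: (ok_weaken (best_ok xi r W64 dW nNW ss4 t4 b4 f18 f19 wst.1)) => //.
set best' := argbest _ _ _ _.
move=> s5 [I5 h18 h19 h20]; have ss5 := memR_stat I5 isT ss4; have [k5 t5 b5] := I5.
have [k5' _ _] := k5.
have h13 : rmem s5 13 = alpha R K b0 l by rewrite (keep0R k5') // (keep0R k4).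
apply: ok_cons; apply: (ok_weaken (elim_ok xi r W64 dW nNW ss5 t5 b5 h20 h13)) => //.
move=> s6 I6; have ss6 := memR_stat I6 isT ss5; have [k6 t6 b6] := I6.
have [k6' _ _] := k6.
have j10 : imem s6 10 = (4 ^ l)%N by rewrite (keep0I k6') // (keep0I k5') // (keep0I k4).
have u10 : rmem s6 10 = (4 ^ l)%:R by rewrite (keep0R k6') // (keep0R k5') // (keep0R k4).
have u11 : rmem s6 11 = beta R b0 l.
  by rewrite (keep0R k6') // (keep0R k5') // (keep0R k4) // (keep0R k13) // q11.
have runS : run l.+1 = next_state T N K b0 l v st by [].
step; rewrite j10; step; step; step; rewrite u10; step; step; rewrite u11; apply: ok_skip.
rewrite /phaseI runS; split.
- by do 3 (apply: stat_real => //); apply: stat_real => //; do 2 apply: stat_idx => //.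
- exists (spanner T N st).1, (est d (spanner T N st).1 v), (spanner T N st).2.
  by split; [tab t6 | do ! apply: basR_idx => //].
- split=> /=; first by rewrite expnS; lia.
  + by rewrite (keep0I k6').
  + by rewrite (keep0I k6').
- split=> /=; first by rewrite expnS natrM mulrC.
  + by rewrite /beta exprS invfM mulrA mulrAC.
  + by rewrite (keep0D k6') (keep0D k5') (keep0D k4) (keep0D k3') (keep0D k2').
- have [c60 cpl] := played_keep k6 (played_keep k5 hpl4).
  by split.
Qed.

(** Each phase of the schedule has at least one round, so [l <= sched d l] and fewer than T + 1
    phases are run. *)
Lemma main_loop_ok s : phaseI 0 s ->
  ok (While (ILe 60 0) phase_prog) s (W ^ 15)
    (fun s' => plays s' = [seq (arm N (pk i), r i) | i <- iota 0 T]).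
Proof.
move=> I0; have TW' : (T <= W)%N by move: TW; clear; lia.
have lsched l : (l <= sched d l)%N.
  elim: l => [//|l IH]; rewrite schedS.
  have : (0 < d * 4 ^ l)%N by rewrite muln_gt0 dpos expn_gt0.
  by move: IH; clear; lia.
apply: (@ok_while_W _ _ _ _ _ W W64 phaseI T 13) => //.
- move=> l s' Il /=; have [ss _ _ _ [c60 _]] := Il.
  rewrite c60 (st0 ss) gtn_min ltnn => lT.
  by split; [exact: leq_ltn_trans (lsched l) lT | exact: phase_ok].
- move=> l s' [ss _ _ _ [c60 cpl]] /=.
  rewrite c60 (st0 ss) gtn_min ltnn -leqNgt => lT.
  by rewrite cpl (minn_idPl lT).
Qed.

End MainLoop.

(** * Parameters and their computation *)

Section Constants.
Variables (R : realType) (d T : nat) (rho : R).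

Definition inv_rho : nat := (Num.truncn rho^-1).+1.
Definition log_len : nat := (trunc_log 2 T).+1.
(** With b0^2 >= 8 n, where n is this sum, exp(- b0^2 / 2) <= 2^(-4 n), which beats the product of
    L, d, T and 1/rho: each factor is at most a power of 2 with exponent a summand of n. *)
Definition conf : nat := (8 * (log_len + d + inv_rho))%N.
Definition conf_sqrt : nat := (Num.truncn (Num.sqrt (conf%:R : R))).+1.
(** Chosen so that the [L] phases are unlucky with total probability at most L d / K = 1 / (8
    [inv_rho]), at most rho / 8. *)
Definition cells_per_width : nat := (8 * d * log_len * inv_rho)%N.

End Constants.

Section Setup.
Variables (R : realType) (d T : nat) (N : seq 'rV[R]_d) (rho : R).
Variables (xi r : nat -> R) (W : nat).
Hypothesis W64 : (64 <= W)%N.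
Hypotheses (dW : (d <= W)%N) (nNW : (size N <= W)%N).
Implicit Types (s : state R d) (tb : nat -> nat -> R) (e : nat -> R)
  (act : nat -> bool) (b : nat -> nat).

Let R0 := inv_rho rho.
Let L := log_len T.
Let X := conf d T rho.
Let b0 := conf_sqrt d T rho.
Let K := cells_per_width d T rho.
Local Notation nN := (size N).
Local Notation w := d.+2.
Local Notation stat := (stat T N K).
Local Notation memR := (memR N).
Local Notation ok := (ok N xi r).

Hypotheses (dpos : (0 < d)%N) (T0 : (0 < T)%N) (N0 : (0 < size N)%N).
Hypotheses (rho0 : 0 < rho) (rho1 : rho <= 1).
Hypotheses (TW : (T <= W)%N) (R0W : (R0 <= W)%N) (LW : (L <= W)%N) (b0W : (b0 <= W)%N).

Lemma count_ok s x nn n : imem s nn = n -> (n <= W)%N -> imem s 3 = 1%N ->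
  rmem s 1 = 1 -> rmem s x = 0 -> x != 1%N -> nn != 50%N ->
  ok (For 50 nn (Do (ROp RAdd x x 1))) s (W ^ 3) (fun s' =>
    [/\ forall a, a != 50%N -> imem s' a = imem s a,
      forall a, a != x -> rmem s' a = rmem s a,
      rmem s' x = n%:R, drawn s' = drawn s & plays s' = plays s]).
Proof.
move=> sn nW s3 s1 sx x1 n50.
pose I i s' := [/\ forall a, a != 50%N -> imem s' a = imem s a,
      forall a, a != x -> rmem s' a = rmem s a,
      rmem s' x = i%:R, drawn s' = drawn s & plays s' = plays s].
apply: (@ok_for _ _ _ _ _ W W64 I n 1) => //.
- by rewrite eq_sym.
- by split=> //= a /negbTE ->.
- move=> i s' iN [h1 h2 h3 h4 h5] c50 cn c3.
  apply: (@ok_le _ _ _ _ _ _ _ 1); last by wl.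
  apply: ok_do; first by reflexivity.
  split=> //; split=> //=.
  + by move=> a na; rewrite (negbTE na) h1.
  + by move=> a na; rewrite (negbTE na) h2.
  + by rewrite eqxx h3 (h2 1%N) 1?eq_sym // s1 natr1.
Qed.

Lemma repeat_add_ok s y z nn n : imem s nn = n -> (n <= W)%N -> imem s 3 = 1%N ->
  nn != 50%N -> y != 50%N -> z != 50%N -> y != nn -> y != 3%N -> y != z ->
  ok (For 50 nn (Do (IAdd y y z))) s (W ^ 3) (fun s' =>
    [/\ forall a, a != 50%N -> a != y -> imem s' a = imem s a,
      forall a, rmem s' a = rmem s a,
      imem s' y = (imem s y + n * imem s z)%N, drawn s' = drawn s & plays s' = plays s]).
Proof.
move=> sn nW s3 n50 y50 z50 yn y3 yz.
pose I i s' := [/\ forall a, a != 50%N -> a != y -> imem s' a = imem s a,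
      forall a, rmem s' a = rmem s a,
      imem s' y = (imem s y + i * imem s z)%N, drawn s' = drawn s & plays s' = plays s].
apply: (@ok_for _ _ _ _ _ W W64 I n 1) => //.
- by rewrite eq_sym.
- split=> //=; first by move=> a /negbTE ->.
  by rewrite (negbTE y50) mul0n addn0.
- move=> i s' iN [h1 h2 h3 h4 h5] c50 cn c3.
  apply: (@ok_le _ _ _ _ _ _ _ 1); last by wl.
  apply: ok_do; first by reflexivity.
  rewrite /= [50%N == y]eq_sym (negbTE y50) [nn == y]eq_sym (negbTE yn) [3%N == y]eq_sym (negbTE y3).
  split=> //; split=> //=.
  + by move=> a na nb; rewrite (negbTE na) (negbTE nb) h1.
  + rewrite (negbTE y50) eqxx h3 (h1 z) //; last by rewrite eq_sym.
    by rewrite mulSn [(imem s z + _)%N]addnC addnA.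
Qed.

(** What the first instructions of the setup establish; the cells of [stat] still under construction
    are tracked separately. *)
Record base s : Prop := Base {
  bs0 : imem s 0 = T; bs1 : imem s 1 = d; bs2 : imem s 2 = nN;
  bs3 : imem s 3 = 1%N; bs4 : imem s 4 = w; bs5 : imem s 5 = 64%N;
  bs8 : imem s 8 = d.+1; bs9 : imem s 9 = 0%N;
  br0 : rmem s 0 = rho; br1 : rmem s 1 = 1;
  bd : drawn s = 0%N; bp : plays s = [::] }.

Lemma base_frame s s' : base s ->
  (forall a, a \in [:: 0; 1; 2; 3; 4; 5; 8; 9]%N -> imem s' a = imem s a) ->
  (forall a, a \in [:: 0; 1]%N -> rmem s' a = rmem s a) ->
  drawn s' = drawn s -> plays s' = plays s -> base s'.
Proof.
by move=> [h0 h1 h2 h3 h4 h5 h8 h9 r0 r1 hd hp] hi hr hd' hp'; split;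
  rewrite ?hi ?hr ?hd' ?hp'.
Qed.

Lemma R0_loop s : base s -> rmem s 30 = 0 -> rmem s 31 = 0 ->
  ok (While (RLe 31 1) (block [:: Do (ROp RAdd 30 30 1); Do (ROp RMul 31 30 0)])) s (W ^ 3)
    (fun s' => [/\ base s', forall a, imem s' a = imem s a,
      forall a, a \notin [:: 30; 31]%N -> rmem s' a = rmem s a & rmem s' 30 = R0%:R]).
Proof.
move=> bs s30 s31.
pose I i s' := [/\ base s', forall a, imem s' a = imem s a,
  forall a, a \notin [:: 30; 31]%N -> rmem s' a = rmem s a, rmem s' 30 = i%:R &
  rmem s' 31 = i%:R * rho /\ (i <= R0)%N].
have test i : (i%:R * rho <= 1) = (i < R0)%N.
  by rewrite -ler_pdivlMr // mul1r ltnS truncn_ge_nat // invr_ge0 ltW.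
apply: (@ok_while_W _ _ _ _ _ W W64 I R0 1) => //.
- by split=> //; rewrite s31 mul0r.
- move=> i s1 [b1 h1 h2 h3 [h4 h5]] /=; rewrite h4 (br1 b1) test => lt; split=> //.
  apply: (ok_short W64); step; step; rewrite h3 (br1 b1) (br0 b1) natr1; apply: ok_skip.
  split=> //.
    by apply: (base_frame b1) => // a; rewrite !inE => /orP[] /eqP ->.
  by move=> a; rewrite !inE negb_or => /andP[a1 a2] /=; rewrite (negbTE a1) (negbTE a2) h2 // !inE negb_or a1.
- move=> i s1 [b1 h1 h2 h3 [h4 h5]] /=; rewrite h4 (br1 b1) test -leqNgt => ge.
  by split=> //; rewrite h3; congr (_%:R); apply/eqP; rewrite eqn_leq h5.
Qed.

Lemma L_loop s : base s -> rmem s 32 = 0 -> imem s 50 = 1%N ->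
  ok (While (ILe 50 0) (block [:: Do (IAdd 50 50 50); Do (ROp RAdd 32 32 1)])) s (W ^ 3)
    (fun s' => [/\ base s', forall a, a != 50%N -> imem s' a = imem s a,
      forall a, a != 32%N -> rmem s' a = rmem s a & rmem s' 32 = L%:R]).
Proof.
move=> bs s32 s50.
pose I i s' := [/\ base s', forall a, a != 50%N -> imem s' a = imem s a,
  forall a, a != 32%N -> rmem s' a = rmem s a, rmem s' 32 = i%:R &
  imem s' 50 = (2 ^ i)%N /\ (i <= L)%N].
have test i : (2 ^ i <= T)%N = (i < L)%N.
  rewrite /L /log_len ltnS; apply/idP/idP => h; first exact: trunc_log_max.
  by apply: leq_trans (trunc_logP (isT : (1 < 2)%N) T0); rewrite leq_exp2l.
apply: (@ok_while_W _ _ _ _ _ W W64 I L 1) => //.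
- move=> i s1 [b1 h1 h2 h3 [h4 h5]] /=; rewrite h4 (bs0 b1) test => lt; split=> //.
  apply: (ok_short W64); step; step; rewrite h4 h3 (br1 b1) natr1; apply: ok_skip.
  split=> //.
  + by apply: (base_frame b1) => // a ha /=; rewrite ifN //; apply: contraTneq ha => ->.
  + by move=> a na /=; rewrite (negbTE na) h1.
  + by move=> a na /=; rewrite (negbTE na) h2.
  + by split=> //=; rewrite expnS; lia.
- move=> i s1 [b1 h1 h2 h3 [h4 h5]] /=; rewrite h4 (bs0 b1) test -leqNgt => ge.
  by split=> //; rewrite h3; congr (_%:R); apply/eqP; rewrite eqn_leq h5.
Qed.

Lemma b0_loop s : base s -> rmem s 11 = 0 -> rmem s 35 = 0 -> rmem s 33 = X%:R ->
  ok (While (RLe 35 33) (block [:: Do (ROp RAdd 11 11 1); Do (ROp RMul 35 11 11)])) s (W ^ 3)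
    (fun s' => [/\ base s', forall a, imem s' a = imem s a,
      forall a, a \notin [:: 11; 35]%N -> rmem s' a = rmem s a & rmem s' 11 = b0%:R]).
Proof.
move=> bs s11 s35 s33.
pose I i s' := [/\ base s', forall a, imem s' a = imem s a,
  forall a, a \notin [:: 11; 35]%N -> rmem s' a = rmem s a, rmem s' 11 = i%:R &
  rmem s' 35 = i%:R * i%:R /\ (i <= b0)%N].
have test i : (i%:R * i%:R <= X%:R :> R) = (i < b0)%N.
  rewrite /b0 /conf_sqrt ltnS truncn_ge_nat ?sqrtr_ge0 // -/X.
  by rewrite -expr2 -[in RHS](ler_pXn2r (n := 2)) ?nnegrE ?sqrtr_ge0 ?ler0n // sqr_sqrtr.
apply: (@ok_while_W _ _ _ _ _ W W64 I b0 1) => //.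
- by split=> //; rewrite s35 mul0r.
- move=> i s1 [b1 h1 h2 h3 [h4 h5]] /=; rewrite h4 (h2 33%N) // s33 test => lt; split=> //.
  apply: (ok_short W64); step; step; rewrite h3 (br1 b1) natr1; apply: ok_skip.
  split=> //.
    by apply: (base_frame b1) => // a; rewrite !inE => /orP[] /eqP ->.
  by move=> a; rewrite !inE negb_or => /andP[a1 a2] /=; rewrite (negbTE a1) (negbTE a2) h2 // !inE negb_or a1.
- move=> i s1 [b1 h1 h2 h3 [h4 h5]] /=; rewrite h4 (h2 33%N) // s33 test -leqNgt => ge.
  by split=> //; rewrite h3; congr (_%:R); apply/eqP; rewrite eqn_leq h5.
Qed.

Lemma setup_ok : ok setup_prog (init T N rho) (W ^ 7) (fun s =>
  [/\ stat s, exists tb e b, tabR N s (fun=> true) tb e /\ basR s b,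
   [/\ imem s 10 = 1%N, imem s 18 = 0%N & imem s 19 = 64%N],
   [/\ rmem s 10 = 1, rmem s 11 = b0%:R & drawn s = 0%N] &
   imem s 60 = 1%N /\ plays s = [::]]).
Proof.
apply: (@ok_le _ _ _ _ _ _ _ (W ^ 3 + (W ^ 3 + (W ^ 3 + (W ^ 3 + (W ^ 3 + (W ^ 3 + (W ^ 3 +
  (W ^ 5).+4.+4).+4.+2).+2).+2).+2).+1).+1).+4.+3); last by wl.
do 7 step; set s1 := set_real _ 2 _.
have b1 : base s1 by rewrite /s1; split=> //=; rewrite ?addn1.
apply: ok_cons; apply: (ok_weaken (count_ok (x := 2) (bs0 b1) TW (bs3 b1) (br1 b1) _ _ _)) => //.
move=> s2 [h1 h2 x2 h4 h5].
have b2 : base s2.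
  by apply: (base_frame b1) => // a ha; rewrite ?h1 ?h2 //; apply: contraTneq ha => ->.
clear h1 h2 h4 h5; step; set s2' := set_real s2 5 _.
have b2' : base s2'.
  by apply: (base_frame b2) => // a ha /=; rewrite ifN //; apply: contraTneq ha => ->.
apply: ok_cons; apply: (ok_weaken (count_ok (x := 5) (bs1 b2') dW (bs3 b2') (br1 b2') _ _ _)) => //.
move=> s3 [h1 h2 x5 h4 h5].
have b3 : base s3.
  by apply: (base_frame b2') => // a ha; rewrite ?h1 ?h2 //; apply: contraTneq ha => ->.
have {}x2 : rmem s3 2 = T%:R by rewrite h2.
clear h1 h2 h4 h5; step; rewrite (bs5 b3) (bs9 b3); set s3' := set_idx s3 6 _.
have b3' : base s3'.
  by apply: (base_frame b3) => // a ha /=; rewrite ifN //; apply: contraTneq ha => ->.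
apply: ok_cons; apply: (ok_weaken (repeat_add_ok (y := 6) (z := 4) (bs2 b3') nNW (bs3 b3') _ _ _ _ _ _)) => //.
move=> s4 [h1 h2 x6 h4 h5].
have b4 : base s4.
  apply: (base_frame b3') => // a ha; rewrite ?h1 ?h2 //; apply: contraTneq ha => ->; by [].
have {}x6 : imem s4 6 = (64 + nN * w)%N by rewrite x6 /= (bs4 b3) addn0.
have {}x2 : rmem s4 2 = T%:R by rewrite h2.
have {}x5 : rmem s4 5 = d%:R by rewrite h2.
clear h1 h2 h4 h5; step; rewrite (bs0 b4) (bs1 b4); step; set s4' := set_idx _ 7 _.
have b4' : base s4'.
  by apply: (base_frame b4) => // a ha /=; rewrite !ifN //; apply: contraTneq ha => ->.
apply: ok_cons; apply: (ok_weaken (repeat_add_ok (y := 7) (z := 51) (bs1 b4') dW (bs3 b4') _ _ _ _ _ _)) => //.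
move=> s5 [h1 h2 x7 h4 h5].
have b5 : base s5.
  apply: (base_frame b4') => // a ha; rewrite ?h1 ?h2 //; apply: contraTneq ha => ->; by [].
have {}x7 : imem s5 7 = (d * (d + T))%N by rewrite x7 /= add0n [(T + d)%N]addnC.
have {}x6 : imem s5 6 = (64 + nN * w)%N by rewrite h1.
have {}x2 : rmem s5 2 = T%:R by rewrite h2.
have {}x5 : rmem s5 5 = d%:R by rewrite h2.
clear h1 h2 h4 h5; step; step; set s5' := set_real _ 31 _.
have b5' : base s5'.
  by apply: (base_frame b5) => // a ha /=; rewrite !ifN //; apply: contraTneq ha => ->.
apply: ok_cons; apply: (ok_weaken (R0_loop b5' _ _)) => // s6 [b6 h1 h2 x30].
have {}x7 : imem s6 7 = (d * (d + T))%N by rewrite h1.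
have {}x6 : imem s6 6 = (64 + nN * w)%N by rewrite h1.
have {}x2 : rmem s6 2 = T%:R by rewrite h2.
have {}x5 : rmem s6 5 = d%:R by rewrite h2.
clear h1 h2; step; step; set s6' := set_idx _ 50 _.
have b6' : base s6'.
  by apply: (base_frame b6) => // a ha /=; rewrite !ifN //; apply: contraTneq ha => ->.
apply: ok_cons; apply: (ok_weaken (L_loop b6' _ _)) => // s7 [b7 h1 h2 x32].
have {}x7 : imem s7 7 = (d * (d + T))%N by rewrite h1.
have {}x6 : imem s7 6 = (64 + nN * w)%N by rewrite h1.
have {}x2 : rmem s7 2 = T%:R by rewrite h2.
have {}x5 : rmem s7 5 = d%:R by rewrite h2.
have {}x30 : rmem s7 30 = R0%:R by rewrite h2.
clear h1 h2; step; rewrite x32 x5; step; rewrite x30; step; step; step; step; set s7' := set_real _ 35 _.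
have b7' : base s7'.
  by apply: (base_frame b7) => // a ha /=; rewrite !ifN //; apply: contraTneq ha => ->.
have x33 : rmem s7' 33 = X%:R by rewrite /= -!natrD -natrM.
apply: ok_cons; apply: (ok_weaken (b0_loop b7' _ _ x33)) => // s8 [b8 h1 h2 x11].
have {}x7 : imem s8 7 = (d * (d + T))%N by rewrite h1.
have {}x6 : imem s8 6 = (64 + nN * w)%N by rewrite h1.
have {}x2 : rmem s8 2 = T%:R by rewrite h2.
have {}x5 : rmem s8 5 = d%:R by rewrite h2.
have {}x30 : rmem s8 30 = R0%:R by rewrite h2.
have {}x32 : rmem s8 32 = L%:R by rewrite h2.
have x34 : rmem s8 34 = 8 by rewrite h2.
clear h1 h2; step; rewrite x34 x5; step; rewrite x32; step; rewrite x30 -!natrM.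
step; step; step; step; rewrite (bs5 b8) (bs9 b8); step; set s9 := set_real _ 10 _.
have ss9 : stat s9.
  by rewrite /s9; case: (b8) => *; split=> //=.
have c60 : imem s9 60 = 1%N by [].
have pd : plays s9 = [::] /\ drawn s9 = 0%N by rewrite /= (bp b8) (bd b8).
have C : [/\ imem s9 10 = 1%N, imem s9 18 = 0%N, imem s9 19 = 64%N, rmem s9 10 = 1 & rmem s9 11 = b0%:R].
  by split.
clearbody s9.
pose tb0 k j : R := rmem s9 (64 + k * w + j.+1)%N.
pose e0 k : R := rmem s9 (64 + k * w + d.+1)%N.
pose J i s' := [/\ keep 20 s9 s', forall k, (k < i)%N -> rmem s' (64 + k * w)%N = 1 &
  forall k, (k < nN)%N -> (forall j, (j < d)%N -> rmem s' (64 + k * w + j.+1)%N = tb0 k j) /\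
    rmem s' (64 + k * w + d.+1)%N = e0 k].
apply: ok_last; apply: (@ok_rows _ _ T _ K _ _ W W64 dW nNW J 1) => //.
- by move=> i s' v [j1 j2 j3]; split=> //; exact: keep_idx.
- by move=> i s' v [j1 j2 j3]; split=> //; exact: keep_idx.
- by move=> i s' [j1 _ _]; apply: keep_stat j1 ss9.
- move=> i s' iN [j1 j2 j3] ss' s30 s31.
  apply: (@ok_le _ _ _ _ _ _ _ 1); last by wl.
  apply: ok_do; first by reflexivity.
  rewrite s31 (sr1 ss'); split=> //; split.
  + exact: keep_store.
  + move=> k ki /=; case: eqP => // ne; apply: j2.
    rewrite ltn_neqAle -ltnS ki andbT; apply/eqP => ki'; by rewrite ki' in ne.
  + move=> k kN; have [q1 q2] := j3 k kN; split=> [j jd|] /=.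
      by rewrite -[X in _ == X]addn0 addr_inj ?andbF ?q1; try lia.
    by rewrite -[X in _ == X]addn0 addr_inj ?andbF ?q2; try lia.
- move=> s' [j1 j2 j3]; have [c1 c2 c3 c4 c5] := C; have [j1' j60 jp] := j1.
  split.
  + by apply: keep_stat j1 ss9.
  + exists tb0, e0, (fun j => imem s' (64 + j.+1)%N); split=> // k kN.
    by have [q1 q2] := j3 k kN; split=> //; exact: j2.
  + by rewrite !(keep0I j1').
  + by rewrite !(keep0R j1') // (keep0D j1') pd.2.
  + by rewrite j60 jp c60 pd.1.
Qed.

End Setup.

Section Program.
Variables (R : realType) (d T : nat) (N : seq 'rV[R]_d) (rho : R) (W : nat).
Let K := cells_per_width d T rho.
Let b0 := conf_sqrt d T rho.
Let alg := lin_alg T N K b0.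
Hypotheses (W64 : (64 <= W)%N) (nNW : (size N <= W)%N).
Hypotheses (dpos : (0 < d)%N) (T0 : (0 < T)%N) (N0 : (0 < size N)%N).
Hypotheses (rho0 : 0 < rho) (rho1 : rho <= 1).
Hypotheses (R0W : (inv_rho rho <= W)%N) (LW : (log_len T <= W)%N) (b0W : (b0 <= W)%N).
Hypotheses (KW : (K <= W)%N) (fW : (d * (d + T) <= W)%N) (TW : (3 * T + d + 1 <= W)%N).

Lemma cells_per_width_gt0 : (0 < K)%N.
Proof. by rewrite /K /cells_per_width !muln_gt0 dpos. Qed.

(** The exponent 16 covers [W ^ 7] for the setup and [W ^ 15] for the main loop. *)
Lemma bandit_prog_computes :
  computes_within bandit_prog T N rho alg (W ^ 16)%:R.
Proof.
move=> xi r xi01.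
have dW : (d <= W)%N by move: TW; clear; lia.
have TW' : (T <= W)%N by move: TW; clear; lia.
have K0 := cells_per_width_gt0.
have b00 : (0 < b0)%N by [].
pose run := real_run T N K b0 (offset K xi) r.
have : ok N xi r bandit_prog (init T N rho) (W ^ 16) (fun s' =>
    plays s' = [seq (arm N (index_at T N run i), r i) | i <- iota 0 T]).
  apply: (@ok_le _ _ _ _ _ _ _ (W ^ 7 + (W ^ 15 + 0))); last first.
    have h1 : (W ^ 7 <= W ^ 15)%N by rewrite leq_exp2l //; move: W64; clear; lia.
    by have := pow_W W64 15; move: h1; move: (W ^ 7)%N (W ^ 15)%N (W ^ 16)%N; clear; lia.
  apply: ok_cons; apply: (ok_weaken (setup_ok xi r W64 dW nNW dpos T0 N0 rho0 rho1 TW' R0W LW b0W)) => //.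
  move=> s [h1 h2 [h3 h4 h5] [h6 h7 h8] [h9 h10]].
  apply: ok_cons; apply: (ok_weaken (@main_loop_ok _ _ _ _ _ _ _ _ W64 dW nNW _ K0 b00 dpos T0 N0 KW fW TW xi01 s _)) => //.
    split=> //; first by split=> //; rewrite h7 /beta divr1.
    by rewrite sched0 minn0.
  by move=> s' hs'; exact: ok_skip.
move=> [s [m [h1 h2 h3]]]; exists s, m; split=> //.
- by rewrite h3 size_map size_iota.
- move=> t tT; rewrite h3 (nth_map 0%N) ?size_iota // nth_iota // add0n.
  congr (_, _); rewrite /alg /lin_alg -map_take take_iota size_map size_iota (minn_idPl (ltnW tT)).
  congr (arm N _); rewrite /index_at; congr (slot_arm T N _ _).
  (* The policy sees the first [t] rewards only, and these fix the state of the phase of round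
     [t]. *)
  apply: real_run_causal => // i; have /andP[ht _] := phase_ofP dpos t => hi.
  have it : (i < t)%N by exact: leq_trans hi ht.
  by rewrite (nth_map 0%N) ?size_iota // nth_iota.
- by rewrite ler_nat.
Qed.

End Program.

(** * Choice of the constants *)

Section Numerics.
Variables (R : realType) (d T : nat) (rho : R).
Hypotheses (dpos : (0 < d)%N) (T2 : (2 <= T)%N) (rho0 : 0 < rho) (rho1 : rho <= 1).
Let R0 := inv_rho rho.
Let L := log_len T.
Let b0 := conf_sqrt d T rho.
Let K := cells_per_width d T rho.
Let p : R := noise_prob d L b0.

Lemma inv_rho_ge : rho^-1 <= R0%:R.
Proof. by rewrite ltW // /R0 /inv_rho truncnS_gt. Qed.

Lemma inv_rho_le : R0%:R <= rho^-1 + 1.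
Proof. by rewrite /R0 /inv_rho -natr1 lerD2r truncn_le // invr_ge0 ltW. Qed.

Lemma inv_rho_le2 : R0%:R <= 2 / rho.
Proof.
apply: le_trans inv_rho_le _; rewrite mulr2n mulrDl mul1r lerD2l.
by rewrite invf_ge1.
Qed.

Lemma log_len_gt : (T < 2 ^ L)%N.
Proof. exact: trunc_log_ltn. Qed.

Lemma log_len_le_ln : L%:R <= 4 * ln T%:R :> R.
Proof.
(* Two factors of 2 make up the 4: ln 2 >= 1/2, and L <= 2 (L - 1) because T >= 2. *)
have T0 : (0 : R) < T%:R by rewrite ltr0n; move: T2; clear; lia.
have ln2 : 2^-1 <= ln 2 :> R.
  rewrite -[X in ln X]invrK lnV ?posrE // lerNr.
  have := @le_ln1Dx R (- 2^-1); rewrite (_ : 1 + - 2^-1 = 2^-1); last by field.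
  by apply; lra.
have h : (L.-1)%:R * ln 2 <= ln T%:R :> R.
  rewrite mulr_natl -lnXn // ler_ln ?posrE ?exprn_gt0 // -natrX ler_nat.
  by apply: trunc_logP => //; move: T2; clear; lia.
have L1 : (L <= 2 * L.-1)%N.
  have : (0 < trunc_log 2 T)%N by apply: trunc_log_max.
  by rewrite /L /log_len; lia.
apply: (@le_trans _ _ (2 * L.-1%:R)); first by rewrite -natrM ler_nat.
have : 0 <= L.-1%:R :> R by [].
nra.
Qed.

Lemma log_len_le : (L <= T)%N.
Proof.
have h : (2 ^ trunc_log 2 T <= T)%N by apply: trunc_logP => //; move: T2; clear; lia.
by apply: leq_trans h; exact: ltn_expl.
Qed.

Lemma conf_sqrt_sqr : (conf d T rho)%:R <= b0%:R ^+ 2 :> R.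
Proof.
have h : Num.sqrt (conf d T rho)%:R <= b0%:R :> R by rewrite ltW // truncnS_gt.
by rewrite -[leLHS]sqr_sqrtr // ler_pXn2r ?nnegrE ?sqrtr_ge0.
Qed.

Lemma conf_sqrt_le : b0%:R <= Num.sqrt (conf d T rho)%:R + 1 :> R.
Proof. by rewrite /b0 /conf_sqrt -natr1 lerD2r truncn_le // sqrtr_ge0. Qed.

Lemma conf_sqrt_le_conf : (b0 <= (conf d T rho).+1)%N.
Proof.
rewrite -(ler_nat R) -natr1; apply: le_trans conf_sqrt_le _; rewrite lerD2r.
have c1 : (1 : R) <= (conf d T rho)%:R by rewrite ler1n /conf; lia.
rewrite -[leRHS]sqr_sqrtr // expr2 ler_peMr ?sqrtr_ge0 //.
by rewrite -[leLHS]sqrtr1 ler_wsqrtr.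
Qed.

Lemma noise_prob_ge0 : 0 <= p.
Proof. by rewrite /p /noise_prob !mulr_ge0 ?expR_ge0. Qed.

(** One estimate for two uses: the noise failure is at most 1/(4 T) for the regret and at most 1/(4
    [inv_rho]) for replicability. *)
Lemma noise_prob_small : p * T%:R * R0%:R <= 4^-1.
Proof.
have e1 : 2 <= expR 1 :> R by have := expR_ge1Dx (1 : R); lra.
set n := (L + d + R0)%N.
have hn : expR (- (b0%:R ^+ 2 / 2)) <= (2 ^ (4 * n))%:R^-1 :> R.
  rewrite expRN lef_pV2 ?posrE ?expR_gt0 ?ltr0n ?expn_gt0 //.
  apply: (@le_trans _ _ (expR (4 * n)%:R)).
    by rewrite -[X in expR X]mulr1 expRM_natl natrX lerXn2r ?nnegrE ?expR_ge0.
  rewrite ler_expR ler_pdivlMr //; apply: le_trans conf_sqrt_sqr.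
  by rewrite -natrM ler_nat /conf -/n; lia.
(* The factors are at most 2^n, 2^L, 2^d, 2^L and 2^R0, and n + 2 L + d + R0 <= 4 n. *)
have hnat : (8 * (L * d * T * R0) <= 2 ^ (4 * n))%N.
  have l2 m : (m <= 2 ^ m)%N by apply: ltnW; exact: ltn_expl.
  have h8 : (8 <= 2 ^ n)%N by rewrite (@leq_exp2l 2 3) // /n /L /log_len /R0 /inv_rho; lia.
  apply: (@leq_trans (2 ^ n * (2 ^ L * 2 ^ d * 2 ^ L * 2 ^ R0))%N).
    by rewrite !leq_mul // ltnW // log_len_gt.
  by rewrite -!expnD leq_exp2l //; rewrite /n; lia.
have p2 : (0 : R) < (2 ^ (4 * n))%:R by rewrite ltr0n expn_gt0.
rewrite /p /noise_prob -/L -/R0.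
apply: (@le_trans _ _ ((L * d)%:R * (2 * (2 ^ (4 * n))%:R^-1) * T%:R * R0%:R)).
  by rewrite !ler_wpM2r // ler_wpM2l // ler_wpM2l.
rewrite (_ : _ * _ = (8 * (L * d * T * R0))%:R / (2 ^ (4 * n))%:R / 4); last by rewrite !natrM; field; lra.
by rewrite ler_pdivrMr // mulVf // ler_pdivrMr // mul1r ler_nat.
Qed.

Lemma regret_constant : 384 * d%:R * Num.sqrt d%:R * K%:R * b0%:R * Num.sqrt T%:R + 1 + 2 * T%:R * p <=
  1000 * 1000 * (d%:R ^+ 4 * log_1 R d * log_2 R d ^+ 2 * log_3 R d / rho ^+ 2)
    * Num.sqrt T%:R * ln T%:R `^ (3 / 2).
Proof.
have sq1 (n : nat) : (0 < n)%N -> 1 <= Num.sqrt n%:R :> R.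
  by move=> n0; rewrite -[leLHS]sqrtr1 ler_wsqrtr // ler1n.
have L0 : (0 < L)%N by []; have R00 : (0 < R0)%N by [].
have s1 : 1 <= Num.sqrt T%:R :> R by apply: sq1; move: T2; clear; lia.
have l0 : 0 <= ln T%:R :> R by have := log_len_le_ln; have : (0 : R) <= L%:R by []; lra.
have gE : ln T%:R `^ (3 / 2) = ln T%:R * Num.sqrt (ln T%:R) :> R.
  rewrite (_ : 3 / 2 = 1 + 2^-1); last by field.
  by rewrite powRD ?powRr1 ?powR12_sqrt //; apply/implyP => /eqP h; exfalso; lra.
pose q : R := Num.sqrt L%:R * Num.sqrt d%:R * Num.sqrt R0%:R.
have q1 : 1 <= q by rewrite /q !mulr_ege1 ?sq1.
(* The sum in [conf] is at most three times the product L d R0, so conf <= 24 q^2 <= (5 q)^2;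
   rounding up the root costs 1 <= q. *)
have hb : b0%:R <= 6 * q.
  have : Num.sqrt (conf d T rho)%:R <= 5 * q.
    rewrite -(@ler_pXn2r _ 2) ?nnegrE ?sqrtr_ge0 ?mulr_ge0 ?(le_trans ler01 q1) //.
    rewrite sqr_sqrtr // /q !exprMn !sqr_sqrtr // -natrX -!natrM ler_nat /conf -/L -/R0.
    have h1 : (L <= L * d * R0)%N by rewrite -mulnA leq_pmulr // muln_gt0 dpos.
    have h2 : (d <= L * d * R0)%N by rewrite mulnAC leq_pmull // muln_gt0 L0.
    have h3 : (R0 <= L * d * R0)%N by rewrite leq_pmull // muln_gt0 L0.
    by move: h1 h2 h3; move: (L * d * R0)%N; clear; lia.
  by have := conf_sqrt_le; rewrite -/b0; lra.
pose LL : R := L%:R * Num.sqrt L%:R; pose RR : R := R0%:R * Num.sqrt R0%:R.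
have LL1 : 1 <= LL by rewrite mulr_ege1 ?sq1 ?ler1n.
have RR1 : 1 <= RR by rewrite mulr_ege1 ?sq1 ?ler1n.
have hL : LL <= 8 * ln T%:R `^ (3 / 2).
  rewrite gE (_ : 8 * _ = (4 * ln T%:R) * (2 * Num.sqrt (ln T%:R))); last by ring.
  rewrite ler_pM ?sqrtr_ge0 //; first exact: log_len_le_ln.
  rewrite (_ : 2 = Num.sqrt (2 ^+ 2)); last by rewrite sqrtr_sqr ger0_norm.
  rewrite -sqrtrM ?exprn_ge0 // ler_wsqrtr // -natrX; exact: log_len_le_ln.
have hR : RR <= 4 / rho ^+ 2.
  have h2 := inv_rho_le2; have h1 : (1 : R) <= R0%:R by rewrite ler1n.
  apply: (@le_trans _ _ (R0%:R * R0%:R)).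
    rewrite ler_pM2l ?ltr0n // -[leRHS]sqr_sqrtr // expr2 ler_peMl ?sqrtr_ge0 //; exact: sq1.
  rewrite (_ : 4 / rho ^+ 2 = (2 / rho) * (2 / rho)); last by field; rewrite gt_eqF.
  by rewrite ler_pM.
pose D : R := d%:R ^+ 3.
have D1 : 1 <= D by rewrite exprn_ege1 // ler1n.
have d1 : (1 : R) <= d%:R by rewrite ler1n.
(* 48 = 8 * 6, the constants of [K] and of the bound on [b0]. *)
have main : 384 * d%:R * Num.sqrt d%:R * K%:R * b0%:R * Num.sqrt T%:R <=
    (384 * 48) * (D * LL * RR * Num.sqrt T%:R).
  have -> : (384 * 48) * (D * LL * RR * Num.sqrt T%:R) =
      384 * d%:R * Num.sqrt d%:R * K%:R * (6 * q) * Num.sqrt T%:R.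
    rewrite /q /LL /RR /K /cells_per_width -/L -/R0 !natrM /D.
    rewrite (_ : d%:R ^+ 3 = d%:R * d%:R * (Num.sqrt d%:R * Num.sqrt d%:R)); first by ring.
    by rewrite -[Num.sqrt _ * _]expr2 sqr_sqrtr // exprSr expr2.
  apply: ler_wpM2r; first exact: sqrtr_ge0.
  apply: ler_wpM2l; last exact: hb.
  exact: mulr_ge0 (mulr_ge0 (mulr_ge0 (ler0n _ _) (ler0n _ _)) (sqrtr_ge0 _)) (ler0n _ _).
have hp : T%:R * p <= 4^-1.
  apply: le_trans noise_prob_small; rewrite mulrC ler_peMr ?ler1n // mulr_ge0 //.
  exact: noise_prob_ge0.
have Y1 : 1 <= D * LL * RR * Num.sqrt T%:R by rewrite (mulr_ege1 (mulr_ege1 (mulr_ege1 D1 LL1) RR1) s1).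
have D4 : D <= d%:R ^+ 4 * log_1 R d * log_2 R d ^+ 2 * log_3 R d.
  have m1 (x : R) : 1 <= Num.max 1 x by rewrite le_max lexx.
  have -> : d%:R ^+ 4 * log_1 R d * log_2 R d ^+ 2 * log_3 R d =
      D * (d%:R * log_1 R d * log_2 R d ^+ 2 * log_3 R d) by rewrite /D exprSr; ring.
  rewrite ler_peMr ?(le_trans ler01) //.
  exact: mulr_ege1 (mulr_ege1 (mulr_ege1 d1 (m1 _)) (exprn_ege1 2 (m1 _))) (m1 _).
set g := ln _ `^ _ in hL *; set s := Num.sqrt T%:R in s1 main Y1 *.
set E := _ * log_3 R d in D4 *.
have g0 : 0 <= g by exact: powR_ge0.
have Y2 : D * LL * RR * s <= 32 * (E / rho ^+ 2 * s * g).
  rewrite (_ : 32 * _ = E * (8 * g) * (4 / rho ^+ 2) * s); last by ring.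
  have D0 := le_trans ler01 D1; have LL0 := le_trans ler01 LL1; have RR0 := le_trans ler01 RR1.
  apply: ler_wpM2r; first exact: le_trans ler01 s1.
  apply: ler_pM => //; first exact: mulr_ge0.
  exact: ler_pM.
(* The factors multiply to 384 * 48 * 32 = 589824; the additive terms, at most 3/2, are absorbed
   because [Y1] bounds the main product below by 1. *)
move: main Y1 Y2 hp; rewrite (_ : 1000 * 1000 * _ * s * g = 1000 * 1000 * (E / rho ^+ 2 * s * g)); last by ring.
by move: (D * LL * RR * s) (E / rho ^+ 2 * s * g) => y z; lra.
Qed.

(** One bound for all loop lengths and parameters. The cube accommodates the net: (3 T)^d <= T^(3 d)
    since 3 <= T^2. *)
Definition work : nat := (64 * (T ^ d) ^ 3 * R0)%N.

Lemma agree_constant : p + p + L%:R * (d%:R / K%:R) <= rho.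
Proof.
have L0 : (0 < L)%N by []; have R00 : (0 < R0)%N by [].
have h : R0%:R^-1 <= rho.
  by rewrite -[leRHS]invrK lef_pV2 ?posrE ?invr_gt0 ?ltr0n // inv_rho_ge.
have e : L%:R * (d%:R / K%:R) = 8^-1 * R0%:R^-1 :> R.
  rewrite /K /cells_per_width -/L -/R0 !natrM; field.
  by rewrite !pnatr_eq0 -!lt0n ?dpos ?L0 ?R00.
have hp : p <= 4^-1 * R0%:R^-1.
  rewrite ler_pdivlMr ?ltr0n //; apply: le_trans noise_prob_small.
  rewrite ler_pM2r ?ltr0n // ler_peMr ?ler1n //; last by move: T2; clear; lia.
  exact: noise_prob_ge0.
have : 0 < R0%:R^-1 :> R by rewrite invr_gt0 ltr0n.
rewrite e; lra.
Qed.

Lemma work_bounds : [/\ (64 <= work)%N, ((3 * T) ^ d <= work)%N, (R0 <= work)%N,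
  (L <= work)%N & (b0 <= work)%N] /\
  [/\ (K <= work)%N, (d * (d + T) <= work)%N & (3 * T + d + 1 <= work)%N].
Proof.
have R00 : (0 < R0)%N by [].
have T0 : (0 < T)%N by move: T2; clear; lia.
set X := (T ^ d)%N.
have X0 : (0 < X)%N by rewrite expn_gt0 T0.
have TX : (T <= X)%N by rewrite -{1}[T]expn1 leq_exp2l.
have dX : (d <= X)%N.
  by apply: (leq_trans (ltnW (ltn_expl d (isT : 1 < 2)%N))); rewrite leq_exp2r.
have LX : (L <= X)%N by exact: leq_trans log_len_le TX.
have X3 : (X <= X ^ 2 <= X ^ 3)%N by rewrite -{1}[X]expn1 !leq_pexp2l.
have wE : (X ^ 3 * R0 * 64 = work)%N by rewrite /work -/X mulnC mulnA.
have XR : (X ^ 3 <= X ^ 3 * R0)%N by rewrite leq_pmulr.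
have XR1 : (R0 <= X ^ 3 * R0)%N by rewrite leq_pmull // expn_gt0 X0.
have X30 : (0 < X ^ 3)%N by rewrite expn_gt0 X0.
have X2 a b : (a <= X)%N -> (b <= X)%N -> (a * b <= X ^ 2)%N by exact: leq_mul.
split; split.
- by move: X30 XR wE; clear; lia.
- apply: (@leq_trans (X ^ 3)); last by move: XR wE; clear; lia.
  rewrite /X -expnM [(d * 3)%N]mulnC expnM leq_exp2r // -[3%N in leqRHS]/(2 + 1)%N expnD expn1.
  by rewrite leq_mul2r (@leq_trans (2 ^ 2)) ?orbT // leq_exp2r.
- by move: XR1 wE; clear; lia.
- by move: X3 LX XR wE; clear; lia.
- have := conf_sqrt_le_conf; rewrite -/b0 /conf -/L -/R0.
  by move: X3 LX dX XR XR1 wE R00; clear; lia.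
- rewrite /K /cells_per_width -/L -/R0 -wE [leqRHS]mulnC mulnA leq_mul2r.
  by have := X2 _ _ dX LX; move: X3; rewrite -mulnA; clear; lia.
- have := X2 _ _ dX dX; have := X2 _ _ dX TX; rewrite mulnDr.
  by move: X3 XR wE; clear; lia.
- by move: X3 dX TX X0 XR wE; clear; lia.
Qed.

End Numerics.

Definition bandit_alg (R : realType) (d T : nat) (N : seq 'rV[R]_d) (rho : R) : policy R d :=
  lin_alg T N (cells_per_width d T rho) (conf_sqrt d T rho).

(* alg d T N rho is the algorithm run on the horizon T, the action set with
   1/T-net N and the parameter rho; prog is the real-RAM program computing it,
   and q is a polynomial in two variables. *)
Theorem theorem10 (R : realType) :
  exists (C : R) (alg : forall d : nat, nat -> seq 'rV[R]_d -> R -> policy R d)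
    (prog : cmd) (q : {poly {poly R}}),
  0 < C /\
  forall (T : nat) (rho : R) (d : nat) (A : set 'rV[R]_d) (N : seq 'rV[R]_d),
    (2 <= T)%N -> 0 < rho <= 1 -> (1 <= d)%N ->
    infinite_set A -> (forall a, A a -> l2norm a <= 1) ->
    is_net T A N ->
    [/\ forall xi h, A (alg d T N rho xi h),
        replicable (alg d T N rho) T rho,
        forall theta : 'rV[R]_d, l2norm theta <= 1 ->
        forall (d0 : measure_display) (Omega : measurableType d0)
          (P : probability Omega R) (xi eta : nat -> {RV P >-> R}),
          one_execution T xi eta ->
          (expected_regret A (alg d T N rho) T theta xi eta <=
           (C * (d%:R ^+ 4 * log_1 R d * log_2 R d ^+ 2 * log_3 R d
                 / rho ^+ 2)
              * Num.sqrt T%:R * ln T%:R `^ (3 / 2))%:E)%E &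
        computes_within prog T N rho (alg d T N rho)
          (q.[(T%:R ^+ d)%:P].[rho^-1])].
Proof.
(* The outer variable of the polynomial stands for T^d and the inner one for 1/rho: it is the 16th
   power of a bound on [work], with [inv_rho] replaced by 1/rho + 1. *)
exists (1000 * 1000), (@bandit_alg R), bandit_prog, ((64%:R * 'X ^+ 3 * ('X + 1)%:P) ^+ 16).
split; first by rewrite mulr_gt0 ?ltr0n.
move=> T rho d A N T2 /andP[rho0 rho1] dpos infA A1 netA.
have T0 : (0 < T)%N by exact: leq_trans T2.
have [_ sN NA near] := netA.
have N0 : (0 < size N)%N.
  have [a Aa] : A !=set0 by exact: infinite_setN0.
  by have [a' a'N _] := near a Aa; case: (N) a'N.
have uN : unit_arms N by move=> a aN; apply: A1; exact: NA.
have K0 : (0 < cells_per_width d T rho)%N by exact: cells_per_width_gt0.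
have b00 : (0 < conf_sqrt d T rho)%N by [].
have TL := log_len_gt T.
split.
- move=> xi h; apply: NA; apply: mem_nth; exact: index_at_lt.
- move=> theta htheta d0 Omega P xi eta1 eta2 [uxi noise indep].
  apply: (agree_prob dpos T0 K0 b00 TL N0 htheta uxi).
  + by apply: (mutually_independent_inj (g := inl) _ indep) => k k' [].
  + by apply: (mutually_independent_inj (g := fun t => inr (inl t)) _ indep) => k k' [].
  + by apply: (mutually_independent_inj (g := fun t => inr (inr t)) _ indep) => k k' [].
  + by move=> t tT c; have [[_ +] _] := noise t tT; apply.
  + by move=> t tT c; have [[_ h] /same_law_mmt <-] := noise t tT.
  + exact: agree_constant.
- move=> theta htheta d0 Omega P xi eta [uxi noise indep].
  apply: le_trans (regret_bound dpos T0 K0 b00 TL uN N0 htheta xi netA A1 _ _) _.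
  + by apply: (mutually_independent_inj (g := inr) _ indep) => k k' [].
  + by move=> t tT c; have [_ +] := noise t tT; apply.
  + by rewrite lee_fin; exact: regret_constant.
- have [[w1 w2 w3 w4 w5] [w6 w7 w8]] := work_bounds dpos T2 rho0 rho1.
  move=> xi r xi01.
  have [s [n [h1 h2 h3 h4]]] := bandit_prog_computes w1 (leq_trans sN w2) dpos T0 N0
    rho0 rho1 w3 w4 w5 w6 w7 w8 r xi01.
  exists s, n; split=> //; apply: le_trans h4 _.
  rewrite !(horner_exp, hornerM, hornerC, hornerX, hornerMn, hornerD, horner_polyC).
  have Y0 : 0 <= rho^-1 by rewrite invr_ge0 ltW.
  have wE : (work d T rho)%:R = 64 * (T%:R ^+ d) ^+ 3 * (inv_rho rho)%:R :> R.
    by rewrite /work !natrM !natrX.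
  have wle : (work d T rho)%:R <= 64 * (T%:R ^+ d) ^+ 3 * (rho^-1 + 1).
    by rewrite wE ler_wpM2l ?mulr_ge0 ?exprn_ge0 ?inv_rho_le.
  by rewrite natrX; apply: lerXn2r; rewrite ?nnegrE // (le_trans _ wle).
Qed.
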